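(* Let $(M,g)$ be a two-dimensional compact nontrapping Riemannian manifold with strictly convex boundary, $f:M\to\mathbb{R}$ piecewise constant on a regular tiling of $M$, and $p\in\partial M$ a vertex of the tiling. Let $\Delta_1,\dots,\Delta_N$ be the tiles containing $p$, enumerated by increasing maximal angle of their tangent cones with respect to the orthonormal basis $(\omega,\nu)$ of $T_pM$, where $\nu$ is the inward pointing unit normal to $\partial M$ at $p$ and $\omega\in T_p\partial M$ is a unit vector; thus $\Delta_1$ and $\Delta_N$ are the two tiles at $p$ having an edge at $p$ along $\partial M$ (on the side of $\omega$ and $-\omega$ respectively). Let $a_1,a_N$ be the values of $f$ on the interiors of $\Delta_1,\Delta_N$. Then for $i=1,N$, $$a_i=\frac{\kappa}{2}\lim_{\varepsilon\to0^+}\frac1\varepsilon\,\mathcal{I}f(\gamma_i^\varepsilon),$$ where $\kappa$ is the curvature of $\partial M$ at $p$, and $\gamma_1^\varepsilon$ (resp. $\gamma_N^\varepsilon$) is the geodesic of $M$ starting from $p$ with initial velocity $\omega+\varepsilon\nu$ (resp. $-\omega+\varepsilon\nu$).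
   Context: Strictly convex boundary: the second fundamental form of $\partial M$ (with respect to the inward normal) is positive definite; $\kappa>0$ denotes its value on unit vectors at $p$. Nontrapping: every maximal geodesic of $M$ meets $\partial M$ in finite time. $\mathcal{I}f(\gamma)=\int_\gamma f\,ds$ (arc length integral) for a geodesic $\gamma$ of $M$ joining boundary points; the geodesics $\gamma_i^\varepsilon$ are followed until they meet $\partial M$ again. A regular $2$-simplex in $M$ is the image of a $C^\infty$-embedding of the standard $2$-simplex. Interior points have depth $0$, points in the relative interior of an edge depth $1$, corner points depth $2$. A regular tiling is a locally finite collection of regular $2$-simplices (tiles) covering $M$, with pairwise disjoint interiors, such that any point common to two tiles has the same depth in both. A function is piecewise constant on the tiling if it is constant on the interior of each tile and vanishes on the boundaries of the tiles. The tangent cone $C_p\Delta\subset T_pM$ of a tile $\Delta\ni p$ is the set of initial velocities $\dot\sigma(0)$ of $C^\infty$ curves $\sigma$ starting at $p$ and staying in $\Delta$. *)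

(* Defs.v *)
From HB Require Import structures.
From mathcomp Require Import all_boot all_order all_algebra.
From mathcomp Require Import all_classical all_reals all_analysis.

Set Implicit Arguments.
Unset Strict Implicit.
Unset Printing Implicit Defensive.

Import Order.TTheory GRing.Theory Num.Theory.
Import numFieldTopology.Exports numFieldNormedType.Exports.

Local Open Scope classical_set_scope.
Local Open Scope ring_scope.

Section Smoothness.
Context {R : realType}.

(* Class C^k on the set U, which is meant to be open.  In finite dimension,
   asking for all directional derivatives is the same as asking for the partial
   ones. *)
Fixpoint Ck {V W : normedModType R} (k : nat) (U : set V) (f : V -> W) : Prop :=
  (forall x, U x -> {for x, continuous f}) /\
  match k with
  | 0 => True
  | k'.+1 => forall v : V,
      (forall x, U x -> derivable f x v) /\ Ck k' U (fun x => 'D_v f x)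
  end.

(* F is a C^oo extension of the restriction of f to A near x. *)
Definition smooth_extension {V W : normedModType R}
    (A : set V) (f : V -> W) (x : V) (F : V -> W) : Prop :=
  exists U : set V, [/\ open U, U x, (forall k, Ck k U F) &
    forall y, A y -> U y -> f y = F y].

Definition smooth_on {V W : normedModType R} (A : set V) (f : V -> W) : Prop :=
  forall x, A x -> exists F, smooth_extension A f x F.

Definition immersion_on {V W : normedModType R} (A : set V) (f : V -> W) : Prop :=
  forall x, A x -> exists F, smooth_extension A f x F /\
    forall v : V, v != 0 -> 'D_v F x != 0.

(* Derivative at t relative to J: it is one-sided when t is an endpoint of the
   interval J. *)
Definition derive_within {W : normedModType R} (J : set R) (f : R -> W) (t : R)
    : W :=
  lim ((fun s => (s - t)^-1 *: (f s - f t)) @ within J t^').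

(* Directional derivative at x relative to A: only the steps that stay in A are
   considered, so that normal derivatives make sense at the boundary of the
   closed half-plane. *)
Definition dderive_within {V W : normedModType R} (A : set V) (f : V -> W)
    (x v : V) : W :=
  derive_within [set h | A (x + h *: v)] (fun h => f (x + h *: v)) 0.

End Smoothness.

Notation plane R := 'rV[R]_2.

Section Surfaces.
Context {R : realType} {M : topologicalType}.

Definition half_plane : set (plane R) := [set u | 0 <= u 0 1].

Record chart := Chart {
  chart_dom : set M ;
  chart_map :> M -> plane R ;
  chart_inv : plane R -> M ;
  chart_open : open chart_dom ;
  chart_img_open : exists O : set (plane R),
    open O /\ chart_map @` chart_dom = O `&` half_plane ;
  chart_mapK : forall x, chart_dom x -> chart_inv (chart_map x) = x ;
  chart_map_continuous : {within chart_dom, continuous chart_map} ;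
  chart_inv_continuous :
    {within chart_map @` chart_dom, continuous chart_inv} }.

Definition chart_img (c : chart) : set (plane R) := c @` chart_dom c.

Definition overlap (c d : chart) : set (plane R) :=
  c @` (chart_dom c `&` chart_dom d).

Definition transition (c d : chart) : plane R -> plane R := d \o chart_inv c.

(* Jacobian matrix acting on row vectors: v has image v *m jacobian c d u. *)
Definition jacobian (c d : chart) (u : plane R) : 'M[R]_2 :=
  \matrix_(i, j)
    (dderive_within (overlap c d) (transition c d) u (delta_mx 0 i) : plane R) 0 j.

(* chart_at x is a preferred chart around x.  Tangent vectors at x are
   represented by their components in it, that is T_x M is identified with
   plane R. *)
Record surface := Surface {
  atlas : set chart ;
  chart_at : M -> chart ;
  chart_at_atlas : forall x, atlas (chart_at x) ;
  chart_at_dom : forall x, chart_dom (chart_at x) x ;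
  transition_smooth : forall c d, atlas c -> atlas d ->
    smooth_on (overlap c d) (transition c d) ;
  surface_hausdorff : hausdorff_space M ;
  surface_second_countable : @second_countable M }.

Definition boundary (S : surface) : set M :=
  [set x | chart_at S x x 0 1 = 0].

(* metric_mx c u is the Gram matrix of the coordinate frame of the chart c at
   the point of coordinates u. *)
Record riemannian_metric (S : surface) := RiemannianMetric {
  metric_mx : chart -> plane R -> 'M[R]_2 ;
  metric_sym : forall c u, atlas S c -> chart_img c u ->
    (metric_mx c u)^T = metric_mx c u ;
  metric_posdef : forall c u (v : plane R), atlas S c -> chart_img c u -> v != 0 ->
    0 < (v *m metric_mx c u *m v^T) 0 0 ;
  metric_smooth : forall c, atlas S c -> smooth_on (chart_img c) (metric_mx c) ;
  metric_compat : forall c d u, atlas S c -> atlas S d -> overlap c d u ->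
    metric_mx c u =
      jacobian c d u *m metric_mx d (transition c d u) *m (jacobian c d u)^T }.

Variables (S : surface) (g : riemannian_metric S).

Definition inner (x : M) (v w : plane R) : R :=
  (v *m metric_mx g (chart_at S x) (chart_at S x x) *m w^T) 0 0.

(* d_i g_jl in the chart c *)
Definition dmetric (c : chart) (u : plane R) (i j l : 'I_2) : R :=
  (dderive_within (chart_img c) (metric_mx g c) u (delta_mx 0 i) : 'M[R]_2) j l.

(* Gamma^k_ij in the chart c *)
Definition christoffel (c : chart) (u : plane R) (k i j : 'I_2) : R :=
  2^-1 * \sum_l invmx (metric_mx g c u) k l *
    (dmetric c u i j l + dmetric c u j i l - dmetric c u l i j).

(* The covariant derivative at u, along v, of the vector field with constant
   components w in the chart c. *)
Definition connection (c : chart) (u v w : plane R) : plane R :=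
  \row_k \sum_i \sum_j christoffel c u k i j * v 0 i * w 0 j.

(* For x on the boundary, the boundary is {u | u 0 1 = 0} in the chart. *)
Definition tangent_to_boundary (v : plane R) : Prop := v 0 1 = 0.

Definition inward_unit_normal (x : M) (nu : plane R) : Prop :=
  [/\ inner x nu nu = 1,
      (forall v, tangent_to_boundary v -> inner x v nu = 0) & 0 < nu 0 1].

(* <nabla_v W, nu> for v, w tangent to the boundary at x, where W is the
   extension of w with constant components, a field tangent to the boundary. *)
Definition second_fundamental_form (x : M) (nu v w : plane R) : R :=
  inner x (connection (chart_at S x) (chart_at S x x) v w) nu.

Definition strictly_convex_boundary : Prop :=
  forall x nu, boundary S x -> inward_unit_normal x nu ->
  forall v, tangent_to_boundary v -> v != 0 ->
    0 < second_fundamental_form x nu v v.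

(* Curves are total functions of which only the values on an interval I
   matter. *)
Definition chart_times (c : chart) (I : set R) (gam : R -> M) : set R :=
  I `&` gam @^-1` chart_dom c.

Definition smooth_curve (I : set R) (gam : R -> M) : Prop :=
  {within I, continuous gam} /\
  forall c, atlas S c ->
    smooth_on (V := R^o) (chart_times c I gam) (c \o gam).

Definition chart_velocity (c : chart) (I : set R) (gam : R -> M) (t : R)
    : plane R :=
  derive_within (chart_times c I gam) (c \o gam) t.

Definition chart_acceleration (c : chart) (I : set R) (gam : R -> M) (t : R)
    : plane R :=
  derive_within (chart_times c I gam) (chart_velocity c I gam) t.

Definition velocity (I : set R) (gam : R -> M) (t : R) : plane R :=
  chart_velocity (chart_at S (gam t)) I gam t.

Definition speed (I : set R) (gam : R -> M) (t : R) : R :=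
  Num.sqrt (inner (gam t) (velocity I gam t) (velocity I gam t)).

Definition geodesic (I : set R) (gam : R -> M) : Prop :=
  [/\ is_interval I, (exists s t, [/\ I s, I t & s < t]), smooth_curve I gam &
    forall c, atlas S c -> forall t, chart_times c I gam t ->
      chart_acceleration c I gam t +
      connection c (c (gam t)) (chart_velocity c I gam t)
        (chart_velocity c I gam t) = 0].

Definition maximal_geodesic (I : set R) (gam : R -> M) : Prop :=
  geodesic I gam /\
  forall I' gam', geodesic I' gam' -> I `<=` I' ->
    (forall t, I t -> gam' t = gam t) -> I' `<=` I.

(* Every nonconstant maximal geodesic, followed from any of its points, reaches
   the boundary in finite time. *)
Definition nontrapping : Prop :=
  forall I gam, maximal_geodesic I gam ->
    (exists s t, [/\ I s, I t & gam s <> gam t]) ->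
  forall t0, I t0 -> exists t, [/\ I t, t0 <= t & boundary S (gam t)].

(* gam is the geodesic starting from p with initial velocity v, followed until
   it meets the boundary again, which happens at time T. *)
Definition geodesic_chord (p : M) (v : plane R) (T : R) (gam : R -> M) : Prop :=
  [/\ 0 < T, geodesic `[0, T] gam, gam 0 = p & velocity `[0, T] gam 0 = v] /\
  (forall t, 0 < t < T -> ~ boundary S (gam t)) /\ boundary S (gam T).

Definition xray (f : M -> R) (T : R) (gam : R -> M) : R :=
  \int[lebesgue_measure]_(t in `[0, T]) (f (gam t) * speed `[0, T] gam t).

(* The standard 2-simplex; the barycentric coordinates of u are
   u 0 0, u 0 1 and 1 - u 0 0 - u 0 1. *)
Definition simplex : set (plane R) :=
  [set u | [/\ 0 <= u 0 0, 0 <= u 0 1 & u 0 0 + u 0 1 <= 1]].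

Definition depth (u : plane R) : nat :=
  ((u 0 0 == 0)%R + (u 0 1 == 0)%R + (u 0 0 + u 0 1 == 1)%R)%N.

(* By compactness of the simplex, an injective immersion is an embedding. *)
Definition simplex_embedding (s : plane R -> M) : Prop :=
  [/\ {within simplex, continuous s}, {in simplex &, injective s} &
    forall c, atlas S c ->
      immersion_on (simplex `&` s @^-1` chart_dom c) (c \o s)].

Section Tiling.
Variables (K : Type) (s : K -> plane R -> M).

Definition tile (k : K) : set M := s k @` simplex.

Definition tile_interior (k : K) : set M :=
  s k @` [set u | simplex u /\ depth u = 0%N].

Definition tile_boundary (k : K) : set M :=
  s k @` [set u | simplex u /\ (0 < depth u)%N].

Definition regular_tiling : Prop :=
  [/\ (forall k, simplex_embedding (s k)),
      (forall x : M, exists U : set M, nbhs x U /\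
         finite_set [set k | tile k `&` U !=set0]),
      (forall x, exists k, tile k x),
      (forall k l, k <> l -> tile_interior k `&` tile_interior l = set0) &
      (forall k l u v, simplex u -> simplex v -> s k u = s l v ->
         depth u = depth v)].

Definition tiling_vertex (x : M) : Prop :=
  exists k u, [/\ simplex u, depth u = 2%N & s k u = x].

Definition piecewise_constant (f : M -> R) : Prop :=
  forall k, (exists a, forall x, tile_interior k x -> f x = a) /\
            (forall x, tile_boundary k x -> f x = 0).

End Tiling.

Definition tangent_cone (p : M) (D : set M) : set (plane R) :=
  [set v | exists tau (sig : R -> M),
    [/\ 0 < tau, smooth_curve `[0, tau] sig, sig 0 = p,
        (forall t, 0 <= t <= tau -> D (sig t)) &
        velocity `[0, tau] sig 0 = v]].

(* The largest polar angle, with respect to the basis (om, nu), of a nonzero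
   vector of the cone C. *)
Definition max_angle (om nu : plane R) (C : set (plane R)) : R :=
  sup [set th | 0 <= th < 2 * pi /\
    exists2 r, 0 < r & C ((r * cos th) *: om + (r * sin th) *: nu)].

(* The indices 0, ..., n of D correspond to 1, ..., N with N = n + 1. *)
Definition tile_enumeration (K : Type) (s : K -> plane R -> M) (p : M)
    (om nu : plane R) (n : nat) (D : 'I_n.+1 -> K) : Prop :=
  (forall k, tile s k p <-> exists i, D i = k) /\
  (forall i j : 'I_n.+1, (i < j)%N ->
     max_angle om nu (tangent_cone p (tile s (D i))) <
     max_angle om nu (tangent_cone p (tile s (D j)))).

End Surfaces.

Arguments chart : clear implicits.
Arguments surface : clear implicits.

(* Main.v *)
Require Import Defs.
From HB Require Import structures.
From mathcomp Require Import all_boot all_order all_algebra.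
From mathcomp Require Import all_classical all_reals all_analysis.
From mathcomp Require Import measurable_realfun ring lra.

Set Implicit Arguments.
Unset Strict Implicit.
Unset Printing Implicit Defensive.

Import Order.TTheory GRing.Theory Num.Theory.
Import numFieldTopology.Exports numFieldNormedType.Exports.

Local Open Scope classical_set_scope.
Local Open Scope ring_scope.

(** Let [c] be the chart at [p] and [x = c \o gam].  The second component of [x]
    vanishes exactly on the boundary, and the geodesic equation gives it, up to the
    factor [nu 0 1], the second derivative [- kappa + o(1)] as long as [x] stays near
    [c p] and its velocity near [om].  Hence the chord with initial velocity
    [om + e *: nu] follows [e t - kappa t^2 / 2], it returns to the boundary at a time
    [T e] equivalent to [2 e / kappa], and it stays in any prescribed cone around [om].

    In the chart, a tile at [p] is tangent to an angular sector.  Covering the half-plane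
    directions, and disjointness of the interiors, force these sectors to tile [0, pi], so
    that the tile of smallest (resp. largest) maximal angle is the only one whose sector
    contains [om] (resp. [- om]).  The other tiles avoid a cone around that direction; since
    the tiles cover a neighbourhood of [p], the cone minus the boundary consists of interior
    points of that single tile, and [f] is constant along the chord. *)

(** * Differential calculus in the plane *)

(** The chord runs in a thin layer along the boundary, and [om] lies on the rim of the sector of the
    end tile: the tangent sector of that tile does not tell which points so close to its rim belong
    to it. The end tile is therefore reached by elimination. Missing a closed sector is an open
    condition on the direction, so the other tiles miss all directions near [om], uniformly at small
    distances, and the covering leaves one tile. As [f] vanishes on the boundaries of the tiles,
    membership is not enough: a point of the cone off the boundary of [M] has a neighbourhood inside
    the tile, and local injectivity of the parametrization then forces depth 0. No regularity of the
    family of geodesics in [e] is given. All estimates are thus uniform over the curves satisfying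
    the geodesic equation with the prescribed initial velocity, and come from a bootstrap in time.
    At the boundary derivatives are one-sided; they are computed from smooth extensions across it.
    The constant: the return time is about [2 e / kappa] and the speed tends to 1, so the integral
    is about [2 a e / kappa]. *)

Lemma addmxE (V : zmodType) m n (A B : 'M[V]_(m, n)) i j : (A + B) i j = A i j + B i j.
Proof. by rewrite mxE. Qed.

Lemma oppmxE (V : zmodType) m n (A : 'M[V]_(m, n)) i j : (- A) i j = - A i j.
Proof. by rewrite mxE. Qed.

Lemma scalemxE (K : comNzRingType) m n (a : K) (A : 'M[K]_(m, n)) i j :
  (a *: A) i j = a * A i j.
Proof. by rewrite mxE. Qed.

(** Completeness is what the Banach fixed point theorem requires in [locally_surjective]. *)
HB.instance Definition _ (R : realType) m n :=
  Uniform_isComplete.Build 'M[R]_(m, n) cauchy_cvg.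

Section Calculus.
Context {R : realType}.
Implicit Types (V W : normedModType R).

Lemma is_derive_line V W (F : V -> W) (a v : V) (t : R) :
  derivable F (a + t *: v) v ->
  is_derive t (1 : R) (fun h : R => F (a + h *: v)) ('D_v F (a + t *: v)).
Proof.
move=> dF.
have E : (fun h : R => h^-1 *: (((fun h : R => F (a + h *: v)) \o shift t) (h *: 1) -
     F (a + t *: v))) =
   (fun h => h^-1 *: ((F \o shift (a + t *: v)) (h *: v) - F (a + t *: v))).
  apply/funext => h /=; congr (_ *: (F _ - _)).
  by rewrite [h%:A]mulr1 scalerDl addrCA.
by split; rewrite /derivable /derive E.
Qed.

(** Rescaling to the parameter interval [0, 1] makes one statement serve for steps [h] of either
    sign and for [h = 0]. *)
Lemma mean_value_line V (F : V -> R) (a v : V) (h : R) :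
  (forall c : R, 0 <= c <= 1 -> derivable F (a + (c * h) *: v) v) ->
  exists2 c : R, 0 <= c <= 1 & F (a + h *: v) - F a = h * 'D_v F (a + (c * h) *: v).
Proof.
move=> dF.
have D (c : R) : c \in `[0, 1] -> is_derive c (1 : R) (fun t : R => F (a + t *: (h *: v)))
     (h * 'D_v F (a + (c * h) *: v)).
  rewrite in_itv/= => c01.
  have := @is_derive_line _ _ F a v (c * h) (dF c c01) => D1.
  have -> : (fun t : R => F (a + t *: (h *: v))) =
      (fun h0 => F (a + h0 *: v)) \o (fun t => t * h).
    by apply/funext => t /=; rewrite scalerA.
  have D2 : is_derive c (1 : R) (fun t : R => t * h) h.
    have -> : (fun t : R => t * h) = h \*: (@id R).
      by apply/funext => t; rewrite /= mulrC.
    have : is_derive c (1 : R) (h \*: @id R) (h *: (1 : R)) by exact: is_deriveZ.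
    by rewrite [_ *: _]mulr1.
  by rewrite mulrC; exact: is_derive1_comp.
have C : {within `[0, 1], continuous (fun t : R => F (a + t *: (h *: v)))}.
  by apply: derivable_within_continuous => x /D [].
have D' (x : R) : x \in `]0, 1[%R -> is_derive x (1 : R)
    (fun t : R => F (a + t *: (h *: v))) (h * 'D_v F (a + (x * h) *: v)).
  by move=> x01; apply: D; exact: subset_itv_oo_cc.
have [c c01] := MVT_segment (ler01 : (0 : R) <= 1) D' C.
rewrite scale1r scale0r addr0 subr0 mulr1 => E.
by exists c.
Qed.

Local Notation e_ i := (delta_mx 0 i : plane R).

Lemma ord2P (P : 'I_2 -> Prop) : P 0 -> P 1 -> forall i, P i.
Proof.
move=> P0 P1 [[|[|//]] p].
  by rewrite (_ : Ordinal p = 0)//; exact/val_inj.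
by rewrite (_ : Ordinal p = 1)//; exact/val_inj.
Qed.

Lemma plane_eq (u : plane R) : u = u 0 0 *: e_ 0 + u 0 1 *: e_ 1.
Proof. by apply/rowP; apply: ord2P; rewrite !mxE/=; ring. Qed.

Lemma mx_coord_le m n (A : 'M[R]_(m, n)) i j : `|A i j| <= `|A|.
Proof. by rewrite [leRHS]/Num.norm /= mx_normrE; exact: (le_bigmax _ _ (i, j)). Qed.

Lemma mx_norm_leP m n (A : 'M[R]_(m, n)) (c : R) : 0 <= c ->
  (forall i j, `|A i j| <= c) -> `|A| <= c.
Proof.
move=> c0 H; rewrite [leLHS]/Num.norm /= mx_normrE.
by apply/bigmax_leP; split => // -[i j] _ /=.
Qed.

(* Strict differentiability, not only differentiability, is what makes the local
   injectivity and the contraction argument below work. *)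
Lemma strict_derivative_real (F : plane R -> R) (x : plane R) :
  (\forall y \near x, derivable F y (e_ 0)) ->
  (\forall y \near x, derivable F y (e_ 1)) ->
  {for x, continuous ('D_(e_ 0) F)} -> {for x, continuous ('D_(e_ 1) F)} ->
  forall eta, 0 < eta -> exists2 d, 0 < d & forall u v, ball x d u -> ball x d v ->
  `|F u - F v - ((u - v) 0 0 * 'D_(e_ 0) F x + (u - v) 0 1 * 'D_(e_ 1) F x)|
    <= eta * `|u - v|.
Proof.
move=> d0 d1 c0 c1 eta eta0.
have eta2 : 0 < eta / 2 by rewrite divr_gt0.
move/cvgrPdist_le : c0 => /(_ _ eta2) c0.
move/cvgrPdist_le : c1 => /(_ _ eta2) c1.
have : \forall y \near x, [/\ derivable F y (e_ 0), derivable F y (e_ 1),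
    `|'D_(e_ 0) F x - 'D_(e_ 0) F y| <= eta / 2 &
    `|'D_(e_ 1) F x - 'D_(e_ 1) F y| <= eta / 2].
  by apply: filterS2 (filterI d0 d1) (filterI c0 c1) => y [a1 a2] [a3 a4]; exact: And4.
move=> /nbhs_ballP[d /= d_gt0 H]; exists d => // u v xu xv.
have ballE (y : plane R) : ball x d y <-> `|x 0 0 - y 0 0| < d /\ `|x 0 1 - y 0 1| < d.
  split=> [[_ /= h]|[h0 h1]]; first by split; [exact: (h 0 0)|exact: (h 0 1)].
  by split => // i; rewrite (ord1 i); apply: ord2P.
have conv (a b c t : R) : `|a - b| < d -> `|a - c| < d -> 0 <= t <= 1 ->
   `|a - (c + t * (b - c))| < d.
  move=> ab ac /andP[t0 t1].
  have -> : a - (c + t * (b - c)) = t * (a - b) + (1 - t) * (a - c) by ring.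
  rewrite (le_lt_trans (ler_normD _ _))// !normrM (ger0_norm t0).
  rewrite [`|1 - t|]ger0_norm ?subr_ge0//.
  have [->|tn0] := eqVneq t 0; first by rewrite mul0r add0r subr0 mul1r.
  have tp : 0 < t by rewrite lt_neqAle eq_sym tn0.
  nra.
(* [m] is the corner of the path from [v] to [u] along the axes. Balls of the sup norm are squares,
   so both segments stay in the ball and the mean value theorem applies to each. *)
pose m := v + (u - v) 0 0 *: e_ 0.
have m0 : m 0 0 = u 0 0 by rewrite /m !mxE/=; ring.
have m1 : m 0 1 = v 0 1 by rewrite /m !mxE/=; ring.
have [u0 u1] := (ballE u).1 xu; have [v0 v1] := (ballE v).1 xv.
have Em : u = m + (u - v) 0 1 *: e_ 1.
  by apply/rowP; apply: ord2P; rewrite /m !mxE/=; ring.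
have mE : v + (u - v) 0 0 *: e_ 0 = m by [].
clearbody m.
have HB0 (c : R) : 0 <= c <= 1 -> ball x d (v + (c * (u - v) 0 0) *: e_ 0).
  move=> c01; apply/ballE; rewrite !mxE/= !mulr0 !mulr1 !addr0; split; last by [].
  exact: conv.
have HB1 (c : R) : 0 <= c <= 1 -> ball x d (m + (c * (u - v) 0 1) *: e_ 1).
  move=> c01; apply/ballE; rewrite !mxE/= !mulr0 !mulr1 addr0 m0 m1; split; first by [].
  exact: conv.
have DF0 (c : R) : 0 <= c <= 1 -> derivable F (v + (c * (u - v) 0 0) *: e_ 0) (e_ 0).
  by move=> /HB0 /H [].
have DF1 (c : R) : 0 <= c <= 1 -> derivable F (m + (c * (u - v) 0 1) *: e_ 1) (e_ 1).
  by move=> /HB1 /H [].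
have [c c01 E0] := mean_value_line DF0.
have [c' c01' E1] := mean_value_line DF1.
rewrite -Em in E1; rewrite mE in E0.
have [_ _ B0 _] := H _ (HB0 _ c01).
have [_ _ _ B1] := H _ (HB1 _ c01').
set X0 := 'D_(e_ 0) F (v + _) in E0 B0; set X1 := 'D_(e_ 1) F (m + _) in E1 B1.
have -> : F u - F v = (u - v) 0 1 * X1 + (u - v) 0 0 * X0.
  by rewrite -E0 -E1; ring.
rewrite (_ : _ - _ = - ((u - v) 0 0 * ('D_(e_ 0) F x - X0) +
   (u - v) 0 1 * ('D_(e_ 1) F x - X1))); last by ring.
rewrite normrN (le_trans (ler_normD _ _))// !normrM.
have n0 := mx_coord_le (u - v) 0 0; have n1 := mx_coord_le (u - v) 0 1.
rewrite [eta]splitr mulrDl lerD// mulrC ler_pM//.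
Unshelve. all: by end_near. Qed.

End Calculus.

Section PlaneCalculus.
Context {R : realType}.
Local Notation e_ i := (delta_mx 0 i : plane R).

Lemma near_eq_continuous_at (T T' : topologicalType) (f g : T -> T') (x : T) :
  (\forall y \near x, g y = f y) -> {for x, continuous f} -> {for x, continuous g}.
Proof.
move=> fg; rewrite /prop_for /continuous_at (nbhs_singleton fg); apply: cvg_trans.
by apply: near_eq_cvg; apply: filterS fg => y ->.
Qed.

Lemma Ck_continuous (V W : normedModType R) k (U : set V) (F : V -> W) x :
  Ck k U F -> U x -> {for x, continuous F}.
Proof. by case: k => [|k] [H _]; exact: H. Qed.

Lemma Ck_derivable (V W : normedModType R) k (U : set V) (F : V -> W) v x :
  Ck k.+1 U F -> U x -> derivable F x v.
Proof. by move=> [_ /(_ v) [H _]]; exact: H. Qed.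

Lemma Ck_derive (V W : normedModType R) k (U : set V) (F : V -> W) v :
  Ck k.+1 U F -> Ck k U ('D_v F).
Proof. by move=> [_ /(_ v) []]. Qed.

Section AffineComposition.
Variables (V' V W : normedModType R) (A L : V' -> V).
Hypothesis AL : forall x (h : R) v, A (x + h *: v) = A x + h *: L v.
Implicit Types (F : V -> W) (U : set V).

Let quotientE F x v :
  (fun h : R => h^-1 *: ((F \o A \o shift x) (h *: v) - (F \o A) x)) =
  (fun h => h^-1 *: ((F \o shift (A x)) (h *: L v) - F (A x))).
Proof. by apply/funext => h /=; rewrite [h *: v + x]addrC AL [A x + _]addrC. Qed.

Lemma derivable_comp_affine F x v : derivable F (A x) (L v) -> derivable (F \o A) x v.
Proof. by rewrite /derivable quotientE. Qed.

Lemma derive_comp_affine F x v : 'D_v (F \o A) x = 'D_(L v) F (A x).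
Proof. by rewrite /derive quotientE. Qed.

(** The direction [L v] does not depend on the point, so a derivative of the composite is again a
    composite with [A], and the induction on [k] closes. *)
Lemma Ck_comp_affine k U F : continuous A -> Ck k U F -> Ck k (A @^-1` U) (F \o A).
Proof.
move=> cA; elim: k F => [|k IH] F CF.
  split=> // x Ux; apply: continuous_comp; first exact: cA.
  exact: (Ck_continuous CF Ux).
split=> [x Ux|v].
  apply: continuous_comp; first exact: cA.
  exact: (Ck_continuous CF Ux).
split=> [x Ux|]; first exact/derivable_comp_affine/(Ck_derivable CF Ux).
have -> : (fun x => 'D_v (F \o A) x) = ('D_(L v) F) \o A.
  by apply/funext => x; rewrite derive_comp_affine.
by apply: IH; exact: Ck_derive CF.
Qed.

End AffineComposition.

Definition jac (F : plane R -> plane R) (x : plane R) : 'M[R]_2 :=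
  \matrix_(i, j) ('D_(e_ i) F x : plane R) 0 j.

Lemma mulmx_plane (w : plane R) (A : 'M[R]_2) j :
  (w *m A) 0 j = w 0 0 * A 0 j + w 0 1 * A 1 j.
Proof. by rewrite mxE big_ord_recl big_ord1; congr (_ + w 0 _ * A _ _); exact/val_inj. Qed.

(** The norm is the sup norm; the factor 2 counts the two terms of each entry. *)
Lemma mulmx_norm_le (w : plane R) (A : 'M[R]_2) : `|w *m A| <= 2 * `|A| * `|w|.
Proof.
apply: mx_norm_leP => [|i j]; first by rewrite !mulr_ge0.
rewrite (ord1 i) mulmx_plane (le_trans (ler_normD _ _))// !normrM.
have H k : `|w 0 k| * `|A k j| <= `|A| * `|w|.
  by rewrite mulrC ler_pM// mx_coord_le.
by have := lerD (H 0) (H 1); lra.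
Qed.

Lemma mulmxr_continuous (A : 'M[R]_2) : continuous (fun w : plane R => w *m A).
Proof.
move=> w; apply/(@cvgrPdist_le _ _ _ (nbhs w)) => e e0.
have c0 : 0 < 2 * `|A| + 1 by rewrite ltr_wpDl// mulr_ge0.
apply/nbhs_ballP; exists (e / (2 * `|A| + 1)) => /=; first exact: divr_gt0.
move=> v; rewrite -ball_normE/= => H; rewrite -mulmxBl.
rewrite (le_trans (mulmx_norm_le _ _))//.
move: H; rewrite ltr_pdivlMr// => /ltW; apply: le_trans.
by rewrite mulrDr mulr1 mulrC lerDl.
Qed.

Lemma strict_derivative (U : set (plane R)) (F : plane R -> plane R) x :
  open U -> U x -> Ck 1 U F ->
  forall eta, 0 < eta -> exists2 d, 0 < d & forall u v, ball x d u -> ball x d v ->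
  `|F u - F v - (u - v) *m jac F x| <= eta * `|u - v|.
Proof.
move=> oU Ux CF eta eta0.
have nU : nbhs x U by exact: open_nbhs_nbhs.
have coordD j v y : U y -> derivable (fun z => F z 0 j) y v /\
    'D_v (fun z => F z 0 j) y = ('D_v F y) 0 j.
  move=> Uy; have dF := Ck_derivable (v := v) CF Uy; split.
    exact: ((derivable_mxP _ _ _).1 dF).
  by rewrite derive_mx// mxE.
have cD j k : {for x, continuous ('D_(e_ k) (fun z => F z 0 j))}.
  have := @continuous_comp _ _ _ ('D_(e_ k) F) (fun z : plane R => z 0 j) x
    (Ck_continuous (Ck_derive (e_ k) CF) Ux) (@coord_continuous _ _ _ _ _ _).
  apply: near_eq_continuous_at.
  by apply: filterS nU => y /(coordD j (e_ k)) [].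
have H j : exists2 d, 0 < d & forall u v, ball x d u -> ball x d v ->
   `|F u 0 j - F v 0 j - ((u - v) 0 0 * ('D_(e_ 0) F x : plane R) 0 j +
       (u - v) 0 1 * ('D_(e_ 1) F x : plane R) 0 j)| <= eta * `|u - v|.
  have [||||d d0 Hd] := @strict_derivative_real R (fun z => F z 0 j) x _ _ _ _ eta eta0.
  - by apply: filterS nU => y /(coordD j (e_ 0)) [].
  - by apply: filterS nU => y /(coordD j (e_ 1)) [].
  - exact: cD.
  - exact: cD.
  exists d => // u v xu xv; have := Hd u v xu xv.
  by rewrite !(coordD j _ _ Ux).2.
have [d0 d00 H0] := H 0; have [d1 d10 H1] := H 1.
exists (Num.min d0 d1); first by rewrite lt_min d00 d10.
move=> u v xu xv; apply: mx_norm_leP => [|i]; first by rewrite mulr_ge0// ltW.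
rewrite (ord1 i).
have B d y : Num.min d0 d1 <= d -> ball x (Num.min d0 d1) y -> ball x d y.
  by move=> h; exact: le_ball.
apply: ord2P; rewrite mxE [(- (_ *m _)) _ _]mxE mulmx_plane [X in `|X + _|]mxE.
  rewrite [(- F v) _ _]mxE [jac _ _ _ _]mxE [jac _ _ _ _]mxE.
  by apply: H0; apply: B => //; rewrite ge_min lexx.
rewrite [(- F v) _ _]mxE [jac _ _ _ _]mxE [jac _ _ _ _]mxE.
by apply: H1; apply: B => //; rewrite ge_min lexx orbT.
Qed.

End PlaneCalculus.

(** * Chain rule and local inversion for plane maps *)

Section InverseFunction.
Context {R : realType}.
Local Notation e_ i := (delta_mx 0 i : plane R).

(** The filter and the factor [k] are arbitrary so that the same chain rule covers derivatives along
    a line and one-sided velocities of curves. *)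
Lemma jac_chain (T : Type) (G : set_system T) (FG : Filter G) (k : T -> R)
    (phi : T -> plane R) (U : set (plane R)) (F : plane R -> plane R) (x l : plane R) :
  open U -> U x -> Ck 1 U F ->
  phi s @[s --> G] --> x -> k s *: (phi s - x) @[s --> G] --> l ->
  k s *: (F (phi s) - F x) @[s --> G] --> l *m jac F x.
Proof.
move=> oU Ux CF phix ql.
have qJ : (k s *: (phi s - x)) *m jac F x @[s --> G] --> l *m jac F x.
  apply: (@cvg_comp _ _ _ (fun s => k s *: (phi s - x)) (fun w : plane R => w *m jac F x)
    G (nbhs l)) => //; exact: mulmxr_continuous.
apply/(@cvgrPdist_le _ _ _ G) => e e0.
have l1 : 0 < `|l| + 1 by rewrite ltr_wpDl.
(* The scaled increments eventually have norm at most [|l| + 1], so this rate costs at most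
   [e / 2]. *)
have eta0 : 0 < e / 2 / (`|l| + 1) by rewrite !divr_gt0.
have [d d0 Hd] := strict_derivative oU Ux CF eta0.
have e20 : 0 < e / 2 by rewrite divr_gt0.
have A1 := (@cvgrPdist_le _ _ _ G _ _ _).1 qJ _ e20.
have A2 := (@cvgrPdist_le _ _ _ G _ _ _).1 ql _ ltr01.
have A3 := (@cvgrPdist_lt _ _ _ G _ _ _).1 phix _ d0.
apply: filterS3 (A1 FG) (A2 FG) (A3 FG) => s {}A1 {}A2 {}A3.
rewrite -[X in `|X|](subrKA ((k s *: (phi s - x)) *m jac F x)).
rewrite (le_trans (ler_normD _ _))// [leRHS]splitr lerD//.
have B := Hd (phi s) x.
rewrite -scalemxAl -scalerBr normrZ distrC.
have B1 : ball x d (phi s) by rewrite -ball_normE.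
have {B1}B := B B1 (ballxx _ d0).
rewrite (le_trans (ler_wpM2l _ B))// mulrCA -normrZ.
have C : `|k s *: (phi s - x)| <= `|l| + 1.
  have -> : k s *: (phi s - x) = l - (l - k s *: (phi s - x)) by rewrite subKr.
  by rewrite (le_trans (ler_normB _ _))// lerD.
by rewrite (le_trans (ler_wpM2l (ltW eta0) C))// divfK// gt_eqF.
Qed.

Lemma derive_jac (U : set (plane R)) (F : plane R -> plane R) x v :
  open U -> U x -> Ck 1 U F -> 'D_v F x = v *m jac F x.
Proof.
move=> oU Ux CF; apply: cvg_lim => //.
have := @jac_chain R (0^') _ (fun h => h^-1) (fun h => h *: v + x) U F x v oU Ux CF.
apply.
- rewrite -[X in _ --> X]add0r; apply: cvgD; last exact: cvg_cst.
  rewrite -[X in _ --> X](scale0r v); apply: cvgZr_tmp; apply: cvg_within.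
- apply: cvg_near_cst; near=> h.
  rewrite addrK scalerA mulVf ?scale1r//.
  by near: h; exact: nbhs_dnbhs_neq.
Unshelve. all: by end_near. Qed.

(** Corrected by the inverse jacobian, [F] differs from the identity by a map of small Lipschitz
    constant. Injectivity, surjectivity and the corner estimates all use this form. *)
Lemma strict_derivative_normalized (U : set (plane R)) (F : plane R -> plane R) x :
  open U -> U x -> Ck 1 U F -> jac F x \in unitmx ->
  forall eta, 0 < eta -> exists2 d, 0 < d & ball x d `<=` U /\
  forall u v, ball x d u -> ball x d v ->
  `|(F u - F v) *m invmx (jac F x) - (u - v)| <= eta * `|u - v|.
Proof.
move=> oU Ux CF uA eta eta0.
set A := jac F x in uA *.
pose C := 2 * `|invmx A| + 1.
have C0 : 0 < C by rewrite ltr_wpDl// mulr_ge0.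
have [d d0 Hd] := strict_derivative oU Ux CF (divr_gt0 eta0 C0).
have /nbhs_ballP[d' /= d'0 Hd'] : nbhs x U by exact: open_nbhs_nbhs.
exists (Num.min d d'); first by rewrite lt_min d0.
split=> [y xy|u v xu xv].
  by apply: Hd'; apply: le_ball xy; rewrite ge_min lexx orbT.
have xu' : ball x d u by apply: le_ball xu; rewrite ge_min lexx.
have xv' : ball x d v by apply: le_ball xv; rewrite ge_min lexx.
rewrite -[X in _ - X](mulmxK uA) -mulmxBl (le_trans (mulmx_norm_le _ _))//.
have I0 : 0 <= 2 * `|invmx A| by rewrite mulr_ge0.
rewrite (le_trans (ler_wpM2l I0 (Hd _ _ xu' xv')))//.
rewrite mulrA ler_wpM2r// mulrCA ler_piMr ?(ltW eta0)// ler_pdivrMr// mul1r.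
by rewrite lerDl.
Qed.

Lemma locally_injective (U : set (plane R)) (F : plane R -> plane R) x :
  open U -> U x -> Ck 1 U F -> jac F x \in unitmx ->
  exists2 d, 0 < d & forall u v, ball x d u -> ball x d v -> F u = F v -> u = v.
Proof.
move=> oU Ux CF uA.
have h0 : 0 < (2^-1 : R) by rewrite invr_gt0.
have [d d0 [_ Hd]] := strict_derivative_normalized oU Ux CF uA h0.
exists d => // u v xu xv Fuv; have := Hd u v xu xv.
rewrite Fuv subrr mul0mx sub0r normrN => H; apply/eqP; rewrite -subr_eq0 -normr_eq0.
by apply/eqP; have := normr_ge0 (u - v); lra.
Qed.

(** The estimate on [u - x - z] locates the preimage; it is what later shows that points in an open
    sector come from the interior of the simplex. *)
Lemma locally_surjective (U : set (plane R)) (F : plane R -> plane R) x :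
  open U -> U x -> Ck 1 U F -> jac F x \in unitmx ->
  forall eta, 0 < eta -> exists2 d, 0 < d & forall z : plane R, `|z| <= d ->
   exists u, `|u - x - z| <= eta * `|z| /\ F u = F x + z *m jac F x.
Proof.
move=> oU Ux CF uA eta eta0.
(* Rate 1/2 gives a contraction and the bound [|u| <= 2 |z|]; the latter turns the rate [eta / 2]
   into the announced [eta]. *)
pose q := Num.min (eta / 2) 2^-1.
have q0 : 0 < q by rewrite lt_min divr_gt0//= invr_gt0.
have q2 : q <= 2^-1 by rewrite ge_min lexx orbT.
have qe : q <= eta / 2 by rewrite ge_min lexx.
have [d d0 [_ Hd]] := strict_derivative_normalized oU Ux CF uA q0.
(* The ball of radius [d / 2] is mapped into itself: a displacement [|z| <= d / 4] plus half of the
   radius. *)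
exists (d / 4) => [|z zd]; first by rewrite divr_gt0.
pose H u := (F (x + u) - F x) *m invmx (jac F x).
(* A fixed point of the contraction [f] solves [H u = z]. *)
pose f u := u - H u + z.
have Hf u v : `|u| <= d / 2 -> `|v| <= d / 2 -> `|f u - f v| <= q * `|u - v|.
  move=> ud vd.
  have B w : `|w| <= d / 2 -> ball x d (x + w).
    rewrite -ball_normE/= opprD addNKr normrN => H1.
    by rewrite (le_lt_trans H1)// ltr_pdivrMr// ltr_pMr// ltr1n.
  have := Hd _ _ (B _ ud) (B _ vd).
  rewrite [in leRHS]opprD addrACA subrr add0r; apply: le_trans.
  rewrite -normrN le_eqVlt; apply/orP; left; apply/eqP; congr `|_|.
  have -> : F (x + u) - F (x + v) = (F (x + u) - F x) - (F (x + v) - F x).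
    by rewrite opprB addrA subrK.
  rewrite mulmxBl /f -/(H u) -/(H v); move: (H u) (H v) => Hu Hv.
  by apply/matrixP => i j; rewrite !mxE; ring.
pose B := [set u : plane R | `|u| <= d / 2].
have f0 : f 0 = z by rewrite /f /H addr0 subrr mul0mx subr0 add0r.
have fB : {homo f : u / B u}.
  move=> u Bu; have := Hf u 0 Bu.
  rewrite normr0 f0 subr0 => /(_ (ltW (divr_gt0 d0 (ltr0Sn _ 1)))) fz.
  rewrite /B /= -(subrK z (f u)) (le_trans (ler_normD _ _))//.
  have : q * `|u| <= 2^-1 * (d / 2) by rewrite ler_pM// ltW.
  by move: fz zd; lra.
have ctr : is_contraction (mkfun_fun fB).
  have q0' : 0 <= q by exact: ltW.
  exists (NngNum q0'); split => /=; first by rewrite (le_lt_trans q2)// invf_lt1// ltr1n.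
  by move=> -[u v] /= [Bu Bv]; exact: Hf.
have clB : closed B.
  rewrite (_ : B = Num.norm @^-1` [set r : R | r <= d / 2])//.
  apply: closed_comp; last exact: closed_le.
  by move=> u _; exact: norm_continuous.
have [|u Bu fu] := banach_fixed_point ctr clB.
  by exists 0; rewrite /B/= normr0 ltW// divr_gt0.
exists (x + u); rewrite [x + u]addrC addrK.
have uz : `|u - z| <= q * `|u|.
  have := Hf u 0 Bu; rewrite normr0 f0 subr0 [in `|f u - z|](_ : f u = u).
    by apply; rewrite ltW// divr_gt0.
  by rewrite {2}fu.
split.
  have H1 : `|u| <= 2 * `|z|.
    have : `|u| <= `|u - z| + `|z| by rewrite -{1}(subrK z u) ler_normD.
    have : q * `|u| <= 2^-1 * `|u| by rewrite ler_wpM2r.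
    by move: uz; lra.
  apply: (le_trans uz); apply: (le_trans (ler_pM (ltW q0) (normr_ge0 _) qe H1)).
  by rewrite mulrA divfK.
have : H u = z.
  have /= fu' : u = f u by rewrite {1}fu.
  move: fu'; rewrite /f -[u - H u + z]addrA -{1}[u]addr0 => /addrI /esym.
  by rewrite addrC => /subr0_eq ->.
move=> <-; rewrite /H mulmxKV// [x + u]addrC.
by rewrite [RHS]addrC subrK.
Qed.

End InverseFunction.

(** * Charts and curves *)

Section WithinDerivatives.
Context {R : realType}.
Local Notation e_ i := (delta_mx 0 i : plane R).

(** This makes [within J t^'] a proper filter, so that the [lim] in [derive_within] is the actual
    limit and not a default value. *)
Definition clusters_at (J : set R) (t : R) :=
  forall e, 0 < e -> exists2 s, J s & s != t /\ `|t - s| < e.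

Lemma clusters_at_proper (J : set R) (t : R) :
  clusters_at J t -> ProperFilter (within J t^').
Proof.
move=> aJ; apply: Build_ProperFilter_ex => P /nbhs_ballP[e /= e0 H].
have [s Js [st ts]] := aJ e e0.
by exists s; apply: H.
Qed.

Lemma derive_withinE (W : normedModType R) (J : set R) (f F : R -> W) (t : R) :
  clusters_at J t -> derivable F t 1 -> f t = F t ->
  (\forall s \near t, J s -> f s = F s) -> derive_within J f t = 'D_1 F t.
Proof.
move=> /clusters_at_proper PJ dF ft fF; apply: cvg_lim => //.
have : (s - t)^-1 *: (F s - F t) @[s --> t^'] --> 'D_1 F t.
  move/cvgrPdist_le : (dF) => H; apply/cvgrPdist_le => e e0.
  have := H e e0 => /nbhs_ballP[d /= d0 {}H].
  apply/nbhs_ballP; exists d => //= s ts st.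
  have := H (s - t); rewrite /= [(s - t) *: 1]mulr1 subrK => /(_ _ _); apply.
    by rewrite -ball_normE /= sub0r normrN distrC.
  by rewrite subr_eq0.
move=> C; apply: (cvg_trans _ (cvg_trans (cvg_app _ (@cvg_within _ (t^') _ J)) C)).
apply: near_eq_cvg; rewrite near_withinE.
have : \forall s \near t^', J s -> f s = F s by exact: nbhs_dnbhs.
by apply: filterS => s H Js; rewrite (H Js) ft.
Qed.

Lemma dderive_withinE (V W : normedModType R) (A : set V) (f F : V -> W) (x v : V) :
  clusters_at [set h | A (x + h *: v)] 0 -> derivable F x v -> f x = F x ->
  (\forall y \near x, A y -> f y = F y) ->
  dderive_within A f x v = 'D_v F x.
Proof.
move=> aJ dF fx fF.
have dl : is_derive (0 : R) (1 : R) (fun h : R => F (x + h *: v)) ('D_v F x).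
  rewrite -{2}[x]addr0 -(scale0r v); apply: is_derive_line.
  by rewrite scale0r addr0.
rewrite -(@derive_val _ _ _ _ _ _ _ dl); apply: derive_withinE => //.
- by rewrite scale0r addr0.
- have : (x + h *: v) @[h --> (0 : R)] --> x.
    rewrite -[X in _ --> X]addr0 -(scale0r v).
    by apply: cvgD; [exact: cvg_cst|exact: scalel_continuous].
  by move=> /(_ _ fF).
Qed.

End WithinDerivatives.

(** * Charts of a surface with boundary *)

Section Charts.
Context {R : realType} {M : topologicalType}.
Local Notation e_ i := (delta_mx 0 i : plane R).
Implicit Types (c d : chart R M).

Lemma chart_img_ge0 c u : chart_img c u -> 0 <= u 0 1.
Proof.
have [Q [_ E]] := chart_img_open c.
by rewrite /chart_img E => -[].
Qed.

Lemma chart_img_near c u : chart_img c u ->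
  \forall v \near u, 0 <= (v : plane R) 0 1 -> chart_img c v.
Proof.
have [Q [oQ E]] := chart_img_open c.
rewrite /chart_img E => -[Qu _].
have : nbhs u Q by exact: open_nbhs_nbhs.
by apply: filterS => v Qv v0; split.
Qed.

Lemma chart_invK c u : chart_img c u ->
  chart_dom c (chart_inv c u) /\ c (chart_inv c u) = u.
Proof. by move=> [x cx <-]; rewrite chart_mapK. Qed.

Lemma overlap_near c d u : overlap c d u ->
  \forall v \near u, 0 <= (v : plane R) 0 1 -> overlap c d v.
Proof.
move=> [x [cx dx] <-].
have ix : chart_img c (c x) by exists x.
have : chart_inv c v @[v --> within (chart_img c) (nbhs (c x))] --> chart_inv c (c x).
  exact: (subspace_continuousP _ _).1 (@chart_inv_continuous _ _ c) _ ix.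
rewrite chart_mapK// => /(_ (chart_dom d)).
have nd : nbhs x (chart_dom d) by apply: open_nbhs_nbhs; split => //; exact: chart_open.
move=> /(_ nd) H'.
have H : \forall v \near c x, chart_img c v -> chart_dom d (chart_inv c v) := H'.
apply: filterS2 H (chart_img_near ix) => v H1 H2 v0.
have iv := H2 v0; have [dv cv] := chart_invK iv.
by exists (chart_inv c v) => //; split => //; exact: H1.
Qed.

(** Positive steps never leave the half-plane: [e_ 0] is parallel to its edge and [e_ 1] points
    inward. *)
Lemma half_plane_clusters_at (A : set (plane R)) (u : plane R) i :
  0 <= u 0 1 -> (\forall v \near u, 0 <= (v : plane R) 0 1 -> A v) ->
  clusters_at [set h | A (u + h *: e_ i)] 0.
Proof.
move=> u0 nA e e0.
have : (u + h *: e_ i) @[h --> (0 : R)] --> u.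
  rewrite -[X in _ --> X]addr0 -(scale0r (e_ i)).
  by apply: cvgD; [exact: cvg_cst|exact: scalel_continuous].
move=> /(_ _ nA) nA'.
have /nbhs_ballP[r /= r0 H] : nbhs (0 : R)
  [set h : R | 0 <= (u + h *: e_ i) 0 1 -> A (u + h *: e_ i)] := nA'.
pose h := Num.min r e / 2.
have m0 : 0 < Num.min r e by rewrite lt_min r0.
have h0 : 0 < h by rewrite divr_gt0.
have hm : h < Num.min r e by rewrite ltr_pdivrMr// ltr_pMr// ltr1n.
exists h; last first.
  by rewrite gt_eqF// sub0r normrN gtr0_norm// (lt_le_trans hm)// ge_min lexx orbT.
apply: H => /=.
  by rewrite -ball_normE/= sub0r normrN gtr0_norm// (lt_le_trans hm)// ge_min lexx.
by rewrite !mxE addr_ge0// mulr_ge0// ?ltW//; case: (_ && _).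
Qed.

Lemma jacobianE c d u (U : set (plane R)) (F : plane R -> plane R) :
  overlap c d u -> open U -> U u -> Ck 1 U F ->
  (forall v, overlap c d v -> U v -> transition c d v = F v) ->
  Defs.jacobian c d u = jac F u.
Proof.
move=> ou oU Uu CF H; apply/matrixP => i j; rewrite !mxE.
have u0 : 0 <= u 0 1.
  by case: ou => x [cx _] <-; apply: (@chart_img_ge0 c); exists x.
rewrite (@dderive_withinE _ _ _ _ _ F)//.
- by apply: half_plane_clusters_at => //; exact: overlap_near.
- exact: Ck_derivable CF Uu.
- exact: H.
- have : nbhs u U by exact: open_nbhs_nbhs.
  by apply: filterS => v Uv ov; exact: H.
Qed.

Variables (S : surface R M) (g : riemannian_metric S).

(** By [metric_compat] a vector killed by the jacobian would have length zero in the chart [c]; no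
    inverse transition map has to be differentiated. *)
Lemma jacobian_unit c d u : atlas S c -> atlas S d -> overlap c d u ->
  Defs.jacobian c d u \in unitmx.
Proof.
move=> ac ad ou; rewrite unitmxE unitfE; apply/negP => /det0P[v v0 vJ].
have iu : chart_img c u by case: ou => x [cx _] <-; exists x.
have := metric_posdef g ac iu v0.
by rewrite (metric_compat g ac ad ou) !mulmxA vJ !mul0mx mxE ltxx.
Qed.

Lemma local_min_jac (F : plane R -> plane R) (U : set (plane R)) u :
  open U -> U u -> Ck 1 U F -> (\forall v \near u, F u 0 1 <= F (v : plane R) 0 1) ->
  forall i, jac F u i 1 = 0.
Proof.
move=> oU Uu CF Fmin i; rewrite mxE.
have lc : (u + h *: e_ i) @[h --> (0 : R)] --> u.
  rewrite -[X in _ --> X]addr0 -(scale0r (e_ i)).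
  by apply: cvgD; [exact: cvg_cst|exact: scalel_continuous].
have nU : nbhs u U by exact: open_nbhs_nbhs.
have nA : nbhs (0 : R)
  [set h : R | U (u + h *: e_ i) /\ F u 0 1 <= F (u + h *: e_ i) 0 1].
  exact: (lc _ (filterI nU Fmin)).
have [r /= r0 H] := (nbhs_ballP _ _).1 nA.
have inr (t : R) : t \in `](- r), r[ -> ball 0 r t.
  by rewrite in_itv/= -ball_normE/= sub0r normrN ltr_norml.
pose f t := F (u + t *: e_ i) 0 1.
have D t : t \in `](- r), r[ ->
    is_derive t (1 : R) f (('D_(e_ i) F (u + t *: e_ i) : plane R) 0 1).
  move=> /inr /H [Ut _].
  have dF : derivable F (u + t *: e_ i) (e_ i) by exact: Ck_derivable CF Ut.
  have -> : ('D_(e_ i) F (u + t *: e_ i) : plane R) 0 1 =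
      'D_(e_ i) (fun v => F v 0 1) (u + t *: e_ i).
    by rewrite derive_mx// mxE.
  apply: (@is_derive_line _ _ _ (fun v => F v 0 1)).
  exact: ((derivable_mxP _ _ _).1 dF).
have r0' : - r < r by rewrite gtrN.
have : is_derive (0 : R) (1 : R) f 0.
  apply: (derive1_at_min (ltW r0')) => [t /D []//||t /inr /H [_]].
    by rewrite in_itv/= oppr_lt0 r0.
  by rewrite /f scale0r addr0.
move=> D0.
have Z : (0 : R) \in `](- r), r[ by rewrite in_itv/= oppr_lt0 r0.
have := @derive_val _ _ _ _ _ _ _ (D 0 Z).
by rewrite (@derive_val _ _ _ _ _ _ _ D0) scale0r addr0.
Qed.

(* If [c x] were interior, the second component of the transition map would have a local
   minimum there and the jacobian would have a zero column. *)
Lemma chart_boundary c d x : atlas S c -> atlas S d -> chart_dom c x ->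
  chart_dom d x -> d x 0 1 = 0 -> c x 0 1 = 0.
Proof.
move=> ac ad cx dx dx0; apply/eqP; apply: contrapT => /negP cxn0.
have ix : chart_img c (c x) by exists x.
have cx0 : 0 < c x 0 1 by rewrite lt_neqAle eq_sym cxn0 (chart_img_ge0 ix).
have ox : overlap c d (c x) by exists x.
have [F [U [oU Ux CF HF]]] := transition_smooth ac ad ox.
have J := jacobianE ox oU Ux (CF 1%N) HF.
have nU : nbhs (c x) U by exact: open_nbhs_nbhs.
have n0 : \forall v \near c x, 0 < (v : plane R) 0 1.
  have := @coord_continuous R 1 2 0 1 (c x).
  by move=> /(_ [set r | 0 < r]); apply; apply: open_nbhs_nbhs; split => //; exact: open_gt.
have Fx : F (c x) 0 1 = 0 by rewrite -HF// /transition/= chart_mapK.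
have : \forall v \near c x, F (c x) 0 1 <= F v 0 1.
  apply: filterS3 nU n0 (overlap_near ox) => v Uv v0 /(_ (ltW v0)) ov.
  rewrite Fx -HF//; case: ov => y [cy dy] <-.
  by rewrite /transition/= chart_mapK//; apply: (@chart_img_ge0 d); exists y.
move=> /(local_min_jac oU Ux (CF 1%N)) J0.
have uJ := jacobian_unit ac ad ox.
have : Defs.jacobian c d (c x) *m (delta_mx 1 0 : 'cV[R]_2) = 0.
  apply/matrixP => i j; rewrite J !mxE big1// => k _.
  have [->|k1] := eqVneq k 1; first by rewrite J0 mul0r.
  by rewrite [delta_mx _ _ _ _]mxE (negPf k1) mulr0.
move=> /(congr1 (mulmx (invmx (Defs.jacobian c d (c x))))); rewrite mulKmx// mulmx0.
by move=> /matrixP /(_ 1 0); rewrite !mxE !eqxx => /eqP; rewrite oner_eq0.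
Qed.

Lemma boundaryE c x : atlas S c -> chart_dom c x ->
  boundary S x <-> c x 0 1 = 0.
Proof.
move=> ac cx; have ax := chart_at_atlas S x; have dx := chart_at_dom S x.
by split; [exact: chart_boundary|exact: chart_boundary].
Qed.

End Charts.

(** * Curves read in a fixed chart *)

Section Curves.
Context {R : realType} {M : topologicalType}.
Local Notation e_ i := (delta_mx 0 i : plane R).
Implicit Types (c d : chart R M).

Lemma derive_quotient (W : normedModType R) (F : R -> W) (t : R) :
  derivable F t 1 -> (s - t)^-1 *: (F s - F t) @[s --> t^'] --> 'D_1 F t.
Proof.
move=> dF; move/cvgrPdist_le : (dF) => H; apply/cvgrPdist_le => e e0.
have /nbhs_ballP[d /= d0 {}H] := H e e0.
apply/nbhs_ballP; exists d => //= s ts st.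
have := H (s - t); rewrite /= [(s - t) *: 1]mulr1 subrK => /(_ _ _); apply.
  by rewrite -ball_normE /= sub0r normrN distrC.
by rewrite subr_eq0.
Qed.

Lemma within_near_eq_cvg (T T' : topologicalType) (f F : T -> T') (A : set T) (x : T) :
  (\forall s \near x, A s -> f s = F s) -> {for x, continuous F} ->
  f s @[s --> within A (nbhs x)] --> F x.
Proof.
move=> H cF; apply: (cvg_trans _ (cvg_trans (cvg_app _ (@cvg_within _ (nbhs x) _ A)) cF)).
apply: near_eq_cvg; rewrite near_withinE.
by apply: filterS H => s H As; rewrite H.
Qed.

Lemma itv_clusters_at (T t d : R) (J : set R) : 0 < T -> 0 <= t <= T -> 0 < d ->
  (forall s, ball t d s -> 0 <= s <= T -> J s) -> clusters_at J t.
Proof.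
move=> T0 /andP[t0 tT] d0 H e e0.
have m0 : 0 < Num.min e d by rewrite lt_min e0.
have [me md] : Num.min e d <= e /\ Num.min e d <= d.
  by split; rewrite ge_min lexx ?orbT.
(* Times are approached from the right, except the endpoint [T], which is approached from the
   left. *)
have [tT'|Tt] := ltP t T.
  have m1 : 0 < Num.min (Num.min e d) (T - t) by rewrite lt_min m0 subr_gt0.
  have [m1m m1T] : Num.min (Num.min e d) (T - t) <= Num.min e d /\
      Num.min (Num.min e d) (T - t) <= T - t by split; rewrite ge_min lexx ?orbT.
  move: m1 m1m m1T; set m := Num.min (Num.min e d) _ => m1 m1m m1T.
  have B : `|t - (t + m / 2)| < Num.min e d.
    by rewrite opprD addNKr normrN gtr0_norm ?divr_gt0//; lra.
  exists (t + m / 2); first by apply: H; rewrite -?ball_normE/=; lra.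
  by split; [rewrite gt_eqF//; lra|lra].
have {tT Tt}tT : t = T by apply/eqP; rewrite eq_le tT.
have m1 : 0 < Num.min (Num.min e d) t by rewrite lt_min m0 tT.
have [m1m m1T] : Num.min (Num.min e d) t <= Num.min e d /\
    Num.min (Num.min e d) t <= t by split; rewrite ge_min lexx ?orbT.
move: m1 m1m m1T; set m := Num.min (Num.min e d) _ => m1 m1m m1T.
have B : `|t - (t - m / 2)| < Num.min e d.
  by rewrite subKr gtr0_norm ?divr_gt0//; lra.
exists (t - m / 2); first by apply: H; rewrite -?ball_normE/=; lra.
by split; [rewrite lt_eqF//; lra|lra].
Qed.

Variables (S : surface R M) (g : riemannian_metric S).
Variables (T : R) (gam : R -> M).
Hypotheses (T0 : 0 < T) (gamS : smooth_curve S `[0, T] gam).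
Local Notation I := [set` `[0, T]].
Variable c : chart R M.
Hypothesis ac : atlas S c.

Lemma chart_times_near (e : chart R M) t : chart_times e I gam t ->
  exists2 d, 0 < d & forall s, ball t d s -> 0 <= s <= T -> chart_times e I gam s.
Proof.
move=> [It et]; have [cgam _] := gamS.
have C : gam s @[s --> within I (nbhs t)] --> gam t.
  exact: (subspace_continuousP _ _).1 cgam _ It.
have ne : nbhs (gam t) (chart_dom e) by apply: open_nbhs_nbhs; split => //; exact: chart_open.
have H : \forall s \near t, I s -> chart_dom e (gam s) := C _ ne.
have [d /= d0 Hd] := (nbhs_ballP _ _).1 H.
exists d => // s ts sT; have Is : I s by rewrite /= in_itv.
by split => //; exact: Hd.
Qed.

(** A single extension [F] gives position, velocity and acceleration on a common neighbourhood,
    endpoints included; continuity and derivatives of the curve are then read off [F]. *)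
Lemma smooth_curve_local t : chart_times c I gam t ->
  exists (F : R -> plane R) (d : R), [/\ 0 < d, (forall k, Ck k (ball (t : R) d) F) &
    forall s, ball t d s -> 0 <= s <= T -> [/\ chart_times c I gam s, c (gam s) = F s,
      chart_velocity c I gam s = 'D_1 F s &
      chart_acceleration c I gam s = 'D_1 ('D_1 F) s] ].
Proof.
move=> ct; have [_ /(_ c ac t ct) [F [U [oU Ut CF HF]]]] := gamS.
have [d1 d10 H1] := chart_times_near ct.
have nU : nbhs (t : R) (U : set R) by exact: open_nbhs_nbhs.
have [d2 /= d20 H2] := (nbhs_ballP _ _).1 nU.
have m0 : 0 < Num.min d1 d2 by rewrite lt_min d10.
have B1 s : ball t (Num.min d1 d2) s -> ball t d1 s.
  by apply: le_ball; rewrite ge_min lexx.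
have B2 s : ball t (Num.min d1 d2) s -> U s.
  by move=> ts; apply: H2; apply: le_ball ts; rewrite ge_min lexx orbT.
have Ck_sub (V W : normedModType R) k (A B : set V) (f : V -> W) :
    A `<=` B -> Ck k B f -> Ck k A f.
  move=> AB; elim: k f => [|k IH] f [Cf Hf].
    by split => // x Ax; apply: Cf; exact: AB.
  split => [x /AB|v]; first exact: Cf.
  have [dv Cv] := Hf v; split => [x /AB|]; first exact: dv.
  exact: IH.
have near_ball s : ball t (Num.min d1 d2) s ->
    \forall r \near s, ball t (Num.min d1 d2) r.
  by move=> ts; apply: open_nbhs_nbhs; split => //; exact: ball_open.
have acc s : ball t (Num.min d1 d2) s -> 0 <= s <= T ->
    clusters_at (chart_times c I gam) s.
  move=> ts sT; have [r /= r0 Hr] := (nbhs_ballP _ _).1 (near_ball _ ts).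
  by apply: (itv_clusters_at T0 sT r0) => q /Hr /B1 /H1.
have eF s : ball t (Num.min d1 d2) s -> 0 <= s <= T -> c (gam s) = F s.
  by move=> ts sT; apply: HF; [apply: H1 => //; exact: B1|exact: B2].
have vF s : ball t (Num.min d1 d2) s -> 0 <= s <= T ->
    chart_velocity c I gam s = 'D_1 F s.
  move=> ts sT; apply: derive_withinE; first exact: acc.
  - exact: Ck_derivable (CF 1%N) (B2 _ ts).
  - exact: eF.
  - apply: filterS (near_ball s ts) => r tr [Ir _].
    by apply: eF => //; move: Ir; rewrite /= in_itv.
exists F, (Num.min d1 d2); split; [exact: m0| |move=> s ts sT; split].
- by move=> k; apply: Ck_sub (CF k).
- by apply: H1 => //; exact: B1.
- exact: eF.
- exact: vF.
- apply: derive_withinE; first exact: acc.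
  + exact: Ck_derivable (Ck_derive (1 : R) (CF 2%N)) (B2 _ ts).
  + exact: vF.
  + apply: filterS (near_ball s ts) => r tr [Ir _].
    by apply: vF => //; move: Ir; rewrite /= in_itv.
Qed.

Lemma chart_curve_continuous t : chart_times c I gam t ->
  c (gam s) @[s --> within I (nbhs t)] --> c (gam t).
Proof.
move=> ct; have [F [d [d0 CF HF]]] := smooth_curve_local ct.
have tT : 0 <= t <= T by case: ct; rewrite /= in_itv.
have [_ -> _ _] := HF t (ballxx _ d0) tT.
apply: (within_near_eq_cvg _ (Ck_continuous (CF 0%N) (ballxx _ d0))).
have : nbhs t (ball t d) by exact: nbhsx_ballx.
apply: filterS => s ts; rewrite /= in_itv/= => sT.
by have [_ -> _ _] := HF s ts sT.
Qed.

Lemma chart_velocity_continuous t : chart_times c I gam t ->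
  chart_velocity c I gam s @[s --> within I (nbhs t)] --> chart_velocity c I gam t.
Proof.
move=> ct; have [F [d [d0 CF HF]]] := smooth_curve_local ct.
have tT : 0 <= t <= T by case: ct; rewrite /= in_itv.
have [_ _ -> _] := HF t (ballxx _ d0) tT.
apply: (within_near_eq_cvg _ (Ck_continuous (Ck_derive (1 : R) (CF 1%N)) (ballxx _ d0))).
have : nbhs t (ball t d) by exact: nbhsx_ballx.
apply: filterS => s ts; rewrite /= in_itv/= => sT.
by have [_ _ -> _] := HF s ts sT.
Qed.

Lemma chart_curve_derive t : 0 < t < T -> chart_times c I gam t ->
  is_derive t (1 : R) (fun s => c (gam s)) (chart_velocity c I gam t) /\
  is_derive t (1 : R) (chart_velocity c I gam) (chart_acceleration c I gam t).
Proof.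
move=> /andP[t0 tT'] ct; have [F [d [d0 CF HF]]] := smooth_curve_local ct.
have tT : 0 <= t <= T by rewrite !ltW.
have [_ _ -> ->] := HF t (ballxx _ d0) tT.
have nI : \forall s \near t, 0 <= s <= T.
  near=> s; apply/andP; split; apply: ltW; near: s; first exact: lt_nbhsr.
  exact: lt_nbhsl.
have nB : nbhs t (ball t d) by exact: nbhsx_ballx.
split.
  have : is_derive t (1 : R) F ('D_1 F t).
    by apply: derivableP; exact: Ck_derivable (CF 1%N) (ballxx _ d0).
  apply: near_eq_is_derive; apply: filterS2 nI nB => s sT ts.
  by have [_ -> _ _] := HF s ts sT.
have : is_derive t (1 : R) ('D_1 F) ('D_1 ('D_1 F) t).
  have dd : derivable ('D_1 F) t 1.
    exact: Ck_derivable (Ck_derive (1 : R) (CF 2%N)) (ballxx _ d0).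
  exact: (derivableP dd).
apply: near_eq_is_derive; apply: filterS2 nI nB => s sT ts.
by have [_ _ -> _] := HF s ts sT.
Unshelve. all: by end_near. Qed.

Lemma chart_velocity_transition (e : chart R M) t : atlas S e ->
  chart_times c I gam t -> chart_times e I gam t ->
  chart_velocity e I gam t =
    chart_velocity c I gam t *m Defs.jacobian c e (c (gam t)).
Proof.
move=> ae ct et; have [F [d [d0 CF HF]]] := smooth_curve_local ct.
have tT : 0 <= t <= T by case: ct; rewrite /= in_itv.
have [_ xF -> _] := HF t (ballxx _ d0) tT.
have ox : overlap c e (c (gam t)) by exists (gam t) => //; split; [case: ct|case: et].
have [A [U [oU Ux CA HA]]] := transition_smooth ac ae ox.
rewrite (jacobianE ox oU Ux (CA 1%N) HA).
have [d2 d20 H2] := chart_times_near et.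
have nB : nbhs t (ball t d) by exact: nbhsx_ballx.
pose J := chart_times e I gam.
have cont : c (gam s) @[s --> within J t^'] --> c (gam t).
  apply: cvg_trans (chart_curve_continuous ct).
  apply: cvg_app => P H.
  have H' : \forall s \near t, I s -> P s := H.
  have : \forall s \near t^', I s -> P s by exact: nbhs_dnbhs.
  by apply: filterS => s Hs [Is _]; exact: Hs.
have aJ : clusters_at J t by exact: (itv_clusters_at T0 tT d20 H2).
have PJ := clusters_at_proper aJ.
apply: cvg_lim => //.
have dF : derivable F t 1 by exact: Ck_derivable (CF 1%N) (ballxx _ d0).
have Q : (s - t)^-1 *: (c (gam s) - c (gam t)) @[s --> within J t^'] --> 'D_1 F t.
  have C := derive_quotient dF.
  apply: (cvg_trans _ (cvg_trans (cvg_app _ (@cvg_within _ (t^') _ J)) C)).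
  apply: near_eq_cvg; rewrite near_withinE.
  have : \forall s \near t^', ball t d s by exact: nbhs_dnbhs.
  apply: filterS => s ts [Is _]; rewrite /= in_itv/= in Is.
  by have [_ -> _ _] := HF s ts Is; rewrite xF.
have FJ : Filter (within J t^') by exact: within_filter.
have := jac_chain FJ oU Ux (CA 1%N) cont Q.
apply: cvg_trans; apply: near_eq_cvg; rewrite near_withinE.
have nU : \forall s \near within J t^', U (c (gam s)).
  by apply: cont; exact: open_nbhs_nbhs.
have nU' : \forall s \near t^', J s -> U (c (gam s)) := nU.
have nT : \forall s \near t^', ball t d s by exact: nbhs_dnbhs.
apply: filterS2 nU' nT => s Us ts Js.
have Is : 0 <= s <= T by case: Js; rewrite /= in_itv.
have [[_ cs] _ _ _] := HF s ts Is.
have es : chart_dom e (gam s) by case: Js.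
rewrite -HA//; [|by exists (gam s)|exact: Us].
rewrite -HA// /transition/= !chart_mapK//.
by case: ct.
Qed.

(** [speed] refers to the preferred chart at [gam t], which may jump with [t]. Since velocities
    transform by the jacobian and so does the metric, it can be computed in the fixed chart [c]. *)
Lemma speed_chart t : chart_times c I gam t ->
  let w := chart_velocity c I gam t in
  speed g I gam t = Num.sqrt ((w *m metric_mx g c (c (gam t)) *m w^T) 0 0).
Proof.
move=> ct w; have [It cgt] := ct.
set e := chart_at S (gam t).
have ae : atlas S e by exact: chart_at_atlas.
have et : chart_times e I gam t by split => //; exact: chart_at_dom.
have ox : overlap c e (c (gam t)) by exists (gam t) => //; split => //; case: et.
rewrite /speed /inner /velocity -/e (chart_velocity_transition ae ct et).
rewrite (metric_compat g ac ae ox) trmx_mul !mulmxA /transition/=.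
by rewrite chart_mapK.
Qed.

End Curves.

(** * Tiles at a boundary vertex *)

Section SimplexSymmetries.
Context {R : realType}.
Local Notation e_ i := (delta_mx 0 i : plane R).

Lemma simplex_vertexP (u : plane R) : simplex u -> depth u = 2%N ->
  [\/ u = 0, u = e_ 0 | u = e_ 1].
Proof.
move=> [u0 u1 u01]; rewrite /depth.
have [E0|_] := eqVneq (u 0 0) 0; have [E1|_] := eqVneq (u 0 1) 0 => //=.
- by move=> _; apply: Or31; apply/rowP; apply: ord2P; rewrite !mxE.
- rewrite E0 add0r; have [E|] := eqVneq (u 0 1) 1 => //= _.
  by apply: Or33; apply/rowP; apply: ord2P; rewrite !mxE.
- rewrite E1 addr0; have [E|] := eqVneq (u 0 0) 1 => //= _.
  by apply: Or32; apply/rowP; apply: ord2P; rewrite !mxE.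
- by case: (_ == _).
Qed.

(** The affine involution exchanging the vertex with the origin transposes two barycentric
    coordinates, and both the simplex and the depth are symmetric in these coordinates. *)
Lemma simplex_vertex_symmetry (u : plane R) : simplex u -> depth u = 2%N ->
  exists2 E : 'M[R]_2, E \in unitmx & forall w,
    (simplex (u + w *m E) <-> simplex w) /\ depth (u + w *m E) = depth w.
Proof.
move=> su du; have [->|->|->] := simplex_vertexP su du.
- exists 1%:M; first exact: unitmx1.
  by move=> w; rewrite mulmx1 add0r.
(* The image of [w] is [(1 - w 0 0 - w 0 1, w 0 1)]; in the remaining case it is
   [(w 0 0, 1 - w 0 0 - w 0 1)]. *)
- pose E : 'M[R]_2 := \matrix_(i, j) nth 0 (nth [::] [:: [:: -1; 0]; [:: -1; 1]] i) j.
  exists E.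
    apply: (@mulmx1_unit _ _ E E _).1.
    by apply/matrixP; apply: ord2P; apply: ord2P; rewrite !mxE big_ord_recl big_ord1 !mxE/=; ring.
  move=> w.
  have E0 : (e_ 0 + w *m E) 0 0 = 1 - w 0 0 - w 0 1.
    by rewrite mxE mulmx_plane !mxE/=; ring.
  have E1 : (e_ 0 + w *m E) 0 1 = w 0 1.
    by rewrite mxE mulmx_plane !mxE/=; ring.
  rewrite /simplex /depth /= E0 E1; split.
    by split=> -[? ? ?]; split; lra.
  rewrite (_ : 1 - w 0 0 - w 0 1 + w 0 1 = 1 - w 0 0); last by ring.
  rewrite (_ : (1 - w 0 0 == 1) = (w 0 0 == 0)); last first.
    by rewrite -subr_eq0 addrAC subrr add0r oppr_eq0.
  rewrite (_ : (1 - w 0 0 - w 0 1 == 0) = (w 0 0 + w 0 1 == 1)); last first.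
    by rewrite -addrA -opprD subr_eq0 eq_sym.
  by rewrite addnC addnA addnAC [X in (X + _)%N]addnC.
- pose E : 'M[R]_2 := \matrix_(i, j) nth 0 (nth [::] [:: [:: 1; -1]; [:: 0; -1]] i) j.
  exists E.
    apply: (@mulmx1_unit _ _ E E _).1.
    by apply/matrixP; apply: ord2P; apply: ord2P; rewrite !mxE big_ord_recl big_ord1 !mxE/=; ring.
  move=> w.
  have E0 : (e_ 1 + w *m E) 0 0 = w 0 0.
    by rewrite mxE mulmx_plane !mxE/=; ring.
  have E1 : (e_ 1 + w *m E) 0 1 = 1 - w 0 0 - w 0 1.
    by rewrite mxE mulmx_plane !mxE/=; ring.
  rewrite /simplex /depth /= E0 E1; split.
    by split=> -[? ? ?]; split; lra.
  rewrite (_ : w 0 0 + (1 - w 0 0 - w 0 1) = 1 - w 0 1); last by ring.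
  rewrite (_ : (1 - w 0 1 == 1) = (w 0 1 == 0)); last first.
    by rewrite -subr_eq0 addrAC subrr add0r oppr_eq0.
  rewrite (_ : (1 - w 0 0 - w 0 1 == 0) = (w 0 0 + w 0 1 == 1)); last first.
    by rewrite -addrA -opprD subr_eq0 eq_sym.
  by rewrite addnAC.
Qed.

Lemma simplex_compact : compact (@simplex R).
Proof.
apply: bounded_closed_compact.
  exists 1; split => // x x1 u [u0 u1 u01].
  apply: mx_norm_leP; first by rewrite ltW// (lt_trans ltr01).
  by move=> i; rewrite (ord1 i); apply: ord2P; rewrite ger0_norm//; lra.
have -> : @simplex R = (fun u : plane R => u 0 0) @^-1` [set x | 0 <= x] `&`
   ((fun u : plane R => u 0 1) @^-1` [set x | 0 <= x] `&`
   (fun u : plane R => u 0 0 + u 0 1) @^-1` [set x | x <= 1]).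
  by apply/seteqP; split => [u [? ? ?]|u [? [? ?]]]; split.
apply: closedI; last apply: closedI; apply: closed_comp.
- by move=> u _; exact: coord_continuous.
- exact: closed_ge.
- by move=> u _; exact: coord_continuous.
- exact: closed_ge.
- by move=> u _; apply: continuousD; exact: coord_continuous.
- exact: closed_le.
Qed.

End SimplexSymmetries.

Section Reparametrization.
Context {R : realType} {M : topologicalType} (S : surface R M).
Local Notation e_ i := (delta_mx 0 i : plane R).

Lemma simplex_embedding_affine (s : plane R -> M) (u : plane R) (E : 'M[R]_2) :
  E \in unitmx -> (forall w, simplex (u + w *m E) <-> simplex w) ->
  simplex_embedding S s -> simplex_embedding S (fun w => s (u + w *m E)).
Proof.
move=> uE sE [cs injs ims].
pose A (w : plane R) := u + w *m E.
have cA : continuous A.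
  move=> w; have C := @mulmxr_continuous R E w.
  exact: (@cvgD _ _ _ (nbhs w) _ (cst u) (fun w => w *m E) u _ (cvg_cst u) C).
have AL x (h : R) v : A (x + h *: v) = A x + h *: (v *m E).
  by rewrite /A mulmxDl scalemxAl addrA.
split.
- apply/subspace_continuousP => x sx.
  have sAx : simplex (A x) by apply/sE.
  have C : s y @[y --> within simplex (nbhs (A x))] --> s (A x).
    exact: (subspace_continuousP _ _).1 cs _ sAx.
  move=> P nP; have H : \forall y \near A x, simplex y -> P (s y) := C _ nP.
  have H' : \forall y \near x, simplex (A y) -> P (s (A y)) := cA x _ H.
  suff : \forall y \near x, simplex y -> P (s (A y)) by [].
  by apply: filterS H' => y Hy sy; apply: Hy; apply/sE.
- move=> x y /set_mem sx /set_mem sy sxy.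
  have : A x = A y by apply: injs => //; apply/mem_set; apply/sE.
  by move=> /addrI /(congr1 (fun w => w *m invmx E)); rewrite !mulmxK.
- move=> c ac x [sx cx].
  have [F [[U [oU Ux CF HF]] dF]] := ims c ac (A x) (conj ((sE x).2 sx) cx).
  exists (F \o A); split.
    exists (A @^-1` U); split => //.
    + by apply: open_comp => // y _; exact: cA.
    + by move=> k; apply: (Ck_comp_affine (L := fun v => v *m E)).
    + by move=> y [sy cy] Uy; apply: HF => //; split => //; apply/sE.
  move=> v v0; rewrite (derive_comp_affine (L := fun v => v *m E) AL).
  apply: dF; apply: contra v0 => /eqP /(congr1 (fun w => w *m invmx E)).
  by rewrite mulmxK// mul0mx => ->.
Qed.

(** Reduces to a tile whose corner is the image of the origin, near which the simplex is the
    quadrant [0 <= u 0 0], [0 <= u 0 1]. *)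
Lemma vertex_at_origin (K : Type) (s : K -> plane R -> M) k u :
  simplex_embedding S (s k) -> simplex u -> depth u = 2%N ->
  exists s' : plane R -> M, [/\ simplex_embedding S s', s' 0 = s k u,
    s' @` simplex = tile s k &
    s' @` [set w | simplex w /\ depth w = 0%N] = tile_interior s k].
Proof.
move=> es su du; have [E uE HE] := simplex_vertex_symmetry su du.
have sE w : simplex (u + w *m E) <-> simplex w := (HE w).1.
have dE w : depth (u + w *m E) = depth w := (HE w).2.
exists (fun w => s k (u + w *m E)); split.
- exact: simplex_embedding_affine.
- by rewrite mul0mx addr0.
- apply/seteqP; split => x [w sw <-].
    by exists (u + w *m E) => //; apply/sE.
  have Ew : u + (w - u) *m invmx E *m E = w by rewrite mulmxKV// addrC subrK.
  by exists ((w - u) *m invmx E); rewrite ?Ew//; apply/sE; rewrite Ew.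
- apply/seteqP; split => x [w [sw dw] <-].
    by exists (u + w *m E) => //; split; [apply/sE|rewrite dE].
  have Ew : u + (w - u) *m invmx E *m E = w by rewrite mulmxKV// addrC subrK.
  exists ((w - u) *m invmx E); rewrite ?Ew//.
  by split; [apply/sE; rewrite Ew|rewrite -dE Ew].
Qed.

End Reparametrization.

(** * Embedded simplices seen in a chart *)

Section EmbeddedSimplices.
Context {R : realType} {M : topologicalType} (S : surface R M).
Local Notation e_ i := (delta_mx 0 i : plane R).

(** Continuity of the inverse of the embedding: the part of the simplex away from [u] is compact, so
    its image is closed, and it misses [s u] by injectivity. *)
Lemma simplex_inverse_near (s : plane R -> M) u d :
  simplex_embedding S s -> simplex u -> 0 < d ->
  \forall q \near s u, forall v, simplex v -> s v = q -> ball u d v.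
Proof.
move=> [cs injs _] su d0.
pose K := @simplex R `&` ~` ball u d.
have cK : compact K.
  apply: (subclosed_compact _ simplex_compact); last by move=> v [].
  apply: closedI.
    apply: compact_closed; last exact: simplex_compact.
    exact: norm_hausdorff.
  by apply: open_closedC; exact: ball_open.
have csK : compact (s @` K).
  by apply: continuous_compact => //; apply: continuous_subspaceW cs => v [].
have clK : closed (s @` K) by apply: compact_closed => //; exact: (surface_hausdorff S).
have : open_nbhs (s u) (~` (s @` K)).
  split; first exact: closed_openC.
  move=> [v [sv nv] suv]; apply: nv.
  have -> : v = u by apply: injs => //; exact/mem_set.
  exact: ballxx.
move=> /open_nbhs_nbhs; apply: filterS => q nq v sv svq.
by apply: contrapT => nv; apply: nq; exists v.
Qed.

Lemma chart_inv_near (c : chart R M) q P : chart_dom c q -> nbhs q P ->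
  \forall z \near c q, chart_img c z -> P (chart_inv c z).
Proof.
move=> cq nP; have iq : chart_img c (c q) by exists q.
have C : chart_inv c v @[v --> within (chart_img c) (nbhs (c q))] --> chart_inv c (c q).
  exact: (subspace_continuousP _ _).1 (@chart_inv_continuous _ _ c) _ iq.
have nP' : nbhs (chart_inv c (c q)) P by rewrite chart_mapK.
exact: (C _ nP').
Qed.

Lemma simplex_embedding_near (s : plane R -> M) u P :
  simplex_embedding S s -> simplex u -> nbhs (s u) P ->
  \forall v \near u, simplex v -> P (s v).
Proof.
move=> [cs _ _] su nP.
have C : s v @[v --> within simplex (nbhs u)] --> s u.
  exact: (subspace_continuousP _ _).1 cs _ su.
exact: (C _ nP).
Qed.

Lemma immersion_jac (c : chart R M) (s : plane R -> M) u :
  simplex_embedding S s -> atlas S c -> simplex u -> chart_dom c (s u) ->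
  exists (F : plane R -> plane R) (U : set (plane R)),
  [/\ open U, U u, (forall k, Ck k U F),
      (forall v, simplex v -> chart_dom c (s v) -> U v -> c (s v) = F v) &
      jac F u \in unitmx].
Proof.
move=> [_ _ ims] ac su cu.
have [F [[U [oU Uu CF HF]] dF]] := ims c ac u (conj su cu).
exists F, U; split => //.
  by move=> v sv cv Uv; exact: HF.
rewrite unitmxE unitfE; apply/negP => /det0P[v v0 vJ].
have := dF v v0.
by rewrite (derive_jac v oU Uu (CF 1%N)) vJ eqxx.
Qed.

(** A small step along each of [- e_ 0], [- e_ 1] and [e_ 0] makes the three inequalities strict. *)
Lemma simplex_interior_point (u : plane R) : simplex u ->
  (\forall v \near u, simplex v) -> depth u = 0%N.
Proof.
move=> [u0 u1 u01] /(nbhs_ballP _ _).1 [d /= d0 H].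
have B (v : plane R) : `|v| <= d / 2 -> simplex (u + v).
  move=> vd; apply: H; rewrite -ball_normE/= opprD addNKr normrN.
  by rewrite (le_lt_trans vd)// ltr_pdivrMr// ltr_pMr// ltr1n.
have d2 : 0 < d / 2 by rewrite divr_gt0.
have N i (h : R) : `|h| <= d / 2 -> `|h *: e_ i| <= d / 2.
  move=> hd; apply: mx_norm_leP; first exact: ltW.
  move=> a b; rewrite !mxE; case: (_ && _); rewrite ?mulr1// mulr0 normr0.
  exact: ltW.
have Np : `|d / 2| <= d / 2 by rewrite gtr0_norm.
have Nm : `|- (d / 2)| <= d / 2 by rewrite normrN gtr0_norm.
have [A0 _ _] := B _ (N 0 _ Nm).
have [_ A1 _] := B _ (N 1 _ Nm).
have [_ _ A2] := B _ (N 0 _ Np).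
rewrite !mxE /= in A0 A1 A2.
have p0 : 0 < u 0 0 by lra.
have p1 : 0 < u 0 1 by lra.
have p2 : u 0 0 + u 0 1 < 1 by lra.
by rewrite /depth (gt_eqF p0) (gt_eqF p1) (lt_eqF p2).
Qed.

(* At a point [u] of the boundary of the simplex, the local extension [F] of [c \o s] maps
   points outside the simplex into [W], whose points are values of [F] inside the simplex:
   this contradicts the local injectivity of [F]. *)
Lemma open_in_tile_interior (c : chart R M) (s : plane R -> M) u (W : set (plane R)) :
  simplex_embedding S s -> atlas S c -> simplex u -> chart_dom c (s u) ->
  nbhs (c (s u)) W ->
  (forall z, W z -> exists v, [/\ simplex v, chart_dom c (s v) & c (s v) = z]) ->
  depth u = 0%N.
Proof.
move=> es ac su cu nW HW; apply: simplex_interior_point => //.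
have [F [U [oU Uu CF HF uJ]]] := immersion_jac es ac su cu.
have [d d0 inj] := locally_injective oU Uu (CF 1%N) uJ.
have nU : nbhs u U by exact: open_nbhs_nbhs.
have [d1 /= d10 Hd1] := (nbhs_ballP _ _).1 nU.
have dd0 : 0 < Num.min d d1 by rewrite lt_min d0.
(* Ensures that the preimage in the simplex supplied by [HW] lies in the ball where [F] is
   injective. *)
have I1 := chart_inv_near cu (simplex_inverse_near es su dd0).
have nF : \forall z \near c (s u), W z /\ (chart_img c z ->
    forall v, simplex v -> s v = chart_inv c z -> ball u (Num.min d d1) v).
  exact: filterI nW I1.
have cF : {for u, continuous F} by exact: Ck_continuous (CF 0%N) Uu.
have Fu : F u = c (s u) by rewrite HF.
rewrite -Fu in nF.
have nF' : \forall w \near u, W (F w) /\ (chart_img c (F w) ->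
    forall v, simplex v -> s v = chart_inv c (F w) -> ball u (Num.min d d1) v).
  exact: cF _ nF.
have nB : nbhs u (ball u (Num.min d d1)) by exact: nbhsx_ballx.
apply: filterS2 nF' nB => w [Ww Iw] uw.
have [v [sv cv Ev]] := HW _ Ww.
have iF : chart_img c (F w) by rewrite -Ev; exists (s v).
have uv : ball u (Num.min d d1) v.
  by apply: (Iw iF) => //; rewrite -Ev chart_mapK.
suff -> : w = v by [].
apply: inj.
- by apply: le_ball uw; rewrite ge_min lexx.
- by apply: le_ball uv; rewrite ge_min lexx.
rewrite -Ev HF//; apply: Hd1; apply: le_ball uv; by rewrite ge_min lexx orbT.
Qed.

End EmbeddedSimplices.

(** * Local shape of a tile at its corner *)

Section Corner.
Context {R : realType} {M : topologicalType} (S : surface R M).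
Local Notation e_ i := (delta_mx 0 i : plane R).
Variables (s : plane R -> M) (c : chart R M).
Hypotheses (es : simplex_embedding S s) (ac : atlas S c) (cp : chart_dom c (s 0)).
Variables (F : plane R -> plane R) (U : set (plane R)).
Hypotheses (oU : open U) (U0 : U 0) (CF : forall k, Ck k U F).
Hypothesis HF : forall v, simplex v -> chart_dom c (s v) -> U v -> c (s v) = F v.
Hypothesis uJ : jac F 0 \in unitmx.
(** The rows of [jac F 0] are the directions of the two edges at the corner, so [d *m B] lists the
    coordinates of [d] in that basis: the sector is the set where both are nonnegative. *)
Notation B := (invmx (jac F 0)).

Lemma simplex0 : simplex (0 : plane R).
Proof. by rewrite /simplex /= !mxE; split; rewrite ?addr0 ?ler01. Qed.

Let F0 : F 0 = c (s 0).
Proof. by rewrite HF//; exact: simplex0. Qed.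

(** A parameter [u] of the point [c (s 0) + rho *: d'] would be [rho *: (d' *m B)] up to a small
    multiple of [rho], hence have a negative coordinate. The estimate holds uniformly for [d'] near
    [d]. *)
Lemma corner_avoids_rays (d : plane R) i : (d *m B) 0 i < 0 ->
  exists2 r, 0 < r & forall d' rho u, ball d r d' -> 0 < rho < r -> simplex u ->
    chart_dom c (s u) -> c (s u) <> c (s 0) + rho *: d'.
Proof.
move=> dBi.
pose m := - (d *m B) 0 i; have m0 : 0 < m by rewrite oppr_gt0.
pose X := `|d *m B| + m / 2; have X0 : 0 < X by rewrite ltr_wpDl// divr_gt0.
pose C := 2 * `|B| + 1; have C0 : 0 < C by rewrite ltr_wpDl// mulr_ge0.
(* Rate 1/2 gives [|u| <= 2 rho X]; the error [eta |u|] is then at most [rho m / 4], while the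
   coordinate is at most [- rho m / 2]. *)
pose eta := Num.min 2^-1 (m / (8 * X)).
have eta0 : 0 < eta by rewrite lt_min invr_gt0 ltr0n/= divr_gt0// mulr_gt0.
have eta2 : eta <= 2^-1 by rewrite ge_min lexx.
have etam : eta <= m / (8 * X) by rewrite ge_min lexx orbT.
have [d1 d10 [Ud1 Hd1]] := strict_derivative_normalized oU U0 (CF 1%N) uJ eta0.
have I1 := chart_inv_near cp (simplex_inverse_near es simplex0 d10).
have [d2 /= d20 Hd2] := (nbhs_ballP _ _).1 I1.
pose Y := `|d| + 1; have Y0 : 0 < Y by rewrite ltr_wpDl.
pose r := Num.min (m / (2 * C)) (Num.min 1 (d2 / Y)).
have r0 : 0 < r by rewrite !lt_min ltr01/= !divr_gt0// mulr_gt0.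
have r1 : r <= m / (2 * C) by rewrite ge_min lexx.
have r2 : r <= 1 by rewrite !ge_min lexx orbT.
have r3 : r <= d2 / Y by rewrite !ge_min lexx !orbT.
exists r => // d' rho u; rewrite -ball_normE/= => dd' /andP[rho0 rhor] su cu Ecu.
have d'Y : `|d'| < Y.
  have -> : d' = d - (d - d') by rewrite subKr.
  rewrite (le_lt_trans (ler_normB _ _))// ltrD2l.
  exact: lt_le_trans dd' r2.
have near_p : ball (c (s 0)) d2 (c (s u)).
  rewrite Ecu -ball_normE/= opprD addNKr normrN normrZ gtr0_norm//.
  have : rho * `|d'| < d2 / Y * Y.
    exact: ltr_pM (ltW rho0) (normr_ge0 _) (lt_le_trans rhor r3) d'Y.
  by rewrite divfK// gt_eqF.
have iu : chart_img c (c (s u)) by exists (s u).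
have u_small : ball 0 d1 u by apply: (Hd2 _ near_p iu) => //; rewrite chart_mapK.
have := Hd1 u 0 u_small (ballxx _ d10).
rewrite subr0 -HF//; last exact: Ud1.
rewrite F0 Ecu [c (s 0) + _]addrC addrK -scalemxAl.
set z := d' *m B => Hu.
have zd : `|z - d *m B| <= m / 2.
  rewrite -mulmxBl (le_trans (mulmx_norm_le _ _))//.
  have : C * `|d' - d| <= C * (m / (2 * C)).
    by rewrite ler_wpM2l ?ltW// distrC (lt_le_trans dd').
  have -> : C * (m / (2 * C)) = m / 2.
    rewrite invfM mulrCA [C * _]mulrCA mulfV ?gt_eqF//; ring.
  apply: le_trans; rewrite ler_wpM2r//.
  by rewrite lerDl.
clearbody z.
have zX : `|z| <= X.
  by rewrite -(subrK (d *m B) z) addrC (le_trans (ler_normD _ _))// lerD2l.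
have zi : z 0 i <= - (m / 2).
  have := le_trans (mx_coord_le (z - d *m B) 0 i) zd.
  by rewrite addmxE oppmxE ler_norml => /andP[_]; rewrite /m; lra.
have ui : 0 <= u 0 i by move: i {dBi m m0 X X0 eta eta0 eta2 etam Hd1 r r0 r1 r2 r3 rhor dd' Hu zd zX zi}; case: su => ? ? _; apply: ord2P.
have un : `|u| <= 2 * (rho * X).
  have : `|u| <= `|rho *: z - u| + `|rho *: z|.
    by rewrite -{1}(subKr (rho *: z) u) [leRHS]addrC; exact: ler_normB.
  rewrite normrZ (gtr0_norm rho0).
  have : rho * `|z| <= rho * X by rewrite ler_wpM2l// ltW.
  have : eta * `|u| <= 2^-1 * `|u| by rewrite ler_wpM2r.
  by move: Hu; lra.
have Hui := le_trans (mx_coord_le (rho *: z - u) 0 i) Hu.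
rewrite addmxE oppmxE scalemxE ler_norml in Hui; case/andP: Hui => Hui _.
have E1 : eta * `|u| <= m / (8 * X) * (2 * (rho * X)).
  by rewrite ler_pM// ltW.
have E2 : m / (8 * X) * (2 * (rho * X)) = rho * m / 4.
  by field; rewrite gt_eqF.
have E3 : rho * z 0 i <= rho * - (m / 2) by rewrite ler_wpM2l// ltW.
have E4 : 0 < rho * m by rewrite mulr_gt0.
by rewrite E2 in E1; lra.
Qed.

(** The solution [u] given by [locally_surjective] for the target [rho *: (d *m B)] is so close to
    it that both coordinates stay positive. *)
Lemma corner_interior (d : plane R) : (forall i, 0 < (d *m B) 0 i) ->
  exists2 r, 0 < r & forall rho, 0 < rho < r ->
    exists u, [/\ simplex u, depth u = 0%N, chart_dom c (s u) &
      c (s u) = c (s 0) + rho *: d].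
Proof.
move=> dB; pose m := Num.min ((d *m B) 0 0) ((d *m B) 0 1).
have m0 : 0 < m by rewrite lt_min !dB.
have mi i : m <= (d *m B) 0 i.
  by move: i; apply: ord2P; rewrite /m ge_min lexx ?orbT.
pose X := `|d *m B| + 1; have X0 : 0 < X by rewrite ltr_wpDl.
have XdB : `|d *m B| <= X by rewrite lerDl.
pose eta := Num.min 1 (m / (2 * X)).
have eta0 : 0 < eta by rewrite lt_min ltr01/= divr_gt0// mulr_gt0.
have eta1 : eta <= 1 by rewrite ge_min lexx.
have etam : eta <= m / (2 * X) by rewrite ge_min lexx orbT.
have [r1 r10 H1] := locally_surjective oU U0 (CF 1%N) uJ eta0.
have nd : nbhs (s 0) (chart_dom c) by apply: open_nbhs_nbhs; split => //; exact: chart_open.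
have nU : nbhs (0 : plane R) U by exact: open_nbhs_nbhs.
have [r2 /= r20 H2] := (nbhs_ballP _ _).1 (filterI nU (simplex_embedding_near es simplex0 nd)).
(* As [|u| <= 2 rho X], the three bounds respectively put the target in the range of [H1], put [u]
   in the ball of [H2], and keep [u 0 0 + u 0 1 <= 4 rho X] below 1. *)
pose r := Num.min (r1 / X) (Num.min (r2 / (3 * X)) (1 / (5 * X))).
exists r; first by rewrite !lt_min !divr_gt0// mulr_gt0.
move=> rho /andP[rho0]; rewrite !lt_min => /and3P[].
rewrite !ltr_pdivlMr ?mulr_gt0// => Hr1 Hr2 Hr3.
have zn : `|rho *: (d *m B)| <= rho * X.
  by rewrite normrZ gtr0_norm// ler_wpM2l// ltW.
have [|u [un Fu]] := H1 (rho *: (d *m B)); first by rewrite (le_trans zn)// ltW.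
rewrite subr0 in un.
have rX : 0 < rho * X by rewrite mulr_gt0.
have un2 : `|u| <= 2 * (rho * X).
  rewrite -(subrK (rho *: (d *m B)) u) (le_trans (ler_normD _ _))//.
  have : eta * `|rho *: (d *m B)| <= 1 * (rho * X) by rewrite ler_pM// ltW.
  lra.
have ui i : 0 < u 0 i.
  have := le_trans (mx_coord_le _ 0 i) un.
  rewrite addmxE oppmxE scalemxE ler_norml => /andP[+ _].
  have : eta * `|rho *: (d *m B)| <= m / (2 * X) * (rho * X) by rewrite ler_pM// ltW.
  have -> : m / (2 * X) * (rho * X) = rho * m / 2 by field; rewrite gt_eqF.
  have : rho * m <= rho * (d *m B) 0 i by rewrite ler_wpM2l// ltW.
  have : 0 < rho * m by rewrite mulr_gt0.
  lra.
have ub i : u 0 i <= 2 * (rho * X).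
  by rewrite (le_trans (ler_norm _))// (le_trans (mx_coord_le _ _ _)).
have u01 : u 0 0 + u 0 1 < 1 by have := ub 0; have := ub 1; lra.
have su : simplex u by split; rewrite ?ltW.
have [|Uu cu] := H2 u.
- by rewrite -ball_normE/= sub0r normrN; lra.
exists u; split => //.
- by rewrite /depth !(gt_eqF (ui _)) (lt_eqF u01).
- exact: cu.
- by rewrite HF//; [rewrite Fu F0 -scalemxAl mulmxKV//|exact: cu].
Qed.

(** An edge whose direction had a negative second component would leave the half-plane right after
    the corner, which lies on the boundary. *)
Lemma corner_jac_ge0 i : c (s 0) 0 1 = 0 -> 0 <= jac F 0 i 1.
Proof.
move=> cp0; rewrite leNgt; apply/negP => Jneg.
pose m := - jac F 0 i 1; have m0 : 0 < m by rewrite oppr_gt0.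
have m2 : 0 < m / 2 by rewrite divr_gt0.
have [r1 r10 H1] := strict_derivative oU U0 (CF 1%N) m2.
have nd : nbhs (s 0) (chart_dom c) by apply: open_nbhs_nbhs; split => //; exact: chart_open.
have nU : nbhs (0 : plane R) U by exact: open_nbhs_nbhs.
have [r2 /= r20 H2] := (nbhs_ballP _ _).1 (filterI nU (simplex_embedding_near es simplex0 nd)).
pose h := Num.min 1 (Num.min r1 r2) / 2.
have n0 : 0 < Num.min 1 (Num.min r1 r2) by rewrite !lt_min ltr01 r10.
have h0 : 0 < h by rewrite divr_gt0.
have : h < Num.min 1 (Num.min r1 r2) by rewrite ltr_pdivrMr// ltr_pMr// ltr1n.
rewrite !lt_min => /and3P[h1 hr1 hr2].
pose u := h *: e_ i.
have un : `|u| <= h.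
  apply: mx_norm_leP; first exact: ltW.
  move=> a b; rewrite /u !mxE; case: (_ && _); first by rewrite mulr1 gtr0_norm.
  by rewrite mulr0 normr0 ltW.
have su : simplex u.
  rewrite /simplex /= /u !mxE/=.
  by apply: (ord2P (P := fun i => [/\ 0 <= h * (0 == i)%:R, 0 <= h * (1 == i)%:R & h * (0 == i)%:R + h * (1 == i)%:R <= 1])); rewrite /= ?mulr1 ?mulr0 ?addr0 ?add0r; split => //; exact: ltW.
have [] := H2 u.
  by rewrite -ball_normE/= sub0r normrN (le_lt_trans un).
move=> Uu /(_ su) cu.
have bu : ball 0 r1 u by rewrite -ball_normE/= sub0r normrN (le_lt_trans un).
have := H1 u 0 bu (ballxx _ r10).
rewrite subr0 -HF// F0 => H.
have := le_trans (mx_coord_le _ 0 1) (le_trans H (ler_wpM2l (ltW m2) un)).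
rewrite !addmxE !oppmxE cp0 /u -scalemxAl -rowE scalemxE [row _ _ _ _]mxE.
have c0 : 0 <= c (s u) 0 1 by apply: (@chart_img_ge0 _ _ c); exists (s u).
rewrite ler_norml -/u => /andP[_].
have : 0 < h * m by rewrite mulr_gt0.
by rewrite /m; lra.
Qed.

End Corner.

Section TangentCone.
Context {R : realType} {M : topologicalType} (S : surface R M).
Local Notation e_ i := (delta_mx 0 i : plane R).
Variables (s : plane R -> M).
Local Notation c := (chart_at S (s 0)).
Hypotheses (es : simplex_embedding S s).
Variables (F : plane R -> plane R) (U : set (plane R)).
Hypotheses (oU : open U) (U0 : U 0) (CF : forall k, Ck k U F).
Hypothesis HF : forall v, simplex v -> chart_dom c (s v) -> U v -> c (s v) = F v.
Hypothesis uJ : jac F 0 \in unitmx.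
Notation B := (invmx (jac F 0)).

Let ac : atlas S c. Proof. exact: chart_at_atlas. Qed.
Let cp : chart_dom c (s 0). Proof. exact: chart_at_dom. Qed.

(** At a small time [t] the curve is at [c (s 0) + t *: d'] with [d'] its difference quotient, which
    tends to [v]: it would meet a cone that the tile avoids. *)
Lemma tangent_cone_sub v : tangent_cone S (s 0) (s @` simplex) v ->
  forall i, 0 <= (v *m B) 0 i.
Proof.
move=> [tau [sig [tau0 ssig sig0 Dsig vsig]]] i; rewrite leNgt; apply/negP => vBi.
have [r r0 Hr] := corner_avoids_rays es cp oU U0 CF HF uJ vBi.
have ct : chart_times c [set` `[0, tau]] sig 0.
  by split; rewrite /= ?in_itv/= ?lexx ?ltW// sig0.
have [G [d [d0 CG HG]]] := smooth_curve_local tau0 ssig ac ct.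
have tau00 : 0 <= (0 : R) <= tau by rewrite lexx ltW.
have [_ G0 vG _] := HG 0 (ballxx _ d0) tau00.
rewrite /velocity sig0 vG in vsig.
have dG : derivable G 0 1 by exact: Ck_derivable (CG 1%N) (ballxx _ d0).
have Q := derive_quotient dG; rewrite vsig in Q.
have nB : nbhs v (ball v r) by exact: nbhsx_ballx.
have H : \forall t \near (0 : R)^', ball v r ((t - 0)^-1 *: (G t - G 0)) := Q _ nB.
have [e /= e0 He] := (nbhs_ballP _ _).1 H.
pose t := Num.min (Num.min e d) (Num.min r tau) / 2.
have m0 : 0 < Num.min (Num.min e d) (Num.min r tau) by rewrite !lt_min e0 d0 r0.
have t0 : 0 < t by rewrite divr_gt0.
have : t < Num.min (Num.min e d) (Num.min r tau).
  by rewrite ltr_pdivrMr// ltr_pMr// ltr1n.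
rewrite !lt_min => /andP[/andP[te td] /andP[tr ttau]].
have Bt a : t < a -> ball 0 a t by move=> ta; rewrite -ball_normE/= sub0r normrN gtr0_norm.
have tT : 0 <= t <= tau by rewrite !ltW.
have := He t (Bt _ te) (lt0r_neq0 t0); rewrite subr0 => bd.
have [[_ ct'] Gt _ _] := HG t (Bt _ td) tT.
have [u su Eu] := Dsig t tT.
have t0r : 0 < t < r by rewrite t0.
apply: (Hr _ t u bd t0r su); first by rewrite Eu.
have Gp : G 0 = c (s 0) by rewrite -G0 sig0.
by rewrite Eu Gt Gp scalerA mulfV ?gt_eqF// scale1r addrC subrK.
Qed.

Lemma tangent_cone_sup v : (forall i, 0 <= (v *m B) 0 i) ->
  tangent_cone S (s 0) (s @` simplex) v.
Proof.
move=> vB; pose w := v *m B.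
(* Up to this time [t *: w] stays in the simplex; the added 1 covers [w = 0]. *)
pose tau := (w 0 0 + w 0 1 + 1)^-1.
have W0 : 0 < w 0 0 + w 0 1 + 1 by rewrite ltr_wpDl// addr_ge0//; exact: vB.
have tau0 : 0 < tau by rewrite invr_gt0.
have st t : 0 <= t <= tau -> simplex (t *: w).
  move=> /andP[t0 tt]; split; rewrite !scalemxE; try by rewrite mulr_ge0//; exact: vB.
  have : t * (w 0 0 + w 0 1 + 1) <= tau * (w 0 0 + w 0 1 + 1) by rewrite ler_wpM2r// ltW.
  by rewrite /tau mulVf ?gt_eqF//; lra.
pose sig t := s (t *: w).
have lc : continuous (fun t : R => t *: w) by exact: scalel_continuous.
have LA (x h a : R) : (x + h *: (a : R^o)) *: w = x *: w + h *: (a *: w).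
  by rewrite scalerDl scalerA.
have csig : {within [set` `[0, tau]], continuous sig}.
  apply/subspace_continuousP => t; rewrite /= in_itv/= => tt P nP.
  have H := simplex_embedding_near es (st t tt) nP.
  have H' : \forall y \near t, simplex (y *: w) -> P (s (y *: w)) := lc t _ H.
  suff : \forall y \near t, y \in `[0, tau] -> P (s (y *: w)) by [].
  by apply: filterS H' => y Hy; rewrite in_itv/= => /st; exact: Hy.
have ssig : smooth_curve S [set` `[0, tau]] sig.
  split => // c' ac' t [/= tt ct]; rewrite in_itv/= in tt.
  have [G [V [oV Vt CG HG _]]] := immersion_jac es ac' (st t tt) ct.
  exists (G \o (fun t : R^o => t *: w)).
  exists ((fun t : R^o => t *: w) @^-1` V); split => //.
  - by apply: open_comp => // y _; exact: lc.
  - by move=> k; apply: (Ck_comp_affine (L := fun a : R^o => a *: w)).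
  - by move=> y [/=]; rewrite in_itv/= => yt cy Vy; apply: HG => //; exact: st.
exists tau, sig; split => //.
- by rewrite /sig scale0r.
- by move=> t /st stw; exists (t *: w).
have E0 : (0 : R) *: w = 0 by rewrite scale0r.
have ct : chart_times c [set` `[0, tau]] sig 0.
  by split; rewrite /= ?in_itv/= ?lexx ?ltW// /sig E0.
have [d d0 Hd] := chart_times_near ssig ct.
have tau00 : 0 <= (0 : R) <= tau by rewrite lexx ltW.
have dF : derivable F (0 *: w) (1 *: w).
  by rewrite E0; exact: Ck_derivable (CF 1%N) U0.
rewrite /velocity {1}/sig E0.
have -> : v = 'D_1 (F \o (fun t : R^o => t *: w)) (0 : R^o).
  rewrite (derive_comp_affine (L := fun a : R^o => a *: w))// scale1r E0.
  by rewrite (derive_jac _ oU U0 (CF 1%N)) mulmxKV.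
apply: derive_withinE.
- exact: itv_clusters_at tau0 tau00 d0 Hd.
- exact: (derivable_comp_affine (L := fun a : R^o => a *: w)).
- by rewrite /= /sig E0 HF//; exact: simplex0.
have nU : nbhs (0 *: w) U by rewrite E0; exact: open_nbhs_nbhs.
have H : \forall t \near (0 : R), U (t *: w) := lc 0 _ nU.
apply: filterS H => t Ut [/= tt ctt]; rewrite in_itv/= in tt.
by apply: HF => //; exact: st.
Qed.

End TangentCone.

(** * Angular sectors of the half-plane *)

Section Sectors.
Context {R : realType}.
Local Notation e_ i := (delta_mx 0 i : plane R).

Lemma polar_coordinates (a b : R) : 0 <= b -> (a != 0) || (b != 0) ->
  exists r phi, [/\ 0 < r, 0 <= phi <= pi, a = r * cos phi & b = r * sin phi].
Proof.
move=> b0 ab0; pose r := Num.sqrt (a ^+ 2 + b ^+ 2).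
have n0 : 0 < a ^+ 2 + b ^+ 2.
  have [a0|a0] := eqVneq a 0.
    by rewrite a0 eqxx/= in ab0; rewrite a0 expr0n/= add0r exprn_even_gt0.
  by rewrite ltr_pwDl// ?sqr_ge0// exprn_even_gt0.
have r0 : 0 < r by rewrite sqrtr_gt0.
have r2 : r ^+ 2 = a ^+ 2 + b ^+ 2 by rewrite sqr_sqrtr// ltW.
have ar : -1 <= a / r <= 1.
  rewrite -ler_norml normrM normfV (gtr0_norm r0) ler_pdivrMr// mul1r.
  by rewrite -(gtr0_norm r0) -ler_sqr ?nnegrE// !real_normK ?num_real// r2 lerDl sqr_ge0.
exists r, (acos (a / r)); split => //.
- by rewrite acos_ge0// acos_lepi.
- by rewrite acosK ?in_itv//= mulrC divfK// gt_eqF.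
- rewrite sin_acos//.
  have -> : 1 - (a / r) ^+ 2 = (b / r) ^+ 2.
    by rewrite !expr_div_n r2; field; rewrite -r2 gt_eqF// exprn_gt0.
  by rewrite sqrtr_sqr ger0_norm ?divr_ge0// ?ltW// mulrC divfK// gt_eqF.
Qed.

(** All differences of angles lie in [-pi, pi], inside which the sign of the sine is that of its
    argument; [sin (b - a) != 0] excludes the flat sector [0, pi]. *)
Lemma sin_sector (a b t : R) : 0 <= a -> a < b -> b <= pi -> sin (b - a) != 0 ->
  0 <= t <= pi ->
  [/\ 0 < sin (b - a), 0 <= sin (b - t) /\ 0 <= sin (t - a) <-> a <= t <= b &
    a < t < b -> 0 < sin (b - t) /\ 0 < sin (t - a)].
Proof.
move=> a0 ab bpi sab /andP[t0 tpi].
have sneg (x y : R) : x < y -> y - x < pi -> sin (x - y) < 0.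
  by move=> xy yx; rewrite -opprB sinN oppr_lt0 sin_gt0_pi// subr_gt0 xy.
split.
- by rewrite lt_neqAle eq_sym sab sin_ge0_pi//; lra.
- split=> [[s1 s2]|/andP[at_ tb]].
    apply/andP; split; rewrite leNgt; apply/negP => h.
      have d : a - t < pi by lra.
      by have := sneg _ _ h d; lra.
    have d : t - b < pi by lra.
    by have := sneg _ _ h d; lra.
  by split; apply: sin_ge0_pi; lra.
- by move=> /andP[h1 h2]; split; apply: sin_gt0_pi; lra.
Qed.

Variables (om nu : plane R).
Hypotheses (om1 : om 0 1 = 0) (om0 : om 0 0 != 0) (nu1 : 0 < nu 0 1).

(* [om] and [nu] need not be orthonormal here: [t] is an angle in the linear coordinates
   of the basis [(om, nu)]. *)
Definition direction (t : R) : plane R := cos t *: om + sin t *: nu.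

Lemma half_plane_direction (v : plane R) : v != 0 -> 0 <= v 0 1 ->
  exists r phi, [/\ 0 < r, 0 <= phi <= pi & v = r *: direction phi].
Proof.
move=> v0 v1; pose b := v 0 1 / nu 0 1; pose a := (v 0 0 - b * nu 0 0) / om 0 0.
have nu10 : nu 0 1 != 0 by rewrite gt_eqF.
have E : v = a *: om + b *: nu.
  apply/rowP; apply: ord2P; rewrite addmxE !scalemxE.
    by rewrite /a divfK// subrK.
  by rewrite om1 mulr0 add0r /b divfK.
have [||r [phi [r0 p ra rb]]] := @polar_coordinates a b.
- by rewrite divr_ge0// ltW.
- apply: contraT; rewrite negb_or !negbK => /andP[/eqP a0 /eqP b0].
  by move: v0; rewrite E a0 b0 !scale0r addr0 eqxx.
exists r, phi; split => //.
by rewrite E ra rb /direction scalerDr !scalerA.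
Qed.

(** Cramer's rule: the determinant of two directions in the basis [(om, nu)] is the sine of the
    difference of their angles. *)
Lemma direction_combination (rP rQ p q t : R) : rP != 0 -> rQ != 0 -> sin (q - p) != 0 ->
  direction t = (sin (q - t) / (rP * sin (q - p))) *: (rP *: direction p) +
                (sin (t - p) / (rQ * sin (q - p))) *: (rQ *: direction q).
Proof.
move=> rP0 rQ0 s0; apply/rowP => j; rewrite /direction !(addmxE, scalemxE).
move: s0; rewrite !sinB => s0; field.
by rewrite s0 rQ0 rP0.
Qed.

Lemma independent_directions (J : 'M[R]_2) rP rQ p q : J \in unitmx ->
  0 < rP -> 0 < rQ ->
  row 0 J = rP *: direction p -> row 1 J = rQ *: direction q -> sin (q - p) != 0.
Proof.
move=> uJ rP0 rQ0 EP EQ; apply/negP => /eqP s0.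
have comb (x y : R) : (x *: e_ 0 + y *: e_ 1) *m J =
    (x * rP * cos p + y * rQ * cos q) *: om + (x * rP * sin p + y * rQ * sin q) *: nu.
  rewrite mulmxDl -!scalemxAl -!rowE EP EQ /direction.
  by apply/rowP => j; rewrite !(addmxE, scalemxE); ring.
have K (x y : R) : x * rP * cos p + y * rQ * cos q = 0 ->
    x * rP * sin p + y * rQ * sin q = 0 -> x = 0 /\ y = 0.
  move=> h1 h2; have := comb x y; rewrite h1 h2 !scale0r addr0.
  move=> /(congr1 (fun w => w *m invmx J)); rewrite mulmxK// mul0mx => E.
  have := congr1 (fun w : plane R => w 0 0) E; have := congr1 (fun w : plane R => w 0 1) E.
  by rewrite !mxE/= !mulr1 !mulr0 addr0 add0r => -> ->.
have nP : rP != 0 by rewrite gt_eqF.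
have nQ : rQ != 0 by rewrite gt_eqF.
rewrite sinB in s0.
(* If the determinant vanishes, the rows, normalized, satisfy two linear relations, with
   coefficients [(sin q, - sin p)] and [(cos q, - cos p)]; independence would make [sin q] and
   [cos q] both zero. *)
have [||sq0 _] := K (sin q / rP) (- sin p / rQ).
- by rewrite !divfK//; lra.
- by rewrite !divfK//; ring.
have [||cq0 _] := K (cos q / rP) (- cos p / rQ).
- by rewrite !divfK//; ring.
- by rewrite !divfK//; lra.
have := cos2Dsin2 q; move: sq0 cq0 => /eqP + /eqP.
rewrite !mulf_eq0 !invr_eq0 (negPf nP) !orbF => /eqP -> /eqP ->.
by rewrite expr0n/= addr0 => /eqP; rewrite eq_sym oner_eq0.
Qed.

(** The rows have polar angles in [0, pi], and these bound the sector. Which row comes first depends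
    on the orientation of the parametrization, hence two symmetric cases. *)
Lemma sector_angles (J : 'M[R]_2) : J \in unitmx -> (forall i, 0 <= J i 1) ->
  exists a b, [/\ 0 <= a, a < b, b <= pi & forall t, 0 <= t <= pi ->
    ((forall i, 0 <= (direction t *m invmx J) 0 i) <-> a <= t <= b) /\
    (a < t < b -> forall i, 0 < (direction t *m invmx J) 0 i)].
Proof.
move=> uJ J1.
have rn0 i : row i J != 0.
  apply/negP => /eqP Ji; have := mulmxK uJ (e_ i).
  rewrite -rowE Ji mul0mx => /(congr1 (fun w : plane R => w 0 i)).
  by rewrite !mxE !eqxx => /esym/eqP; rewrite oner_eq0.
have rowJ1 i : 0 <= row i J 0 1 by rewrite mxE.
have [rP [p [rP0 p0 EP]]] := half_plane_direction (rn0 0) (rowJ1 0).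
have [rQ [q [rQ0 q0 EQ]]] := half_plane_direction (rn0 1) (rowJ1 1).
have s0 := independent_directions uJ rP0 rQ0 EP EQ.
have nP : rP != 0 by rewrite gt_eqF.
have nQ : rQ != 0 by rewrite gt_eqF.
have E t : direction t *m invmx J =
    (sin (q - t) / (rP * sin (q - p))) *: e_ 0 + (sin (t - p) / (rQ * sin (q - p))) *: e_ 1.
  apply: (canLR (mulmxK uJ)).
  by rewrite mulmxDl -!scalemxAl -!rowE EP EQ; exact: direction_combination.
have E0 t : (direction t *m invmx J) 0 0 = sin (q - t) / (rP * sin (q - p)).
  by rewrite E !(addmxE, scalemxE) !mxE/= mulr1 mulr0 addr0.
have E1 t : (direction t *m invmx J) 0 1 = sin (t - p) / (rQ * sin (q - p)).
  by rewrite E !(addmxE, scalemxE) !mxE/= mulr1 mulr0 add0r.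
have /andP[p0' ppi] := p0; have /andP[q0' qpi] := q0.
have [pq|qp|pq] := ltgtP p q.
- exists p, q; split => // t tt.
  have [sp H1 H2] := sin_sector p0' pq qpi s0 tt.
  split; last first.
    by move=> /H2[h1 h2]; apply: ord2P; rewrite (E0, E1) divr_gt0// mulr_gt0.
  split=> [h|/H1[h1 h2]].
    apply/H1; have := h 0; have := h 1.
    by rewrite E0 E1 !pmulr_lge0// invr_gt0 mulr_gt0.
  by apply: ord2P; rewrite (E0, E1) divr_ge0// mulr_ge0// ltW.
- have s0' : sin (p - q) != 0 by rewrite -opprB sinN oppr_eq0.
  have E0' t : (direction t *m invmx J) 0 0 = sin (t - q) / (rP * sin (p - q)).
    by rewrite E0 -(opprB p q) -(opprB t q) !sinN mulrN invrN mulrNN.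
  have E1' t : (direction t *m invmx J) 0 1 = sin (p - t) / (rQ * sin (p - q)).
    by rewrite E1 -(opprB p q) -(opprB p t) !sinN mulrN invrN mulrNN.
  exists q, p; split => // t tt.
  have [sp H1 H2] := sin_sector q0' qp ppi s0' tt.
  split; last first.
    by move=> /H2[h1 h2]; apply: ord2P; rewrite (E0', E1') divr_gt0// mulr_gt0.
  split=> [h|/H1[h1 h2]].
    apply/H1; have := h 0; have := h 1.
    by rewrite E0' E1' !pmulr_lge0// invr_gt0 mulr_gt0.
  by apply: ord2P; rewrite (E0', E1') divr_ge0// mulr_ge0// ltW.
- by rewrite pq subrr sin0 eqxx in s0.
Qed.

(** The last hypothesis only concerns angles in [0, pi]; those beyond [pi] have a negative sine, and
    are excluded from the supremum because the cone lies in the half-plane. *)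
Lemma max_angle_sector (J : 'M[R]_2) (C : set (plane R)) (a b : R) :
  J \in unitmx -> (forall i, 0 <= J i 1) ->
  (forall v, C v <-> forall i, 0 <= (v *m invmx J) 0 i) ->
  0 <= a -> a < b -> b <= pi ->
  (forall t, 0 <= t <= pi ->
    (forall i, 0 <= (direction t *m invmx J) 0 i) <-> a <= t <= b) ->
  max_angle om nu C = b.
Proof.
move=> uJ J1 HC a0 ab bpi H.
have dirE (r t : R) : (r * cos t) *: om + (r * sin t) *: nu = r *: direction t.
  by rewrite /direction scalerDr !scalerA.
pose A := [set th : R | 0 <= th < 2 * pi /\
    exists2 r, 0 < r & C ((r * cos th) *: om + (r * sin th) *: nu)].
have pi0 := pi_gt0 R.
have ub : ubound A b.
  move=> t [/andP[t0 t2] [r r0]]; rewrite dirE => /HC Hr.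
  have Ht i : 0 <= (direction t *m invmx J) 0 i.
    by have := Hr i; rewrite -scalemxAl scalemxE pmulr_rge0.
  have s0 : 0 <= sin t.
    have : 0 <= direction t 0 1.
      rewrite -(mulmxKV uJ (direction t)) mulmx_plane.
      by rewrite addr_ge0// mulr_ge0.
    by rewrite /direction addmxE !scalemxE om1 mulr0 add0r pmulr_lge0.
  have tpi : t <= pi.
    rewrite leNgt; apply/negP => pit.
    have : 0 < sin (t - pi) by apply: sin_gt0_pi; lra.
    have : sin t = - sin (t - pi) by rewrite -[in LHS](subrK pi t) sinDpi.
    lra.
  have tt : 0 <= t <= pi by rewrite t0.
  by have /andP[] := (H t tt).1 Ht.
have Ab : A b.
  split; first by lra.
  exists 1 => //; rewrite dirE scale1r; apply/HC.
  by apply/H; rewrite ?lexx ?andbT; lra.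
apply/eqP; rewrite eq_le; apply/andP; split.
  by apply: ge_sup => //; exists b.
by apply: ub_le_sup => //; exists b.
Qed.

End Sectors.

(** * Arrangement of the tiles around the vertex *)

Section TilesAtBoundaryVertex.
Context {R : realType} {M : topologicalType} (S : surface R M).
Variables (K : Type) (s : K -> plane R -> M) (p : M).
Hypotheses (ht : regular_tiling S s) (hp : boundary S p) (hv : tiling_vertex s p).
Variables (om nu : plane R).
Hypotheses (om1 : om 0 1 = 0) (om0 : om 0 0 != 0) (nu1 : 0 < nu 0 1).
Local Notation c := (chart_at S p).
Local Notation dir := (direction om nu).

Let ac : atlas S c. Proof. exact: chart_at_atlas. Qed.
Let cp : chart_dom c p. Proof. exact: chart_at_dom. Qed.

(** A whole cone of directions around [d] is avoided, at all small distances: a chord has only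
    approximately the direction [om]. One radius [r] bounds both the aperture and the distance. *)
Definition avoids_ray (k : K) (d : plane R) (r : R) :=
  forall d' rho q, ball d r d' -> 0 < rho < r -> tile s k q -> chart_dom c q ->
    c q <> c p + rho *: d'.

Lemma tile_sector k : tile s k p -> exists a b, [/\ 0 <= a, a < b, b <= pi,
    max_angle om nu (tangent_cone S p (tile s k)) = b &
    (forall t, 0 <= t <= pi -> ~ (a <= t <= b) -> exists2 r, 0 < r & avoids_ray k (dir t) r) /\
    (forall t, a < t < b -> exists2 r, 0 < r & forall rho, 0 < rho < r ->
      exists q, [/\ tile_interior s k q, chart_dom c q & c q = c p + rho *: dir t])].
Proof.
move=> [u su Eu]; have [es _ _ _ hdepth] := ht.
(* A common point has the same depth in all tiles, so [p] is a corner of every tile through it. *)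
have du : depth u = 2%N.
  have [k' [u' [su' du' Eu']]] := hv.
  by rewrite -du'; apply: (hdepth k k') => //; rewrite Eu.
have [s' [es' s'0 tileE intE]] := vertex_at_origin (es k) su du.
rewrite Eu in s'0; rewrite -tileE -intE.
have cs0 : chart_dom c (s' 0) by rewrite s'0.
have [F [U [oU U0 CF HF uJ]]] := immersion_jac es' ac simplex0 cs0.
have J1 i : 0 <= jac F 0 i 1.
  apply: (corner_jac_ge0 es' cs0 oU U0 CF HF); rewrite s'0.
  exact: hp.
have [a [b [a0 ab bpi H]]] := sector_angles om1 om0 nu1 uJ J1.
have HF' : forall v, simplex v -> chart_dom (chart_at S (s' 0)) (s' v) -> U v ->
  chart_at S (s' 0) (s' v) = F v by rewrite s'0.
have TC v : tangent_cone S p (s' @` simplex) v <->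
    forall i, 0 <= (v *m invmx (jac F 0)) 0 i.
  rewrite -s'0; split.
    exact: (tangent_cone_sub es' oU U0 CF HF' uJ).
  exact: (tangent_cone_sup es' oU U0 CF HF' uJ).
exists a, b; split => //; [|split].
- by apply: (max_angle_sector om1 nu1 uJ J1 TC a0 ab bpi) => t /H [].
- move=> t tt nt; have [Ht _] := H t tt.
  have [i] : exists i, (dir t *m invmx (jac F 0)) 0 i < 0.
    apply: contrapT => nex; apply: nt; apply/Ht => i.
    by rewrite leNgt; apply/negP => h; apply: nex; exists i.
  move=> /(corner_avoids_rays es' cs0 oU U0 CF HF uJ) [r r0 Hr].
  exists r => // d' rho q dd' rr; rewrite -tileE => -[v sv <-] cv.
  by have := Hr d' rho v dd' rr sv cv; rewrite s'0.
- move=> t /[dup] tab /andP[at_ tb].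
  have tt : 0 <= t <= pi by apply/andP; split; lra.
  have [_ /(_ tab)] := H t tt.
  move=> /(corner_interior es' cs0 oU U0 CF HF uJ) [r r0 Hr].
  exists r => // rho /Hr [v [sv dv cv Ev]].
  by exists (s' v); split => //; [exists v|rewrite Ev s'0].
Qed.

Lemma tile_compact k : compact (tile s k).
Proof.
have [es _ _ _ _] := ht; have [cs _ _] := es k.
by apply: continuous_compact => //; exact: simplex_compact.
Qed.

(** By local finiteness only finitely many tiles come close to [p]; those that do not contain [p]
    are closed and can be kept away. *)
Lemma tiles_near : \forall q \near p, exists2 k, tile s k p & tile s k q.
Proof.
have [_ lf cover _ _] := ht.
have [V [nV /finite_set_leP[n]]] := lf p.
set A := [set k | _] => /card_leP[f].
(* The tiles meeting [V] are numbered through the injection [f], so that [filter_forall] applies to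
   a finite index type. *)
pose P (i : 'I_n) (q : M) := forall k (Ak : A k),
  \val (f (SigSub (mem_set Ak))) = i -> ~ tile s k p -> ~ tile s k q.
have H (i : 'I_n) : \forall q \near p, P i q.
  have [[k [Ak [Ek nk]]]|no] := pselect (exists k (Ak : A k),
     \val (f (SigSub (mem_set Ak))) = i /\ ~ tile s k p); last first.
    by apply: nearW => q k Ak Ek nk; exfalso; apply: no; exists k, Ak.
  have : open_nbhs p (~` tile s k).
    split=> //; apply: closed_openC; apply: compact_closed.
      exact: (surface_hausdorff S).
    exact: tile_compact.
  move=> /open_nbhs_nbhs; apply: filterS => q nq k' Ak' Ek' nk'.
  suff -> : k' = k by [].
  have : f (SigSub (mem_set Ak')) = f (SigSub (mem_set Ak)).
    by apply: val_inj; rewrite Ek' Ek.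
  by move=> /(inj (mem_set I) (mem_set I)) /(congr1 val).
have H' : \forall q \near p, forall i, P i q by exact: filter_forall.
apply: filterS2 H' nV => q Hq Vq.
have [k kq] := cover q.
have Ak : A k by exists q.
exists k => //; apply: contrapT => nk.
have lt : (\val (f (SigSub (mem_set Ak))) < n)%N.
  by have := set_mem (valP (f (SigSub (mem_set Ak)))).
exact: (Hq (Ordinal lt) k Ak).
Qed.

Lemma half_plane_points : exists2 r, 0 < r & forall z : plane R, `|z| < r -> 0 <= z 0 1 ->
  exists q k, [/\ chart_dom c q, c q = c p + z, tile s k p & tile s k q].
Proof.
have ip : chart_img c (c p) by exists p.
have [r /= r0 Hr] := (nbhs_ballP _ _).1
  (filterI (chart_img_near ip) (chart_inv_near cp tiles_near)).
exists r => // z zr z0.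
have [] := Hr (c p + z); first by rewrite -ball_normE/= opprD addNKr normrN.
have cp1 : c p 0 1 = 0 by exact: hp.
rewrite addmxE cp1 add0r => /(_ z0) iz /(_ iz) [k kp kq].
have [cq Eq] := chart_invK iz.
by exists (chart_inv c (c p + z)), k.
Qed.

Variables (n : nat) (D : 'I_n.+1 -> K).
Hypothesis hD : tile_enumeration S s p om nu D.

(** Translates the tiling into intervals of angles sorted by their right ends, which cover (0, pi)
    and have disjoint interiors; the next two lemmas only reason on such intervals. *)
Lemma enumerated_sectors : exists a b : 'I_n.+1 -> R,
  [/\ forall i, [/\ 0 <= a i, a i < b i & b i <= pi],
      forall i j : 'I_n.+1, (i < j)%N -> b i < b j,
      forall i t, 0 <= t <= pi -> ~ (a i <= t <= b i) ->
        exists2 r, 0 < r & avoids_ray (D i) (dir t) r,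
      (forall t, 0 < t < pi -> exists i, a i <= t <= b i) &
      forall i j t, i != j -> a i < t < b i -> a j < t < b j -> False].
Proof.
have [hDp hDlt] := hD.
have H i : exists ab : R * R, [/\ 0 <= ab.1, ab.1 < ab.2, ab.2 <= pi,
    max_angle om nu (tangent_cone S p (tile s (D i))) = ab.2 &
    (forall t, 0 <= t <= pi -> ~ (ab.1 <= t <= ab.2) ->
      exists2 r, 0 < r & avoids_ray (D i) (dir t) r) /\
    (forall t, ab.1 < t < ab.2 -> exists2 r, 0 < r & forall rho, 0 < rho < r ->
      exists q, [/\ tile_interior s (D i) q, chart_dom c q & c q = c p + rho *: dir t])].
  have tp : tile s (D i) p by apply/hDp; exists i.
  by have [a [b h]] := tile_sector tp; exists (a, b).
have [ab Hab] := choice H.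
have mono (i j : 'I_n.+1) : (i < j)%N -> (ab i).2 < (ab j).2.
  move=> /hDlt; have [_ _ _ -> _] := Hab i; by have [_ _ _ -> _] := Hab j.
exists (fun i => (ab i).1), (fun i => (ab i).2); split => //.
- by move=> i; have [] := Hab i.
- by move=> i t tt nt; have [_ _ _ _ [h _]] := Hab i; exact: h.
(* If [t] were in no sector, every tile at [p] would avoid the points close to [p] in the direction
   [dir t], but one of these tiles contains them. *)
- move=> t /andP[t0 tpi]; apply: contrapT => no.
  have tt : 0 <= t <= pi by rewrite !ltW.
  have [r0 r00 Hr0] := half_plane_points.
  have Av i : exists2 r, 0 < r & avoids_ray (D i) (dir t) r.
    have [_ _ _ _ [h _]] := Hab i; apply: h => // ti.
    by apply: no; exists i.
  have N i : \forall r \near (0 : R)^'+, avoids_ray (D i) (dir t) r.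
    have [r rp Hr] := Av i; near=> r'.
    have r'r : r' < r by near: r'; exact: nbhs_right_lt.
    move=> d' rho q dd' /andP[rho0 rhor]; apply: Hr.
      exact: le_ball (ltW r'r) _ dd'.
    by rewrite rho0 (lt_trans rhor).
  have X0 : 0 < `|dir t| + 1 by rewrite ltr_wpDl.
  have [r [Hr rp rr0]] : exists r, [/\ (forall i, avoids_ray (D i) (dir t) r), 0 < r &
      r < r0 / (`|dir t| + 1)].
    apply: (@filter_ex _ (0 : R)^'+); near=> r; split.
    - by near: r; exact: filter_forall.
    - by near: r; exact: nbhs_right_gt.
    - by near: r; apply: nbhs_right_lt; exact: divr_gt0.
  have [||q [k [cq Eq kp kq]]] := Hr0 ((r / 2) *: dir t).
  - rewrite normrZ gtr0_norm ?divr_gt0//.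
    move: rr0; rewrite ltr_pdivlMr// mulrDr mulr1.
    have : 0 <= r * `|dir t| by rewrite mulr_ge0// ltW.
    lra.
  - rewrite scalemxE /direction addmxE !scalemxE om1 mulr0 add0r !mulr_ge0 ?divr_ge0 ?(ltW rp) ?(ltW nu1)//.
    by apply: sin_ge0_pi.
  have [i Ei] := (hDp k).1 kp; subst k.
  apply: (Hr i (dir t) (r / 2) q) => //; first exact: ballxx.
  by rewrite divr_gt0//= ltr_pdivrMr// ltr_pMr// ltr1n.
(* A common direction would give the two tiles a common interior point, at the same small distance
   [r]. *)
- move=> i j t ij ti tj.
  have [_ _ _ _ [_ /(_ t ti) [ri ri0 Hi]]] := Hab i.
  have [_ _ _ _ [_ /(_ t tj) [rj rj0 Hj]]] := Hab j.
  pose r := Num.min ri rj / 2.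
  have m0 : 0 < Num.min ri rj by rewrite lt_min ri0.
  have r0 : 0 < r by rewrite divr_gt0.
  have : r < Num.min ri rj by rewrite ltr_pdivrMr// ltr_pMr// ltr1n.
  rewrite lt_min => /andP[rri rrj].
  have [|q [iq cq Eq]] := Hi r; first by rewrite r0.
  have [|q' [iq' cq' Eq']] := Hj r; first by rewrite r0.
  have qq' : q = q' by rewrite -(chart_mapK cq) -(chart_mapK cq') Eq Eq'.
  have [_ _ _ disj _] := ht.
  have nij : D i <> D j.
    move=> Eij; have [ij'|ij'|ij'] := ltngtP i j.
    - by have := mono _ _ ij'; have [_ _ _ <- _] := Hab i; have [_ _ _ <- _] := Hab j; rewrite Eij ltxx.
    - by have := mono _ _ ij'; have [_ _ _ <- _] := Hab i; have [_ _ _ <- _] := Hab j; rewrite Eij ltxx.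
    - by move: ij; rewrite (val_inj ij') eqxx.
  have : (tile_interior s (D i) `&` tile_interior s (D j)) q by split => //; rewrite qq'.
  by rewrite disj.
Unshelve. all: by end_near. Qed.

(** If the first sector began after 0, the angle [a ord0 / 2] would lie in a sector with a larger
    right end, which would overlap the first one. So it begins at 0, and by disjointness the others
    begin after its end. *)
Lemma others_avoid_first (j : 'I_n.+1) : j != ord0 ->
  exists2 r, 0 < r & avoids_ray (D j) om r.
Proof.
move=> j0; have [a [b [Hab mono av cov disj]]] := enumerated_sectors.
have E0 : om = dir 0 by rewrite /direction cos0 sin0 scale1r scale0r addr0.
have pi0 := pi_gt0 R.
have [a0 ab0 b0pi] := Hab ord0; have [aj abj bjpi] := Hab j.
have bj : b ord0 < b j by apply: mono; rewrite lt0n.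
have a00 : a ord0 = 0.
  apply/eqP; rewrite eq_le a0 andbT leNgt; apply/negP => a0p.
  have [|i /andP[ai bi]] := cov (a ord0 / 2); first by apply/andP; split; lra.
  have i0 : i != ord0 by apply/eqP => Ei; move: ai bi; rewrite Ei; lra.
  have bi0 : b ord0 < b i by apply: mono; rewrite lt0n.
  apply: (disj _ _ ((a ord0 + b ord0) / 2) i0); apply/andP; split; lra.
have E : b ord0 <= a j.
  rewrite leNgt; apply/negP => ajb.
  have m : Num.max (a j) 0 < b ord0 by rewrite gt_max ajb; lra.
  have [m1 m2] : a j <= Num.max (a j) 0 /\ 0 <= Num.max (a j) 0.
    by split; rewrite le_max lexx ?orbT.
  apply: (disj _ _ ((Num.max (a j) 0 + b ord0) / 2) j0); rewrite ?a00; apply/andP; split; lra.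
rewrite E0; apply: av; first by apply/andP; split; lra.
by move=> /andP[+ _]; lra.
Qed.

(** The sorting is by right ends, which increase strictly: no sector but the last can reach [pi]. *)
Lemma others_avoid_last (j : 'I_n.+1) : j != ord_max ->
  exists2 r, 0 < r & avoids_ray (D j) (- om) r.
Proof.
move=> j0; have [a [b [Hab mono av cov disj]]] := enumerated_sectors.
have E0 : - om = dir pi by rewrite /direction cospi sinpi scaleN1r scale0r addr0.
have pi0 := pi_gt0 R.
have [a0 ab0 b0pi] := Hab ord_max; have [aj abj bjpi] := Hab j.
have lt_max (i : 'I_n.+1) : i != ord_max -> b i < b ord_max.
  by move=> im; apply: mono; rewrite ltn_neqAle im/= -ltnS.
have bj := lt_max j j0.
have E : b j <= a ord_max.
  rewrite leNgt; apply/negP => ajb.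
  have m : Num.max (a j) (a ord_max) < b j by rewrite gt_max ajb abj.
  have [m1 m2] : a j <= Num.max (a j) (a ord_max) /\ a ord_max <= Num.max (a j) (a ord_max).
    by split; rewrite le_max lexx ?orbT.
  by apply: (disj _ _ ((Num.max (a j) (a ord_max) + b j) / 2) j0); apply/andP; split; lra.
rewrite E0; apply: av; first by apply/andP; split; lra.
by move=> /andP[_]; lra.
Qed.

Lemma wedge_in_tile (i : 'I_n.+1) (d : plane R) :
  (forall j, j != i -> exists2 r, 0 < r & avoids_ray (D j) d r) ->
  exists2 r, 0 < r & forall d' rho, ball d r d' -> 0 < rho < r -> 0 < d' 0 1 ->
    exists q, [/\ tile_interior s (D i) q, chart_dom c q & c q = c p + rho *: d'].
Proof.
move=> Av; have [hDp _] := hD.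
have [r0 r00 Hr0] := half_plane_points.
have N j : \forall r \near (0 : R)^'+, j != i -> avoids_ray (D j) d r.
  have [->|ji] := eqVneq j i; first by apply: nearW.
  have [r rp Hr] := Av j ji; near=> r' => _.
  have r'r : r' < r by near: r'; exact: nbhs_right_lt.
  move=> d' rho q dd' /andP[rho0 rhor]; apply: Hr.
    exact: le_ball (ltW r'r) _ dd'.
  by rewrite rho0 (lt_trans rhor).
have X0 : 0 < `|d| + 1 by rewrite ltr_wpDl.
have [r [Hr rp r1 rr0]] : exists r, [/\ (forall j, j != i -> avoids_ray (D j) d r), 0 < r,
    r < 1 & r < r0 / (`|d| + 1)].
  apply: (@filter_ex _ (0 : R)^'+); near=> r; split.
  - by near: r; exact: filter_forall.
  - by near: r; exact: nbhs_right_gt.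
  - by near: r; exact: nbhs_right_lt.
  - by near: r; apply: nbhs_right_lt; exact: divr_gt0.
have inD d' rho : ball d r d' -> 0 < rho < r -> 0 <= d' 0 1 ->
    exists q, [/\ tile s (D i) q, chart_dom c q & c q = c p + rho *: d'].
  move=> dd' /andP[rho0 rhor] d'0.
  have d'n : `|d'| < `|d| + 1.
    have -> : d' = d - (d - d') by rewrite subKr.
    rewrite (le_lt_trans (ler_normB _ _))// ltrD2l.
    by move: dd'; rewrite -ball_normE/= => /lt_trans; exact.
  have [||q [k [cq Eq kp kq]]] := Hr0 (rho *: d').
  - rewrite normrZ gtr0_norm//.
    have : rho * `|d'| < r0 / (`|d| + 1) * (`|d| + 1).
      exact: ltr_pM (ltW rho0) (normr_ge0 _) (lt_trans rhor rr0) d'n.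
    by rewrite divfK// gt_eqF.
  - by rewrite scalemxE mulr_ge0// ltW.
  have [j Ej] := (hDp k).1 kp; subst k.
  have [Eji|ji] := eqVneq j i; first by subst j; exists q.
  exfalso; apply: (Hr j ji d' rho q) => //.
  by rewrite rho0.
exists r => // d' rho dd' rr d'0.
have [q [[u su Eu] cq Eq]] := inD d' rho dd' rr (ltW d'0).
have /andP[rho0 rhor] := rr.
exists q; split => //; exists u => //; split => //.
have [es _ _ _ _] := ht.
have cu : chart_dom c (s (D i) u) by rewrite Eu.
(* [dz] recovers the direction from a point at scale [rho]. Directions near [d'] remain in the cone
   and satisfy [0 < d' 0 1], so a full neighbourhood of [c q] consists of points of the tile. *)
pose dz (z : plane R) := rho^-1 *: (z - c p).
have dzq : dz (c q) = d'.
  by rewrite /dz Eq [c p + _]addrC addrK scalerA mulVf ?gt_eqF// scale1r.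
have cdz : {for c q, continuous dz}.
  have C1 : (z - c p) @[z --> c q] --> c q - c p.
    exact: (@cvgB _ _ _ (nbhs (c q)) _ id (cst (c p)) (c q) (c p) cvg_id (cvg_cst (c p))).
  apply: (@cvg_comp _ _ _ (fun z => z - c p) (fun w => rho^-1 *: w) (nbhs (c q))
    (nbhs (c q - c p))); first exact: C1.
  exact: scaler_continuous.
have nW : \forall z \near c q, ball d r (dz z) /\ 0 < dz z 0 1.
  have nb : \forall w \near dz (c q), ball d r w /\ 0 < (w : plane R) 0 1.
    rewrite dzq; apply: filterI.
      by apply: open_nbhs_nbhs; split => //; exact: ball_open.
    have := @coord_continuous R 1 2 0 1 d'.
    move=> /(_ [set x | 0 < x]); apply; apply: open_nbhs_nbhs; split => //; exact: open_gt.
  exact: cdz _ nb.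
rewrite -Eu in nW.
apply: (open_in_tile_interior (es (D i)) ac su cu nW) => z [dz1 dz2].
have [q' [[v sv Ev] cq' Eq']] := inD _ _ dz1 rr (ltW dz2).
exists v; split => //; first by rewrite Ev.
rewrite Ev Eq' /dz scalerA mulfV ?gt_eqF// scale1r addrC subrK//.
Unshelve. all: by end_near. Qed.

End TilesAtBoundaryVertex.

(** * Short geodesics *)

Section MetricCoefficients.
Context {R : realType} {M : topologicalType} (S : surface R M).
Variable g : riemannian_metric S.
Local Notation e_ i := (delta_mx 0 i : plane R).
Variable c : chart R M.
Hypothesis ac : atlas S c.
Local Notation img := (chart_img c).

Lemma metric_continuous u i j : img u ->
  metric_mx g c v i j @[v --> within img (nbhs u)] --> metric_mx g c u i j.
Proof.
move=> iu; have [F [U [oU Uu CF HF]]] := metric_smooth g ac iu.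
have nU : nbhs u U by exact: open_nbhs_nbhs.
have C : {for u, continuous (fun v => F v i j)}.
  apply: (@continuous_comp _ _ _ F (fun A : 'M[R]_2 => A i j)).
    exact: Ck_continuous (CF 0%N) Uu.
  exact: coord_continuous.
have E : metric_mx g c u i j = F u i j by rewrite HF.
rewrite E; apply: (within_near_eq_cvg _ C).
by apply: filterS nU => v Uv iv; rewrite HF.
Qed.

Lemma dmetric_continuous u i j l : img u ->
  dmetric g c v i j l @[v --> within img (nbhs u)] --> dmetric g c u i j l.
Proof.
move=> iu; have [F [U [oU Uu CF HF]]] := metric_smooth g ac iu.
have nU : nbhs u U by exact: open_nbhs_nbhs.
have E v : U v -> img v -> dmetric g c v i j l = ('D_(e_ i) F v : 'M[R]_2) j l.
  move=> Uv iv; rewrite /dmetric (@dderive_withinE _ _ _ _ _ F)//.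
  - apply: half_plane_clusters_at; first exact: chart_img_ge0 iv.
    exact: chart_img_near.
  - exact: Ck_derivable (CF 1%N) Uv.
  - exact: HF.
  - have : nbhs v U by exact: open_nbhs_nbhs.
    by apply: filterS => w Uw iw; exact: HF.
have C : {for u, continuous (fun v => ('D_(e_ i) F v : 'M[R]_2) j l)}.
  apply: (@continuous_comp _ _ _ ('D_(e_ i) F) (fun A : 'M[R]_2 => A j l)).
    exact: Ck_continuous (Ck_derive (e_ i) (CF 1%N)) Uu.
  exact: coord_continuous.
rewrite E//; apply: (within_near_eq_cvg _ C).
by apply: filterS nU => v Uv iv; rewrite E.
Qed.

(** The adjugate, written out so that continuity of the inverse matrix reduces to that of the
    entries. *)
Definition adj2 (A : 'M[R]_2) : 'M[R]_2 :=
  \matrix_(i, j) nth 0 (nth [::] [:: [:: A 1 1; - A 0 1]; [:: - A 1 0; A 0 0]] i) j.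

Lemma invmx2 (A : 'M[R]_2) : A 0 0 * A 1 1 - A 0 1 * A 1 0 != 0 ->
  invmx A = (A 0 0 * A 1 1 - A 0 1 * A 1 0)^-1 *: adj2 A.
Proof.
move=> d0; set d := _ - _ in d0 *.
have E : A *m (d^-1 *: adj2 A) = 1%:M.
  have mulE (B C : 'M[R]_2) i j : (B *m C) i j = B i 0 * C 0 j + B i 1 * C 1 j.
    by rewrite mxE big_ord_recl big_ord1; congr (_ + B i _ * C _ j); exact/val_inj.
  rewrite -scalemxAr; apply/matrixP => i j.
  rewrite scalemxE mulE [adj2 A 0 j]mxE [adj2 A 1 j]mxE [RHS]mxE.
  by move: i j d0; apply: ord2P; apply: ord2P => d0 /=; rewrite ?mulr1n ?mulr0n /d; field.
have [uA _] := mulmx1_unit E.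
by rewrite -[LHS]mulmx1 -E mulKmx.
Qed.

Lemma metric_det_gt0 u : img u ->
  0 < metric_mx g c u 0 0 * metric_mx g c u 1 1 - metric_mx g c u 0 1 * metric_mx g c u 1 0.
Proof.
move=> iu; set A := metric_mx g c u.
have sym : A 0 1 = A 1 0 
  by have /matrixP /(_ 1 0) := Defs.metric_sym g ac iu; rewrite mxE.
have quad (v : plane R) : (v *m A *m v^T) 0 0 =
   (v 0 0 * A 0 0 + v 0 1 * A 1 0) * v 0 0 + (v 0 0 * A 0 1 + v 0 1 * A 1 1) * v 0 1.
  rewrite mxE big_ord_recl big_ord1 !(mulmx_plane v A) ![v^T _ _]mxE.
  by rewrite (_ : lift ord0 ord0 = 1 :> 'I_2)//; exact/val_inj.
have e0n : e_ 0 != 0.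
  apply/eqP => /(congr1 (fun w : plane R => w 0 0)); rewrite !mxE eqxx/=.
  by move=> /eqP; rewrite oner_eq0.
have A00 : 0 < A 0 0.
  have := metric_posdef g ac iu e0n.
  by rewrite -/A quad !mxE/=; lra.
(* On this vector the quadratic form is [A 0 0] times the determinant. *)
pose v : plane R := (- A 1 0) *: e_ 0 + (A 0 0) *: e_ 1.
have v0 : v 0 0 = - A 1 0 by rewrite /v addmxE !scalemxE !mxE/=; ring.
have v1 : v 0 1 = A 0 0 by rewrite /v addmxE !scalemxE !mxE/=; ring.
have vn : v != 0.
  apply/eqP => /(congr1 (fun w : plane R => w 0 1)); rewrite v1 mxE => A0.
  by rewrite A0 ltxx in A00.
have := metric_posdef g ac iu vn.
rewrite -/A quad v0 v1 sym => H.
have : 0 < A 0 0 * (A 0 0 * A 1 1 - A 1 0 * A 1 0) by move: H; lra.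
by rewrite pmulr_rgt0.
Qed.

Lemma invmetric_continuous u i j : img u ->
  invmx (metric_mx g c v) i j @[v --> within img (nbhs u)] --> invmx (metric_mx g c u) i j.
Proof.
move=> iu; pose A := metric_mx g c.
have FF : Filter (within img (nbhs u)) by exact: within_filter.
have cA i' j' : A v i' j' @[v --> within img (nbhs u)] --> A u i' j'.
  exact: metric_continuous.
pose d v := A v 0 0 * A v 1 1 - A v 0 1 * A v 1 0.
have du := metric_det_gt0 iu.
have cd : d v @[v --> within img (nbhs u)] --> d u.
  by apply: cvgB; apply: cvgM; exact: cA.
have cadj : adj2 (A v) i j @[v --> within img (nbhs u)] --> adj2 (A u) i j.
  have E v : adj2 (A v) i j =
     nth 0 (nth [::] [:: [:: A v 1 1; - A v 0 1]; [:: - A v 1 0; A v 0 0]] i) j.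
    by rewrite mxE.
  rewrite E; under eq_fun do rewrite E.
  move: i j {E}; apply: ord2P; apply: ord2P => /=; (exact: cA) || (apply: cvgN; exact: cA).
have -> : invmx (metric_mx g c u) i j = (d u)^-1 * adj2 (A u) i j.
  by rewrite invmx2 ?gt_eqF// scalemxE.
have C : (d v)^-1 * adj2 (A v) i j @[v --> within img (nbhs u)] -->
    (d u)^-1 * adj2 (A u) i j.
  by apply: cvgM => //; apply: cvgV => //; rewrite gt_eqF.
apply: cvg_trans C; apply: near_eq_cvg; rewrite near_withinE; apply: nearW => v iv.
by rewrite invmx2 ?gt_eqF// ?scalemxE//; exact: metric_det_gt0.
Qed.

Lemma christoffel_continuous u k i j : img u ->
  christoffel g c v k i j @[v --> within img (nbhs u)] --> christoffel g c u k i j.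
Proof.
move=> iu; have FF : Filter (within img (nbhs u)) by exact: within_filter.
have E v : christoffel g c v k i j = 2^-1 *
   (invmx (metric_mx g c v) k 0 * (dmetric g c v i j 0 + dmetric g c v j i 0 - dmetric g c v 0 i j) +
    invmx (metric_mx g c v) k 1 * (dmetric g c v i j 1 + dmetric g c v j i 1 - dmetric g c v 1 i j)).
  by rewrite /christoffel big_ord_recl big_ord1 (_ : lift ord0 ord0 = 1 :> 'I_2)//; exact/val_inj.
rewrite E; under eq_fun do rewrite E.
apply: cvgM; first exact: cvg_cst.
by apply: cvgD; apply: cvgM; (exact: invmetric_continuous) ||
  (apply: cvgB; [apply: cvgD|]; exact: dmetric_continuous).
Qed.

Lemma connectionE u (v w : plane R) k : connection g c u v w 0 k =
  (christoffel g c u k 0 0 * v 0 0 * w 0 0 + christoffel g c u k 0 1 * v 0 0 * w 0 1) +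
  (christoffel g c u k 1 0 * v 0 1 * w 0 0 + christoffel g c u k 1 1 * v 0 1 * w 0 1).
Proof.
rewrite mxE !big_ord_recl !big_ord0 !addr0.
by rewrite (_ : lift ord0 ord0 = 1 :> 'I_2)//; exact/val_inj.
Qed.

Lemma quadratic_formE u (w : plane R) : (w *m metric_mx g c u *m w^T) 0 0 =
  (w 0 0 * metric_mx g c u 0 0 + w 0 1 * metric_mx g c u 1 0) * w 0 0 +
  (w 0 0 * metric_mx g c u 0 1 + w 0 1 * metric_mx g c u 1 1) * w 0 1.
Proof.
rewrite mxE big_ord_recl big_ord1 !(mulmx_plane w) ![w^T _ _]mxE.
by rewrite (_ : lift ord0 ord0 = 1 :> 'I_2)//; exact/val_inj.
Qed.

(** Positions are restricted to the image of the chart, where the metric is defined; velocities are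
    free. Hence the asymmetric product filter. *)
Lemma phase_near (f : plane R -> plane R -> R) u w :
  f q.1 q.2 @[q --> filter_prod (within img (nbhs u)) (nbhs w)] --> f u w ->
  forall eta, 0 < eta -> exists2 r, 0 < r & forall u' w', img u' ->
    `|u' - u| < r -> `|w' - w| < r -> `|f u' w' - f u w| <= eta.
Proof.
move=> C eta eta0.
have FF : Filter (within img (nbhs u)) by exact: within_filter.
have H := (@cvgrPdist_le _ _ _ (filter_prod (within img (nbhs u)) (nbhs w)) _ _ _).1 C eta eta0.
have [[A B] /= [nA nB] HAB] := H _.
have nA' : \forall v \near u, img v -> A v := nA.
have [r1 /= r10 H1] := (nbhs_ballP _ _).1 nA'.
have [r2 /= r20 H2] := (nbhs_ballP _ _).1 nB.
exists (Num.min r1 r2); first by rewrite lt_min r10.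
move=> u' w' iu'; rewrite !lt_min => /andP[ur1 _] /andP[_ wr2].
rewrite distrC; apply: (HAB (u', w')); split => /=.
  by apply: H1 => //; rewrite -ball_normE/= distrC.
by apply: H2 => //; rewrite -ball_normE/= distrC.
Qed.

Lemma connection_near u w k : img u -> forall eta, 0 < eta ->
  exists2 r, 0 < r & forall u' w', img u' -> `|u' - u| < r -> `|w' - w| < r ->
    `|connection g c u' w' w' 0 k - connection g c u w w 0 k| <= eta.
Proof.
move=> iu; apply: (@phase_near (fun u w => connection g c u w w 0 k)).
have FF : Filter (within img (nbhs u)) by exact: within_filter.
have cC i j : christoffel g c q.1 k i j
    @[q --> filter_prod (within img (nbhs u)) (nbhs w)] --> christoffel g c u k i j.
  apply: (@cvg_comp _ _ _ fst (fun v => christoffel g c v k i j) _ (within img (nbhs u))).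
    exact: cvg_fst.
  exact: christoffel_continuous.
have cw i : (q.2 : plane R) 0 i
    @[q --> filter_prod (within img (nbhs u)) (nbhs w)] --> w 0 i.
  apply: (@cvg_comp _ _ _ snd (fun v : plane R => v 0 i) _ (nbhs w)).
    exact: cvg_snd.
  exact: coord_continuous.
rewrite connectionE; under eq_fun do rewrite connectionE.
by apply: cvgD; apply: cvgD; do 2![apply: cvgM => //].
Qed.

Lemma speed_near u (w : plane R) : img u -> forall eta, 0 < eta ->
  exists2 r, 0 < r & forall u' w', img u' -> `|u' - u| < r -> `|w' - w| < r ->
    `|Num.sqrt ((w' *m metric_mx g c u' *m w'^T) 0 0) -
      Num.sqrt ((w *m metric_mx g c u *m w^T) 0 0)| <= eta.
Proof.
move=> iu; apply: (@phase_near (fun u w => Num.sqrt ((w *m metric_mx g c u *m w^T) 0 0))).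
have FF : Filter (within img (nbhs u)) by exact: within_filter.
have cC i j : metric_mx g c q.1 i j
    @[q --> filter_prod (within img (nbhs u)) (nbhs w)] --> metric_mx g c u i j.
  apply: (@cvg_comp _ _ _ fst (fun v => metric_mx g c v i j) _ (within img (nbhs u))).
    exact: cvg_fst.
  exact: metric_continuous.
have cw i : (q.2 : plane R) 0 i
    @[q --> filter_prod (within img (nbhs u)) (nbhs w)] --> w 0 i.
  apply: (@cvg_comp _ _ _ snd (fun v : plane R => v 0 i) _ (nbhs w)).
    exact: cvg_snd.
  exact: coord_continuous.
have Q : (q.2 *m metric_mx g c q.1 *m q.2^T) 0 0
    @[q --> filter_prod (within img (nbhs u)) (nbhs w)] --> (w *m metric_mx g c u *m w^T) 0 0.
  rewrite quadratic_formE; under eq_fun do rewrite quadratic_formE.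
  by apply: cvgD; apply: cvgM => //; apply: cvgD; apply: cvgM.
apply: (@cvg_comp _ _ _ (fun q : plane R * plane R => (q.2 *m metric_mx g c q.1 *m q.2^T) 0 0)
   Num.sqrt _ _ _ Q); exact: sqrt_continuous.
Qed.

End MetricCoefficients.

(** * Curvature of the boundary in coordinates *)

Section BoundaryCurvature.
Context {R : realType} {M : topologicalType} (S : surface R M).
Variables (g : riemannian_metric S) (p : M) (nu : plane R).
Hypotheses (hp : boundary S p) (hnu : inward_unit_normal g p nu).
Local Notation e_ i := (delta_mx 0 i : plane R).
Local Notation c := (chart_at S p).

(** Since [nu] is orthogonal to [e_ 0], the product of [x] with [nu] is proportional to [x 0 1], and
    [nu] being unit fixes the factor. Thus [kappa] is visible in the second component of the
    geodesic equation. *)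
Lemma second_fundamental_formE v w :
  second_fundamental_form g p nu v w = connection g c (c p) v w 0 1 / nu 0 1.
Proof.
have [n1 n0 npos] := hnu.
have nu0 : nu 0 1 != 0 by rewrite gt_eqF.
have split_inner x : inner g p x nu = x 0 1 * inner g p (e_ 1) nu.
  have tx : tangent_to_boundary (x 0 0 *: e_ 0).
    by rewrite /tangent_to_boundary scalemxE !mxE/= mulr0.
  have := n0 _ tx; rewrite /inner {2}(plane_eq x) !mulmxDl -!scalemxAl.
  by rewrite addmxE !scalemxE => ->; rewrite add0r.
have E : inner g p (e_ 1) nu = (nu 0 1)^-1.
  by apply: (mulfI nu0); rewrite mulfV// -split_inner.
by rewrite /second_fundamental_form split_inner E.
Qed.

Lemma second_fundamental_formN v :
  second_fundamental_form g p nu (- v) (- v) = second_fundamental_form g p nu v v.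
Proof.
by rewrite !second_fundamental_formE !connectionE !oppmxE; congr (_ / _); ring.
Qed.

Lemma innerN v : inner g p (- v) (- v) = inner g p v v.
Proof. by rewrite /inner linearN/= !mulNmx mulmxN opprK. Qed.

End BoundaryCurvature.

(** * Continuous induction and mean value estimates *)

Section RealLemmas.
Context {R : realType}.

(** The infimum of the bad times is good by the first hypothesis, which at [t = 0] is the base case;
    the second one then pushes the bad times away from it. *)
Lemma real_induction (P : R -> Prop) (b : R) :
  (forall t, 0 <= t <= b -> (forall s, 0 <= s < t -> P s) -> P t) ->
  (forall t, 0 <= t < b -> P t ->
    exists2 d, 0 < d & forall s, t < s < t + d -> s <= b -> P s) ->
  forall t, 0 <= t <= b -> P t.
Proof.
move=> Hlim Hopen t /andP[t0 tb]; apply: contrapT => nPt.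
pose B := [set s : R | 0 <= s <= b /\ ~ P s].
have Bt : B t by split; rewrite ?t0.
have lbB : lbound B 0 by move=> s [/andP[]].
have hB : has_inf B by split; [exists t|exists 0].
have i0 : 0 <= inf B by apply: lb_le_inf => //; exists t.
have it : inf B <= t by apply: ge_inf => //; exists 0.
have Pi : P (inf B).
  apply: Hlim; first by rewrite i0 (le_trans it).
  move=> s /andP[s0 si]; apply: contrapT => nPs.
  have : inf B <= s.
    apply: ge_inf; first by exists 0.
    by split => //; rewrite s0 (le_trans (ltW si))// (le_trans it).
  by rewrite leNgt si.
have it' : inf B < t.
  by rewrite lt_neqAle it andbT; apply/eqP => E; apply: nPt; rewrite -E.
have [d d0 Hd] := Hopen (inf B) (introT andP (conj i0 (lt_le_trans it' tb))) Pi.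
have : inf B + d <= inf B.
  apply: lb_le_inf; first by exists t.
  move=> s [/andP[s0 sb] nPs]; rewrite leNgt; apply/negP => sd.
  have is_ : inf B <= s by apply: ge_inf; [exists 0|split; rewrite ?s0].
  apply: nPs; have [->//|ns] := eqVneq s (inf B).
  by apply: Hd => //; rewrite sd andbT lt_neqAle eq_sym ns.
by rewrite gerDl leNgt d0.
Qed.

Lemma is_derive_coord (f : R -> plane R) (t : R) (df : plane R) j :
  is_derive t (1 : R) f df -> is_derive t (1 : R) (fun s => f s 0 j) (df 0 j).
Proof.
move=> [d E]; split; first exact: ((derivable_mxP _ _ _).1 d).
by rewrite -E derive_mx// mxE.
Qed.

Lemma within_coord (f : R -> plane R) (A : set R) (t : R) j :
  f s @[s --> within A (nbhs t)] --> f t -> f s 0 j @[s --> within A (nbhs t)] --> f t 0 j.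
Proof.
by move=> C; apply: (@cvg_comp _ _ _ f (fun v : plane R => v 0 j) _ _ _ C);
  exact: coord_continuous.
Qed.

Lemma mean_value_bound (f df : R -> plane R) (b C : R) : 0 <= b ->
  (forall t, 0 <= t <= b -> f s @[s --> within [set` `[0, b]] (nbhs t)] --> f t) ->
  (forall t, 0 < t < b -> is_derive t (1 : R) f (df t)) ->
  (forall t, 0 < t < b -> `|df t| <= C) -> 0 <= C -> `|f b - f 0| <= C * b.
Proof.
move=> b0 cf Df Cf C0.
have [b00|bp] := eqVneq b 0; first by rewrite b00 subrr normr0 mulr0.
have b0' : 0 < b by rewrite lt_neqAle eq_sym bp.
apply: mx_norm_leP => [|i j]; first exact: mulr_ge0.
rewrite (ord1 i) addmxE oppmxE.
have D' (x : R) : x \in `]0, b[%R -> is_derive x (1 : R) (fun s => f s 0 j) (df x 0 j).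
  by rewrite in_itv/= => xb; apply: is_derive_coord; exact: Df.
have cf' : {within `[0, b], continuous (fun s => f s 0 j)}.
  apply/subspace_continuousP => t; rewrite /= in_itv/= => tb.
  by apply: within_coord; exact: cf.
have [x xb ->] := MVT b0' D' cf'.
rewrite subr0 normrM (gtr0_norm b0') ler_wpM2r ?(ltW b0')//.
by rewrite (le_trans (mx_coord_le _ _ _))// Cf//; move: xb; rewrite in_itv.
Qed.

(** The mean value theorem is applied to [w - A t], then to [y - w 0 t - A t^2 / 2]. The bound is
    one-sided; a lower bound follows by changing signs. *)
Lemma second_order_bound (y w a : R -> R) (b A : R) : 0 <= b ->
  {within `[0, b], continuous y} -> {within `[0, b], continuous w} ->
  (forall t, 0 < t < b -> is_derive t (1 : R) y (w t)) ->
  (forall t, 0 < t < b -> is_derive t (1 : R) w (a t)) ->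
  (forall t, 0 < t < b -> a t <= A) -> y b <= y 0 + w 0 * b + A * b ^+ 2 / 2.
Proof.
move=> b0 cy cw Dy Dw Aa.
have dlin (k t : R) : is_derive t (1 : R) (fun t : R => k * t) k.
  have : is_derive t (1 : R) (k \*: @id R) (k *: (1 : R)) by exact: is_deriveZ.
  by rewrite [_ *: _]mulr1.
have dsqr (k t : R) : is_derive t (1 : R) (fun t : R => k * t ^+ 2) (k * (2 * t)).
  have H : is_derive t (1 : R) ((@id R) ^+ 2) (2 * t).
    have := @is_deriveX _ _ (@id R) 2 t 1 1 (is_derive_id t 1).
    by rewrite /= expr1 [_ *: _]mulr1.
  exact: (@is_deriveZ _ _ _ ((@id R) ^+ 2) k t 1 _ H).
have sub t : 0 <= t <= b -> [set` `[0, t]] `<=` [set` `[0, b]].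
  move=> /andP[t0 tb] s; rewrite /= !in_itv/= => /andP[-> st].
  exact: le_trans tb.
have cf (f : R -> R) : (forall t, {for t, continuous f}) -> forall t, {within [set` `[0, t]], continuous f}.
  by move=> C t; apply: continuous_subspaceT.
have cl (k : R) : forall t, {for t, continuous (fun t : R => k * t)}.
  by move=> t; apply/differentiable_continuous/derivable1_diffP; case: (dlin k t).
have cs (k : R) : forall t, {for t, continuous (fun t : R => k * t ^+ 2)}.
  by move=> t; apply/differentiable_continuous/derivable1_diffP; case: (dsqr k t).
have Hw t : 0 <= t <= b -> w t - A * t <= w 0.
  move=> /[dup] tb /andP[t0 tb'].
  have [t00|tp] := eqVneq t 0; first by rewrite t00 mulr0 subr0.
  have tpos : 0 < t by rewrite lt_neqAle eq_sym tp.
  have D (x : R) : x \in `]0, t[%R -> is_derive x (1 : R) (w - (fun t => A * t)) (a x - A).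
    rewrite in_itv/= => /andP[x0 xt]; apply: is_deriveB.
    by apply: Dw; rewrite x0 (lt_le_trans xt).
  have C : {within `[0, t], continuous (w - (fun t => A * t))}.
    apply: (@within_continuousB _ _ _ _ w (fun t => A * t)); last exact: cf.
    exact: (continuous_subspaceW (sub t tb) cw).
  have [x xt] := MVT tpos D C.
  rewrite in_itv/= in xt; case/andP: xt => x0 xt.
  rewrite /= !fctE mulr0 !subr0 => E.
  have : (a x - A) * t <= 0.
    by rewrite mulr_le0_ge0 ?subr_le0 ?Aa ?x0 ?(lt_le_trans xt)// ltW.
  by rewrite -E; lra.
have [b00|bp] := eqVneq b 0; first by rewrite b00 expr0n/= !mulr0 mul0r !addr0.
have bpos : 0 < b by rewrite lt_neqAle eq_sym bp.
have D (x : R) : x \in `]0, b[%R ->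
    is_derive x (1 : R) (y - (fun t => w 0 * t) - (fun t => (A / 2) * t ^+ 2))
      (w x - w 0 - A / 2 * (2 * x)).
  rewrite in_itv/= => x0; apply: is_deriveB.
  by apply: is_deriveB; exact: Dy.
have C : {within `[0, b], continuous (y - (fun t => w 0 * t) - (fun t => (A / 2) * t ^+ 2))}.
  apply: (@within_continuousB _ _ _ _ (y - _) (fun t => (A / 2) * t ^+ 2)); last exact: cf.
  by apply: (@within_continuousB _ _ _ _ y (fun t => w 0 * t)); [exact: cy|exact: cf].
have [x xb] := MVT bpos D C.
rewrite in_itv/= in xb; case/andP: xb => x0 xb.
rewrite /= !fctE !mulr0 expr0n/= mulr0 !subr0 => E.
have : (w x - w 0 - A / 2 * (2 * x)) * b <= 0.
  have := Hw x; rewrite (ltW x0) (ltW xb) => /(_ isT) Hx.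
  rewrite mulr_le0_ge0 ?(ltW bpos)//.
  have -> : A / 2 * (2 * x) = A * x by field.
  lra.
by rewrite -E; lra.
Qed.

End RealLemmas.

(** * Bootstrap bounds for a geodesic near the vertex *)

Section ShortGeodesics.
Context {R : realType} {M : topologicalType} (S : surface R M).
Variables (g : riemannian_metric S) (T : R) (gam : R -> M).
Hypotheses (T0 : 0 < T) (hgeo : geodesic g [set` `[0, T]] gam).
Variable c : chart R M.
Hypothesis ac : atlas S c.
Variables (p : M) (v om : plane R).
Hypotheses (cp : chart_dom c p) (gam0 : gam 0 = p).
Local Notation I := [set` `[0, T]].
Local Notation x t := (c (gam t)).
Local Notation w := (chart_velocity c I gam).
Hypothesis v0 : w 0 = v.

Variables (r Cb b : R).
Hypothesis r_img : forall z : plane R, `|z - c p| <= r -> 0 <= z 0 1 -> chart_img c z.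
Hypothesis r_acc : forall u w', chart_img c u -> `|u - c p| < r -> `|w' - om| < r ->
  `|connection g c u w' w'| <= Cb.
Hypotheses (Cb0 : 0 <= Cb) (b0 : 0 <= b) (bT : b <= T).
Hypotheses (b_vel : `|v - om| + Cb * b < r) (b_pos : (`|om| + r) * b < r).

(** While it holds, [r_acc] and the geodesic equation bound position and velocity, and by [b_pos]
    and [b_vel] these bounds are better than the assumed ones: the condition propagates up to
    [b]. *)
Definition good_time (t : R) :=
  [/\ chart_times c I gam t, `|x t - c p| < r & `|w t - om| < r].

Let r0 : 0 < r.
Proof. by apply: le_lt_trans b_vel; rewrite addr_ge0// mulr_ge0. Qed.

Let gamS : smooth_curve S I gam. Proof. by have [] := hgeo. Qed.

Let accE t : chart_times c I gam t ->
  chart_acceleration c I gam t = - connection g c (x t) (w t) (w t).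
Proof.
move=> ct; have [_ _ _ H] := hgeo.
by apply/eqP; rewrite -addr_eq0; apply/eqP; exact: H.
Qed.

Let good_bounds t : 0 <= t <= b -> (forall s, 0 <= s < t -> good_time s) ->
  chart_times c I gam t ->
  `|x t - c p| <= (`|om| + r) * t /\ `|w t - om| <= `|v - om| + Cb * t.
Proof.
move=> /andP[t0 tb] Hs ct; have tT := le_trans tb bT.
have times s : 0 <= s <= t -> chart_times c I gam s.
  move=> /andP[s0 st]; have [->//|ns] := eqVneq s t.
  by have [] := Hs s; first by rewrite s0 lt_neqAle ns.
have sub : [set` `[0, t]] `<=` I.
  move=> s; rewrite /= !in_itv/= => /andP[-> st]; exact: le_trans tT.
have D s : 0 < s < t ->
   is_derive s (1 : R) (fun s => x s) (w s) /\
   is_derive s (1 : R) w (- connection g c (x s) (w s) (w s)).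
  move=> /andP[s0 st].
  have cs : chart_times c I gam s by apply: times; rewrite !ltW.
  have sT : 0 < s < T by rewrite s0 (lt_le_trans st).
  by have := chart_curve_derive T0 gamS ac sT cs; rewrite (accE cs).
have W (f : R -> plane R) s : f q @[q --> within I (nbhs s)] --> f s ->
    f q @[q --> within [set` `[0, t]] (nbhs s)] --> f s.
  by apply: cvg_trans; apply: cvg_app; exact: within_subset.
split.
  rewrite -gam0; apply: (@mean_value_bound _ (fun s => x s) w) => //.
  - move=> s st; apply: W.
    exact: (chart_curve_continuous T0 gamS ac (times s st)).
  - by move=> s /D [].
  - move=> s /andP[s0 st]; have [_ _ h] := Hs s (introT andP (conj (ltW s0) st)).
    by rewrite -(subrK om (w s)) addrC (le_trans (ler_normD _ _))// lerD2l ltW.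
  - by rewrite addr_ge0// ltW.
have : `|w t - w 0| <= Cb * t.
  apply: (@mean_value_bound _ w (fun s => - connection g c (x s) (w s) (w s))) => //.
  - move=> s st; apply: W.
    exact: (chart_velocity_continuous T0 gamS ac (times s st)).
  - by move=> s /D [].
  - move=> s /andP[s0 st]; have [[_ cs] h1 h2] := Hs s (introT andP (conj (ltW s0) st)).
    by rewrite normrN; apply: r_acc => //; exists (gam s).
rewrite v0 => H; rewrite -(subrKA v (w t)).
by rewrite (le_trans (ler_normD _ _))// addrC lerD2l.
Qed.

Let compact_image (r' : R) : r' <= r ->
  closed (chart_inv c @` [set z : plane R | `|z - c p| <= r' /\ 0 <= z 0 1]).
Proof.
move=> r'r; apply: compact_closed; first exact: (surface_hausdorff S).
apply: continuous_compact.
  apply: (continuous_subspaceW _ (@chart_inv_continuous _ _ c)) => z [zr z0].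
  by apply: r_img => //; exact: le_trans r'r.
apply: bounded_closed_compact.
  exists (r' + `|c p|); split; first exact: num_real.
  move=> y ry z [zr _] /=; rewrite -(subrK (c p) z) (le_trans (ler_normD _ _))//.
  by rewrite (le_trans _ (ltW ry))// lerD2r.
have -> : [set z : plane R | `|z - c p| <= r' /\ 0 <= z 0 1] =
   (fun z : plane R => `|z - c p|) @^-1` [set y | y <= r'] `&`
   (fun z : plane R => z 0 1) @^-1` [set y | 0 <= y] by [].
apply: closedI; apply: closed_comp.
- move=> z _; apply: (@continuous_comp _ _ _ (fun z : plane R => z - c p) (fun z : plane R => `|z|)).
    exact: (@cvgB _ _ _ (nbhs z) _ id (cst (c p)) z (c p) cvg_id (cvg_cst (c p))).
  exact: norm_continuous.
- exact: closed_le.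
- by move=> z _; exact: coord_continuous.
- exact: closed_ge.
Qed.

(* The position stays in a smaller ball, whose image in [M] is compact, hence closed: the
   geodesic cannot leave the chart at time [t]. *)
Let good_limit t : 0 <= t <= b -> (forall s, 0 <= s < t -> good_time s) -> good_time t.
Proof.
move=> /[dup] tb /andP[t0 tb'] Hs; have tT := le_trans tb' bT.
have It : I t by rewrite /= in_itv/= t0.
have ct : chart_times c I gam t.
  have [->|tn0] := eqVneq t 0; first by split; rewrite /= ?in_itv/= ?lexx ?ltW// gam0.
  have tpos : 0 < t by rewrite lt_neqAle eq_sym tn0.
  pose r' := (`|om| + r) * b.
  have r'r : r' <= r by exact: ltW.
  pose Kc := chart_inv c @` [set z : plane R | `|z - c p| <= r' /\ 0 <= z 0 1].
  have Kgam s : 0 <= s < t -> Kc (gam s).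
    move=> /[dup] st /andP[s0 st']; have [cs _ _] := Hs s st.
    have sb : 0 <= s <= b by rewrite s0 (le_trans (ltW st')).
    have [H _] := good_bounds sb (fun q qs => Hs q (introT andP (conj (andP qs).1 (lt_trans (andP qs).2 st')))) cs.
    have cgs : chart_dom c (gam s) by case: cs.
    exists (x s); last by rewrite chart_mapK.
    split; last by apply: (@chart_img_ge0 _ _ c); exists (gam s).
    rewrite (le_trans H)// ler_wpM2l// ?addr_ge0// ?(ltW r0)//.
    by case/andP: sb.
  suff [z [zr z0] Ez] : Kc (gam t).
    split => //; rewrite /= -Ez; apply: (chart_invK _).1.
    by apply: r_img => //; exact: le_trans r'r.
  apply: contrapT => nK.
  have [cgam _] := gamS.
  have C : gam s @[s --> within I (nbhs t)] --> gam t.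
    exact: (subspace_continuousP _ _).1 cgam _ It.
  have oK : nbhs (gam t) (~` Kc).
    by apply: open_nbhs_nbhs; split => //; apply: closed_openC; exact: compact_image.
  have H : \forall s \near t, I s -> ~ Kc (gam s) := C _ oK.
  have [d /= d0 Hd] := (nbhs_ballP _ _).1 H.
  pose m := Num.min d t; have m0 : 0 < m by rewrite lt_min d0.
  have md : m <= d by rewrite ge_min lexx.
  have mt : m <= t by rewrite ge_min lexx orbT.
  have B : ball t d (t - m / 2).
    rewrite -ball_normE/= subKr gtr0_norm ?divr_gt0//; lra.
  apply: (Hd _ B); first by rewrite /= in_itv/=; apply/andP; split; lra.
  by apply: Kgam; apply/andP; split; lra.
have [h1 h2] := good_bounds tb Hs ct.
split => //.
  by rewrite (le_lt_trans h1)// (le_lt_trans _ b_pos)// ler_wpM2l// addr_ge0// ltW.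
by rewrite (le_lt_trans h2)// (le_lt_trans _ b_vel)// lerD2l ler_wpM2l.
Qed.

Let good_open t : 0 <= t < b -> good_time t ->
  exists2 d, 0 < d & forall s, t < s < t + d -> s <= b -> good_time s.
Proof.
move=> /andP[t0 tb] [ct h1 h2].
have [d d0 Hd] := chart_times_near gamS ct.
have Cx := chart_curve_continuous T0 gamS ac ct.
have Cw := chart_velocity_continuous T0 gamS ac ct.
have nx : \forall s \near t, I s -> `|x s - c p| < r.
  have nb : nbhs (x t) [set z : plane R | `|z - c p| < r].
    have : nbhs (x t) (ball (c p) r).
      by apply: open_nbhs_nbhs; split; [exact: ball_open|rewrite -ball_normE/= distrC].
    by apply: filterS => z; rewrite -ball_normE/= distrC.
  exact: Cx _ nb.
have nw : \forall s \near t, I s -> `|w s - om| < r.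
  have nb : nbhs (w t) [set z : plane R | `|z - om| < r].
    have : nbhs (w t) (ball om r).
      by apply: open_nbhs_nbhs; split; [exact: ball_open|rewrite -ball_normE/= distrC].
    by apply: filterS => z; rewrite -ball_normE/= distrC.
  exact: Cw _ nb.
have [d' /= d'0 Hd'] := (nbhs_ballP _ _).1 (filterI nx nw).
exists (Num.min d d'); first by rewrite lt_min d0.
move=> s /andP[ts]; rewrite -ltrBlDl lt_min => /andP[sd sd'] sb.
have B e : s - t < e -> ball t e s.
  by move=> h; rewrite -ball_normE/= distrC gtr0_norm ?subr_gt0.
have sT : 0 <= s <= T by rewrite (le_trans t0 (ltW ts)) (le_trans sb).
have Is : I s by rewrite /= in_itv.
have [k1 k2] := Hd' s (B _ sd').
by split; [apply: Hd => //; exact: B|exact: k1|exact: k2].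
Qed.

Lemma all_times_good t : 0 <= t <= b -> good_time t.
Proof. exact: (real_induction good_limit good_open). Qed.

End ShortGeodesics.

Lemma is_derive_scalar_line (R : realType) (V : normedModType R) (v : V) (s : R) :
  is_derive s (1 : R) (fun t : R => t *: v) v.
Proof.
have d : derivable (@id V) (0 + s *: v) v by exact: derivable_id.
have := is_derive_line d; rewrite derive_id.
rewrite (_ : (fun h : R => id (0 + h *: v)) = (fun h => h *: v))//.
by apply/funext => h; rewrite add0r.
Qed.

(** * Return time of nearly tangent chords *)

Section Chords.
Context {R : realType} {M : topologicalType} (S : surface R M).
Variables (g : riemannian_metric S) (p : M) (nu om : plane R).
Hypotheses (hp : boundary S p) (hnu : inward_unit_normal g p nu).
Hypotheses (hom : tangent_to_boundary om).
Local Notation c := (chart_at S p).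
Local Notation kappa := (second_fundamental_form g p nu om om).
Hypotheses (hk : 0 < kappa).

(** For [h <= k / 2] the difference [2 / (k - h) - 2 / k = 2 h / (k (k - h))] is at most
    [4 h / k^2], whence the choice of [h]. *)
Lemma inverse_perturbation (k eta : R) : 0 < k -> 0 < eta ->
  exists2 h, 0 < h <= k / 2 & 2 / (k - h) <= 2 / k + eta /\ 2 / k - eta <= 2 / (k + h).
Proof.
move=> k0 eta0; pose h := Num.min (k / 2) (eta * k ^+ 2 / 4).
have k2 : 0 < k ^+ 2 by rewrite exprn_gt0.
have h0 : 0 < h by rewrite lt_min !divr_gt0// mulr_gt0.
have h1 : h <= k / 2 by rewrite ge_min lexx.
have h2 : h <= eta * k ^+ 2 / 4 by rewrite ge_min lexx orbT.
have kh : 0 < k - h by lra.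
have kh' : 0 < k + h by lra.
exists h; first by rewrite h0.
split.
  rewrite ler_pdivrMr//.
  have -> : (2 / k + eta) * (k - h) = 2 + (eta * (k - h) - 2 * h / k).
    by field; rewrite gt_eqF.
  rewrite lerDl subr_ge0 ler_pdivrMr//.
  have : eta * (k / 2) * k <= eta * (k - h) * k.
    by rewrite ler_wpM2r ?(ltW k0)// ler_wpM2l ?(ltW eta0)//; lra.
  by rewrite expr2 in h2; lra.
rewrite ler_pdivlMr//.
have -> : (2 / k - eta) * (k + h) = 2 + (2 * h / k - eta * (k + h)).
  by field; rewrite gt_eqF.
rewrite gerDl subr_le0 ler_pdivrMr//.
have : eta * k * k <= eta * (k + h) * k.
  by rewrite ler_wpM2r ?(ltW k0)// ler_wpM2l ?(ltW eta0)//; lra.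
have : 0 < eta * k * k by rewrite !mulr_gt0.
by rewrite expr2 in h2; lra.
Qed.

(** The parabola vanishes at 0 and [2 e / k], so its sign at [b] compares [b] with the return
    time. *)
Lemma parabola_ge0 (n b e k : R) : 0 < n -> 0 < b ->
  0 <= e * n * b - k * n * b ^+ 2 / 2 -> b * k <= 2 * e.
Proof.
move=> n0 b0; have -> : e * n * b - k * n * b ^+ 2 / 2 = n * b * (e - k * b / 2) by field.
by rewrite pmulr_rge0 ?mulr_gt0//; lra.
Qed.

Lemma parabola_le0 (n b e k : R) : 0 < n -> 0 < b ->
  e * n * b - k * n * b ^+ 2 / 2 <= 0 -> 2 * e <= b * k.
Proof.
move=> n0 b0; have -> : e * n * b - k * n * b ^+ 2 / 2 = n * b * (e - k * b / 2) by field.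
by rewrite pmulr_rle0 ?mulr_gt0//; lra.
Qed.

Lemma short_chord (eta rW : R) : 0 < eta -> 0 < rW ->
  exists2 e0, 0 < e0 & forall e T gam, 0 < e < e0 ->
    geodesic_chord g p (om + e *: nu) T gam ->
  [/\ `|T / e - 2 / kappa| <= eta,
      forall t, 0 <= t <= T -> chart_times c [set` `[0, T]] gam t /\
        `|speed g [set` `[0, T]] gam t - Num.sqrt (inner g p om om)| <= eta &
      forall t, 0 < t < T -> 0 < t < rW /\
        exists d', [/\ ball om rW d', 0 < d' 0 1, chart_dom c (gam t) &
          c (gam t) = c p + t *: d'] ].
Proof.
move=> eta0 rW0.
have ac : atlas S c by exact: chart_at_atlas.
have cp : chart_dom c p by exact: chart_at_dom.
have ip : chart_img c (c p) by exists p.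
have cp1 : c p 0 1 = 0 by exact: hp.
have [_ _ nu1] := hnu.
have [h /andP[h0 hk2] [hk3 hk4]] := inverse_perturbation hk eta0.
have kh2 : kappa / 2 <= kappa - h by lra.
have kh : 0 < kappa - h by lra.
have kh' : 0 < kappa + h by lra.
have kE : connection g c (c p) om om 0 1 = kappa * nu 0 1.
  by rewrite (second_fundamental_formE hnu) divfK// gt_eqF.
have [r1 r10 H1] := connection_near g ac om 1 ip (mulr_gt0 h0 nu1).
have [r2 r20 H2] := connection_near g ac om 0 ip ltr01.
have [r3 r30 H3] := connection_near g ac om 1 ip ltr01.
have [r4 r40 H4] := speed_near g ac om ip eta0.
have [r5 /= r50 H5] := (nbhs_ballP _ _).1 (chart_img_near ip).
pose r := Num.min (Num.min r1 (Num.min r2 r3)) (Num.min (Num.min r4 r5) rW) / 2.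
have : 0 < r /\ [/\ r < r1, r < r2, r < r3, r < r4 & r < r5 /\ r < rW].
  have m0 : 0 < Num.min (Num.min r1 (Num.min r2 r3)) (Num.min (Num.min r4 r5) rW).
    by rewrite !lt_min r10 r20 r30 r40 r50.
  have r0 : 0 < r by rewrite divr_gt0.
  have : r < Num.min (Num.min r1 (Num.min r2 r3)) (Num.min (Num.min r4 r5) rW).
    by rewrite ltr_pdivrMr// ltr_pMr// ltr1n.
  by rewrite !lt_min => /andP[/and3P[-> -> ->] /andP[/andP[-> ->] ->]].
clearbody r; move=> [r0 [rr1 rr2 rr3 rr4 [rr5 rrW]]].
have lt_r a b : r < b -> a < r -> a < b by move=> rb ar; exact: lt_trans ar rb.
pose Cb := `|connection g c (c p) om om| + 1.
have Cb0 : 0 < Cb by rewrite ltr_wpDl.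
have r_acc u w' : chart_img c u -> `|u - c p| < r -> `|w' - om| < r ->
    `|connection g c u w' w'| <= Cb.
  move=> iu ur wr; apply: mx_norm_leP => [|i j]; first exact: ltW.
  rewrite (ord1 i).
  have D k : `|connection g c u w' w' 0 k - connection g c (c p) om om 0 k| <= 1 ->
      `|connection g c u w' w' 0 k| <= Cb.
    move=> hk'; rewrite -(subrK (connection g c (c p) om om 0 k) (connection g c u w' w' 0 k)).
    by rewrite (le_trans (ler_normD _ _))// addrC lerD// mx_coord_le.
  move: j; apply: ord2P; apply: D.
    by apply: H2 => //; apply: lt_r; eauto.
  by apply: H3 => //; apply: lt_r; eauto.
have r_img (z : plane R) : `|z - c p| <= r -> 0 <= z 0 1 -> chart_img c z.
  move=> zr z0; apply: H5 => //; rewrite -ball_normE/= distrC.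
  exact: le_lt_trans rr5.
pose Y := `|om| + r + 1.
have Y0 : 0 < Y by rewrite ltr_wpDl// addr_ge0// ltW.
(* A time independent of [e]: up to [d0] the velocity drifts by at most [r / 4] and the position by
   less than [r], and [d0 < rW]. *)
pose d0 := Num.min (Num.min (r / (4 * Cb)) (r / (2 * Y))) (rW / 2).
have d00 : 0 < d0 by rewrite !lt_min !divr_gt0// mulr_gt0.
have d01 : Cb * d0 <= r / 4.
  have : d0 <= r / (4 * Cb) by rewrite !ge_min lexx.
  by rewrite ler_pdivlMr ?mulr_gt0//; lra.
have d02 : (`|om| + r) * d0 < r.
  have : d0 <= r / (2 * Y) by rewrite !ge_min lexx orbT.
  rewrite ler_pdivlMr ?mulr_gt0// /Y => H.
  by lra.
have d03 : d0 < rW.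
  have : d0 <= rW / 2 by rewrite !ge_min lexx !orbT.
  by lra.
clearbody d0.
pose N := `|nu| + 1; have N0 : 0 < N by rewrite ltr_wpDl.
(* The first bound limits the initial deviation [e *: nu] to [r / 2]; the second gives
   [2 e < d0 kappa / 2], which forces the return before [d0]. *)
pose e0 := Num.min (r / (2 * N)) (d0 * kappa / 4).
have e00 : 0 < e0 by rewrite lt_min !divr_gt0// mulr_gt0.
have e01 : e0 * N <= r / 2.
  have : e0 <= r / (2 * N) by rewrite ge_min lexx.
  by rewrite ler_pdivlMr ?mulr_gt0//; lra.
have e02 : e0 <= d0 * kappa / 4 by rewrite ge_min lexx orbT.
clearbody e0.
exists e0 => // e T gam /andP[ep ee0] [[T0 geo g0 vel0] [nbd bd]].
set I := [set` `[0, T]] in geo vel0 *.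
pose x t := c (gam t); pose w := chart_velocity c I gam.
have w0 : w 0 = om + e *: nu by rewrite -vel0 /velocity g0.
have gamS : smooth_curve S I gam by case: geo.
have good b : 0 <= b -> b <= T -> b <= d0 -> forall t, 0 <= t <= b ->
    good_time T gam c p om r t.
  move=> b0 bT bd0; apply: (all_times_good T0 geo ac cp g0 w0 r_img r_acc (ltW Cb0) b0 bT).
    rewrite addrAC subrr add0r normrZ gtr0_norm//.
    have : e * `|nu| <= e * N by rewrite ler_wpM2l ?(ltW ep)// lerDl.
    have : e * N < e0 * N by rewrite ltr_pM2r.
    have : Cb * b <= Cb * d0 by rewrite ler_wpM2l// ltW.
    by lra.
  apply: le_lt_trans d02; apply: ler_wpM2l => //.
  by apply: addr_ge0 => //; exact: ltW.
have img_x t : chart_times c I gam t -> chart_img c (x t).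
  by move=> [_ ct]; exists (gam t).
have x00 : x 0 0 1 = 0 by rewrite /x g0.
have w01 : w 0 0 1 = e * nu 0 1 by rewrite w0 addmxE scalemxE hom add0r.
have sub b : b <= T -> [set` `[0, b]] `<=` I.
  by move=> bT s; rewrite /I /= !in_itv/= => /andP[-> sb]; exact: le_trans bT.
have Wi (f : R -> plane R) b s : b <= T -> f q @[q --> within I (nbhs s)] --> f s ->
    f q @[q --> within [set` `[0, b]] (nbhs s)] --> f s.
  by move=> bT; apply: cvg_trans; apply: cvg_app; apply: within_subset; exact: sub.
have Dx b s : 0 <= b -> b <= T -> b <= d0 -> 0 < s < b ->
   is_derive s (1 : R) x (w s) /\
   is_derive s (1 : R) w (- connection g c (x s) (w s) (w s)).
  move=> b0 bT bd0 /andP[s0 sb].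
  have sb' : 0 <= s <= b by rewrite !ltW.
  have [cs _ _] := good b b0 bT bd0 s sb'.
  have sT : 0 < s < T by rewrite s0 (lt_le_trans sb).
  have [_ _ _ G] := geo.
  have aE : chart_acceleration c I gam s = - connection g c (x s) (w s) (w s).
    by apply/eqP; rewrite -addr_eq0; apply/eqP; exact: G.
  by have := chart_curve_derive T0 gamS ac sT cs; rewrite aE.
have Cx b : 0 <= b -> b <= T -> b <= d0 -> {within `[0, b], continuous (fun t => x t 0 1)}.
  move=> b0 bT bd0; apply/subspace_continuousP => s; rewrite /= in_itv/= => sb.
  apply: (@within_coord _ x); apply: Wi => //.
  by have [cs _ _] := good b b0 bT bd0 s sb; exact: (chart_curve_continuous T0 gamS ac cs).
have Cw b : 0 <= b -> b <= T -> b <= d0 -> {within `[0, b], continuous (fun t => w t 0 1)}.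
  move=> b0 bT bd0; apply/subspace_continuousP => s; rewrite /= in_itv/= => sb.
  apply: (@within_coord _ w); apply: Wi => //.
  by have [cs _ _] := good b b0 bT bd0 s sb; exact: (chart_velocity_continuous T0 gamS ac cs).
have acc_bound b s : 0 <= b -> b <= T -> b <= d0 -> 0 < s < b ->
    `|connection g c (x s) (w s) (w s) 0 1 - kappa * nu 0 1| <= h * nu 0 1.
  move=> b0 bT bd0 /andP[s0 sb]; rewrite -kE.
  have sb' : 0 <= s <= b by rewrite !ltW.
  have [cs k1 k2] := good b b0 bT bd0 s sb'.
  by apply: H1; [exact: img_x|exact: lt_r k1|exact: lt_r k2].
have upper b : 0 <= b -> b <= T -> b <= d0 ->
    x b 0 1 <= e * nu 0 1 * b - (kappa - h) * nu 0 1 * b ^+ 2 / 2.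
  move=> b0 bT bd0.
  have := @second_order_bound _ (fun t => x t 0 1) (fun t => w t 0 1)
    (fun s => (- connection g c (x s) (w s) (w s)) 0 1) b (- ((kappa - h) * nu 0 1)) b0
    (Cx b b0 bT bd0) (Cw b b0 bT bd0).
  rewrite /= x00 w01 add0r !mulNr; apply.
  - by move=> t tb; apply: (is_derive_coord 1); case: (Dx b t b0 bT bd0 tb).
  - by move=> t tb; apply: (is_derive_coord 1); case: (Dx b t b0 bT bd0 tb).
  - move=> t tb; rewrite oppmxE.
    have := acc_bound b t b0 bT bd0 tb; rewrite ler_norml lerBrDr => /andP[H _].
    by rewrite lerN2 mulrBl [leLHS]addrC.
have lower b : 0 <= b -> b <= T -> b <= d0 ->
    e * nu 0 1 * b - (kappa + h) * nu 0 1 * b ^+ 2 / 2 <= x b 0 1.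
  move=> b0 bT bd0.
  have CN (f : R -> R) : {within `[0, b], continuous f} -> {within `[0, b], continuous (- f)}.
    by move=> cf t; apply: cvgN; exact: cf.
  have := @second_order_bound _ (- (fun t => x t 0 1)) (- (fun t => w t 0 1))
    (- (fun s => (- connection g c (x s) (w s) (w s)) 0 1)) b ((kappa + h) * nu 0 1) b0
    (CN _ (Cx b b0 bT bd0)) (CN _ (Cw b b0 bT bd0)).
  rewrite /= !fctE x00 w01 oppr0 add0r !mulNr => B.
  suff : - x b 0 1 <= - (e * nu 0 1 * b) + (kappa + h) * nu 0 1 * b ^+ 2 / 2.
    by move=> H; rewrite -lerN2 opprB [leRHS]addrC.
  apply: B.
  - by move=> t tb; apply: is_deriveN; apply: (is_derive_coord 1); case: (Dx b t b0 bT bd0 tb).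
  - by move=> t tb; apply: is_deriveN; apply: (is_derive_coord 1); case: (Dx b t b0 bT bd0 tb).
  - move=> t tb; rewrite oppmxE opprK.
    have := acc_bound b t b0 bT bd0 tb; rewrite ler_norml lerBlDr => /andP[_ H].
    by rewrite mulrDl [leRHS]addrC.
have xge0 b : 0 <= b -> b <= T -> b <= d0 -> 0 <= x b 0 1.
  move=> b0 bT bd0; have bb : 0 <= b <= b by rewrite b0 lexx.
  have [cb _ _] := good b b0 bT bd0 b bb.
  exact: chart_img_ge0 (img_x b cb).
have bound_b b : 0 < b -> b <= T -> b <= d0 -> b * (kappa - h) <= 2 * e.
  move=> b0 bT bd0; apply: (parabola_ge0 nu1 b0).
  by apply: le_trans (upper b (ltW b0) bT bd0); exact: xge0 (ltW b0) bT bd0.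
(* Before its return the chord has [x t 0 1 >= 0], while the upper bound becomes negative
   after the time [2 e / (kappa - h) < d0]. *)
have Td0 : T <= d0.
  rewrite leNgt; apply/negP => dT.
  have I1 := bound_b d0 d00 (ltW dT) (lexx _).
  have I2 : d0 * (kappa / 2) <= d0 * (kappa - h).
    by rewrite ler_wpM2l ?(ltW d00).
  by move: e02 ee0 I1 I2; clear => *; lra.
have TT := good T (ltW T0) (lexx _) Td0.
have xT0 : x T 0 1 = 0.
  have TTT : 0 <= T <= T by rewrite lexx ltW.
  have [[_ cT] _ _] := TT T TTT.
  exact: (boundaryE g ac cT).1.
split.
- have T1 : T / e <= 2 / (kappa - h).
    rewrite ler_pdivrMr// mulrAC ler_pdivlMr//.
    exact: bound_b.
  have T2 : 2 / (kappa + h) <= T / e.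
    rewrite ler_pdivlMr// mulrAC ler_pdivrMr//.
    by apply: (parabola_le0 nu1 T0); rewrite -xT0; exact: lower (ltW T0) (lexx _) Td0.
  move: T1 T2 hk3 hk4; clear; rewrite ler_norml => *.
  by apply/andP; split; lra.
- move=> t tT; have [ct k1 k2] := TT t tT; split => //.
  rewrite (speed_chart g T0 gamS ac ct)//.
  by apply: H4; [exact: img_x|exact: lt_r k1|exact: lt_r k2].
- move=> t /[dup] tT /andP[t0 tT'].
  have tT2 : 0 <= t <= T by rewrite !ltW.
  have [ct k1 k2] := TT t tT2.
  split; first by rewrite t0 (lt_trans tT')// (le_lt_trans Td0).
  exists (t^-1 *: (x t - c p)).
  have td0 : t <= d0 by rewrite (le_trans (ltW tT')).
  have cgt : chart_dom c (gam t) by case: ct.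
  split => //.
  + have lin (s : R) := is_derive_scalar_line om s.
    (* The velocity stays within [r] of [om], hence so does the secant from [c p], which is the
       direction [d']. *)
    have : `|(x t - t *: om) - (x 0 - 0 *: om)| <= r * t.
      apply: (@mean_value_bound _ (x - (fun s : R => s *: om)) (fun s => w s - om)).
      * exact: ltW.
      * move=> s st; apply: cvgB.
          have sT2 : 0 <= s <= T by case/andP: st => -> st; rewrite (le_trans st)// ltW.
          have [cs _ _] := TT s sT2.
          apply: Wi; first exact: ltW.
          exact: (chart_curve_continuous T0 gamS ac cs).
        by apply: cvg_within_filter; exact: scalel_continuous.
      * by move=> s st; apply: is_deriveB; case: (Dx t s (ltW t0) (ltW tT') td0 st).
      * move=> s /andP[s0 st]; have sT2 : 0 <= s <= T by rewrite (ltW s0) (le_trans (ltW st))// ltW.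
        by have [_ _ k] := TT s sT2; exact: ltW.
      * exact: ltW.
    rewrite scale0r subr0 {2}/x g0 => B.
    rewrite -ball_normE/= distrC.
    have -> : t^-1 *: (x t - c p) - om = t^-1 *: (x t - t *: om - c p).
      by rewrite addrAC [RHS]scalerBr scalerA mulVf ?gt_eqF// scale1r.
    rewrite normrZ gtr0_norm ?invr_gt0// (le_lt_trans _ rrW)//.
    by rewrite mulrC ler_pdivrMr.
  + rewrite scalemxE addmxE oppmxE cp1 subr0 mulr_gt0 ?invr_gt0//.
    rewrite lt_neqAle eq_sym xge0 ?(ltW t0) ?(ltW tT')// andbT.
    apply/eqP => xt0; apply: (nbd t tT).
    exact/(boundaryE g ac cgt).
  + by rewrite scalerA mulfV ?gt_eqF// scale1r addrC subrK.
Qed.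

End Chords.

(** * The X-ray transform *)

Lemma within_eq_cvg (T U : topologicalType) (f h : T -> U) (A : set T) (t : T) :
  A t -> (forall s, A s -> f s = h s) ->
  h s @[s --> within A (nbhs t)] --> h t -> f s @[s --> within A (nbhs t)] --> f t.
Proof.
move=> At fh; rewrite (fh _ At); apply: cvg_trans; apply: near_eq_cvg.
by rewrite near_withinE; apply: nearW => s As; rewrite fh.
Qed.

Section Integral.
Context {R : realType}.
Local Notation mu := (@lebesgue_measure R).

(** [phi] is known on the open interval only, because [f] vanishes at the vertex from which the
    chord starts; the endpoints have measure zero. *)
Lemma Rintegral_near_one (phi sigma : R -> R) (a T eta : R) : 0 < T ->
  {within `[0, T], continuous sigma} ->
  (forall t, 0 <= t <= T -> `|sigma t - 1| <= eta) ->
  (forall t, 0 < t < T -> phi t = a) ->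
  `|\int[mu]_(t in `[0, T]) (phi t * sigma t) - a * T| <= `|a| * (eta * T).
Proof.
move=> T0 cs sb pa.
have ics : mu.-integrable `[0, T] (EFin \o sigma).
  by apply: continuous_compact_integrable; [exact: segment_compact|exact: cs].
have icst (k : R) : mu.-integrable `[0, T] (EFin \o (fun _ : R => k)).
  apply: continuous_compact_integrable; first exact: segment_compact.
  by apply: continuous_subspaceT => t; exact: cst_continuous.
have sub : `]0, T[%classic `<=` `[0, T]%classic by exact: subset_itv_oo_cc.
have ia : mu.-integrable `[0, T] (EFin \o (fun t => a * sigma t)).
  apply: continuous_compact_integrable; first exact: segment_compact.
  by move=> t; apply: cvgM; [exact: cvg_cst|exact: cs].
have endpoints (h : R -> R) : measurable_fun `]0, T[ h ->
    \int[mu]_(t in `]0, T[) h t = \int[mu]_(t in `[0, T]) h t.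
  move=> mh; congr fine.
  have mh' : measurable_fun `]0, T] h by exact/measurable_fun_itv_bndo_bndcP.
  rewrite integral_itv_bndo_bndc; last exact/measurable_EFinP.
  by rewrite integral_itv_obnd_cbnd//; exact/measurable_EFinP.
have ma' : measurable_fun `[0, T] (fun t => a * sigma t).
  by apply/measurable_EFinP; exact: (measurable_int mu ia).
have ma : measurable_fun `]0, T[ (fun t => a * sigma t) by exact: measurable_funS ma'.
have mp : measurable_fun `]0, T[ (fun t => phi t * sigma t).
  apply: eq_measurable_fun ma => t.
  by rewrite inE/= in_itv/= => tT; rewrite pa.
have E3 : \int[mu]_(t in `]0, T[) (phi t * sigma t) = \int[mu]_(t in `]0, T[) (a * sigma t).
  by apply: eq_Rintegral => t; rewrite inE/= in_itv/= => tT; rewrite pa.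
rewrite -(endpoints _ mp) E3 (endpoints _ ma) RintegralZl// -mulrBr normrM ler_wpM2l//.
set J := \int[mu]_(t in `[0, T]) sigma t.
have mT (k : R) : \int[mu]_(t in `[0, T]) k = k * T.
  by rewrite Rintegral_cst//= lebesgue_measure_itv/= lte_fin T0 -EFinD/= subr0.
rewrite ler_norml; apply/andP; split.
  have : \int[mu]_(t in `[0, T]) (1 - eta) <= J.
    apply: le_Rintegral => // t; rewrite /= in_itv/= => /sb.
    by rewrite ler_norml => /andP[]; lra.
  by rewrite mT; clearbody J; move: J; clear => J; lra.
have : J <= \int[mu]_(t in `[0, T]) (1 + eta).
  apply: le_Rintegral => // t; rewrite /= in_itv/= => /sb.
  by rewrite ler_norml => /andP[]; lra.
by rewrite mT; clearbody J; move: J; clear => J; lra.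
Qed.

End Integral.

Section Speed.
Context {R : realType} {M : topologicalType} (S : surface R M).
Variables (g : riemannian_metric S) (T : R) (gam : R -> M).
Hypotheses (T0 : 0 < T) (gamS : smooth_curve S [set` `[0, T]] gam).
Variable c : chart R M.
Hypothesis ac : atlas S c.
Local Notation I := [set` `[0, T]].

Lemma speed_continuous : (forall t, 0 <= t <= T -> chart_times c I gam t) ->
  {within I, continuous (speed g I gam)}.
Proof.
move=> ct; apply/subspace_continuousP => t; rewrite /= in_itv/= => tT.
pose x s := c (gam s); pose w := chart_velocity c I gam.
pose q s := (w s *m metric_mx g c (x s) *m (w s)^T) 0 0.
have FF : Filter (within I (nbhs t)) by exact: within_filter.
have Cx := chart_curve_continuous T0 gamS ac (ct t tT).
have Cw := chart_velocity_continuous T0 gamS ac (ct t tT).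
(* The metric is continuous only relative to the image of the chart, so the convergence of the curve
   has to be stated inside it. *)
have Cx' : x s @[s --> within I (nbhs t)] --> within (chart_img c) (nbhs (x t)).
  move=> P nP.
  have nP' : \forall v \near x t, chart_img c v -> P v := nP.
  have H : \forall s \near t, I s -> chart_img c (x s) -> P (x s) := Cx _ nP'.
  suff : \forall s \near t, I s -> P (x s) by [].
  apply: filterS H => s Hs Is; apply: Hs => //.
  have [_ cs] : chart_times c I gam s by apply: ct; move: Is; rewrite /= in_itv.
  by exists (gam s).
have it : chart_img c (x t) by have [_ cs] := ct t tT; exists (gam t).
have CG i j : metric_mx g c (x s) i j @[s --> within I (nbhs t)] --> metric_mx g c (x t) i j.
  apply: (@cvg_comp _ _ _ x (fun v => metric_mx g c v i j) _ _ _ Cx').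
  exact: metric_continuous.
have Cwi i : w s 0 i @[s --> within I (nbhs t)] --> w t 0 i by exact: within_coord.
have Q : q s @[s --> within I (nbhs t)] --> q t.
  have qE s : q s = _ := quadratic_formE g c (x s) (w s).
  rewrite qE; under eq_fun do rewrite qE.
  by apply: cvgD; apply: cvgM => //; apply: cvgD; apply: cvgM.
have SQ : Num.sqrt (q s) @[s --> within I (nbhs t)] --> Num.sqrt (q t).
  by apply: (@cvg_comp _ _ _ q Num.sqrt _ _ _ Q); exact: sqrt_continuous.
have E s : 0 <= s <= T -> speed g I gam s = Num.sqrt (q s).
  by move=> /ct cs; exact: (speed_chart g T0 gamS ac cs).
suff : speed g I gam s @[s --> within I (nbhs t)] --> speed g I gam t by [].
apply: (within_eq_cvg _ _ SQ); first by rewrite /= in_itv.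
by move=> s' Is; apply: E; move: Is; rewrite /= in_itv.
Qed.

End Speed.

(** * Limit of the normalized ray integral *)

Section Limit.
Context {R : realType} {M : topologicalType} (S : surface R M).
Variables (g : riemannian_metric S) (p : M) (nu om : plane R).
Hypotheses (hp : boundary S p) (hnu : inward_unit_normal g p nu).
Hypotheses (hom : tangent_to_boundary om) (hom1 : inner g p om om = 1).
Local Notation c := (chart_at S p).
Local Notation kappa := (second_fundamental_form g p nu om om).
Hypotheses (hk : 0 < kappa).
Variables (f : M -> R) (a rW : R) (D : set M).
Hypotheses (rW0 : 0 < rW) (fa : forall q, D q -> f q = a).
Hypothesis wedge : forall d' rho, ball om rW d' -> 0 < rho < rW -> 0 < d' 0 1 ->
  exists q, [/\ D q, chart_dom c q & c q = c p + rho *: d'].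
Variables (T : R -> R) (gam : R -> R -> M).
Hypothesis hgam : forall e, 0 < e -> geodesic_chord g p (om + e *: nu) (T e) (gam e).

Lemma xray_quotient_limit :
  e^-1 * xray g f (T e) (gam e) @[e --> 0^'+] --> 2 * a / kappa.
Proof.
apply/cvgrPdist_le => eps eps0.
(* The return time contributes an error [|a| eta], the speed at most [|a| eta (2 / kappa + 1)]; [X]
   bounds their sum divided by [eta], the added 1 keeping it positive when [a = 0]. *)
pose X := (`|a| + 1) * (2 / kappa + 2).
have X1 : 0 < 2 / kappa by rewrite divr_gt0.
have X0 : 0 < X by apply: mulr_gt0; [rewrite ltr_wpDl|rewrite addr_gt0].
pose eta := Num.min 1 (eps / X).
have eta0 : 0 < eta by rewrite lt_min ltr01 divr_gt0.
have eta1 : eta <= 1 by rewrite ge_min lexx.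
have etaX : eta * X <= eps.
  by rewrite -ler_pdivlMr// ge_min lexx orbT.
have [e0 e00 He0] := short_chord hp hnu hom hk eta0 rW0.
near=> e.
have ep : 0 < e by near: e; exact: nbhs_right_gt.
have ee0 : e < e0 by near: e; exact: nbhs_right_lt.
have chord := hgam ep.
have [Te cts win] := He0 e (T e) (gam e) (introT andP (conj ep ee0)) chord.
have [[T0 geo g0 vel0] _] := chord.
have gamS : smooth_curve S [set` `[0, T e]] (gam e) by case: geo.
have ac : atlas S c by exact: chart_at_atlas.
have cont := @speed_continuous _ _ _ g _ _ T0 gamS c ac (fun t tT => (cts t tT).1).
have near1 t : 0 <= t <= T e -> `|speed g [set` `[0, T e]] (gam e) t - 1| <= eta.
  by move=> /cts [_]; rewrite hom1 sqrtr1.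
have fgam t : 0 < t < T e -> f (gam e t) = a.
  move=> /win [tr [d' [dd' d'0 cg Eg]]].
  have [q [Dq cq Eq]] := wedge dd' tr d'0.
  have -> : gam e t = q by rewrite -(chart_mapK cg) -(chart_mapK cq) Eg Eq.
  exact: fa.
have B := Rintegral_near_one T0 cont near1 fgam.
rewrite -/(xray g f (T e) (gam e)) in B.
have -> : 2 * a / kappa - e^-1 * xray g f (T e) (gam e) =
    - (a * (T e / e - 2 / kappa) + e^-1 * (xray g f (T e) (gam e) - a * T e)).
  by field; rewrite (gt_eqF ep) (gt_eqF hk).
rewrite normrN (le_trans (ler_normD _ _))// !normrM (gtr0_norm (_ : 0 < e^-1)) ?invr_gt0//.
have I1 : `|a| * `|T e / e - 2 / kappa| <= `|a| * eta by rewrite ler_wpM2l.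
have ei0 : 0 <= e^-1 by rewrite invr_ge0 ltW.
have I2 := ler_wpM2l ei0 B.
have I3 : e^-1 * (`|a| * (eta * T e)) = `|a| * eta * (T e / e).
  by field; rewrite gt_eqF.
have I4 : T e / e <= 2 / kappa + 1.
  by move: Te; rewrite ler_norml => /andP[_]; lra.
have I5 : `|a| * eta * (T e / e) <= `|a| * eta * (2 / kappa + 1).
  by rewrite ler_wpM2l// mulr_ge0// ltW.
have I6 : `|a| * eta * (2 / kappa + 2) <= eta * X.
  rewrite /X mulrA ler_wpM2r//; first by rewrite addr_ge0// ltW.
  by rewrite mulrC ler_wpM2l ?(ltW eta0)// lerDl.
rewrite I3 in I2; lra.
Unshelve. all: by end_near. Qed.

Lemma xray_quotient_value : cvg (e^-1 * xray g f (T e) (gam e) @[e --> 0^'+]) /\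
  a = kappa / 2 * lim (e^-1 * xray g f (T e) (gam e) @[e --> 0^'+]).
Proof.
have C := xray_quotient_limit; split; first by apply/cvg_ex; exists (2 * a / kappa).
rewrite (cvg_lim _ C)//; field.
by rewrite gt_eqF.
Qed.

End Limit.

Theorem lemma4p1 (R : realType) (M : topologicalType) (S : surface R M)
    (g : riemannian_metric S)
    (hcompact : compact [set: M])
    (hnontrap : nontrapping g)
    (hconvex : strictly_convex_boundary g)
    (K : Type) (s : K -> plane R -> M)
    (htiling : regular_tiling S s)
    (f : M -> R) (hf : piecewise_constant s f)
    (p : M) (hp : boundary S p) (hvertex : tiling_vertex s p)
    (nu om : plane R)
    (hnu : inward_unit_normal g p nu)
    (hom : tangent_to_boundary om) (hom1 : inner g p om om = 1)
    (n : nat) (D : 'I_n.+1 -> K) (hD : tile_enumeration S s p om nu D)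
    (a1 aN : R)
    (ha1 : forall x, tile_interior s (D ord0) x -> f x = a1)
    (haN : forall x, tile_interior s (D ord_max) x -> f x = aN)
    (T1 TN : R -> R) (gam1 gamN : R -> R -> M)
    (hgam1 : forall e, 0 < e ->
       geodesic_chord g p (om + e *: nu) (T1 e) (gam1 e))
    (hgamN : forall e, 0 < e ->
       geodesic_chord g p (- om + e *: nu) (TN e) (gamN e)) :
  let kappa := second_fundamental_form g p nu om om in
  (cvg (e^-1 * xray g f (T1 e) (gam1 e) @[e --> 0^'+]) /\
   a1 = kappa / 2 * lim (e^-1 * xray g f (T1 e) (gam1 e) @[e --> 0^'+])) /\
  (cvg (e^-1 * xray g f (TN e) (gamN e) @[e --> 0^'+]) /\
   aN = kappa / 2 * lim (e^-1 * xray g f (TN e) (gamN e) @[e --> 0^'+])).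
Proof.
have om_neq0 : om != 0.
  apply/eqP => om0; move: hom1; rewrite om0 /inner !mul0mx mxE => /eqP.
  by rewrite eq_sym oner_eq0.
have om0 : om 0 0 != 0.
  apply: contra om_neq0 => /eqP om00; apply/eqP/rowP; apply: ord2P; rewrite [RHS]mxE.
    exact: om00.
  exact: hom.
have nu1 : 0 < nu 0 1 by case: hnu.
have kpos := hconvex p nu hp hnu om hom om_neq0.
split.
  have [rW rW0 wedge] := wedge_in_tile htiling hp hD
    (others_avoid_first htiling hp hvertex hom om0 nu1 hD).
  exact: (xray_quotient_value hp hnu hom hom1 kpos rW0 ha1 wedge hgam1).
have [rW rW0 wedge] := wedge_in_tile htiling hp hD
  (others_avoid_last htiling hp hvertex hom om0 nu1 hD).
have hom' : tangent_to_boundary (- om) by rewrite /tangent_to_boundary oppmxE hom oppr0.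
have homN : inner g p (- om) (- om) = 1 by rewrite innerN.
(* The second fundamental form is even, so [- om] sees the same [kappa] and can play the role of
   [om]. *)
rewrite -(second_fundamental_formN hnu) in kpos *.
exact: (xray_quotient_value hp hnu hom' homN kpos rW0 haN wedge hgamN).
Qed.
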